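(* Let $T>0$ be fixed, $h_n=T/n$. Let $k^*\in\mathbb{N}$ and assume the null hypothesis $H_0$ that the true number of factors equals $k^*$ (so the data are generated by the $k^*$-factor model with true parameter $\theta_{k^*,0}$). Suppose that: (i) there is $C>0$ with $|b_{k^*,0}(x)-b_{k^*,0}(y)|\le C|x-y|$ for all $x,y\in\mathbb{R}^{k^*}$; $\sup_{t}\mathbb{E}[|f_{k^*,t}|^\ell]<\infty$ for all $\ell\ge 0$; and $b_{k^*,0}\in C^4_\uparrow(\mathbb{R}^{k^*})$; (ii) there is $C>0$ with $|B_{i,0}(x)-B_{i,0}(y)|\le C|x-y|$ for all $x,y\in\mathbb{R}$ and $i=1,\dots,p$; $\sup_{t}\mathbb{E}[|e_t|^\ell]<\infty$ for all $\ell\ge0$; and $B_{i,0}\in C^4_\uparrow(\mathbb{R})$ for $i=1,\dots,p$; (iii) $\sigma_i>0$ ($i=1,\dots,p$) for every $\theta_{k^*}\in\Theta_{k^*}$; (iv) for $\theta_{k^*}\in\Theta_{k^*}$, $\Sigma_{k^*}(\theta_{k^*})=\Sigma_{k^*}(\theta_{k^*,0})$ implies $\theta_{k^*}=\theta_{k^*,0}$; (v) $\mathrm{rank}\,\Delta_{k^*}=q_{k^*}$. Then, as $h_n\to0$ (equivalently $n\to\infty$), the statistic $T_{k^*,n}=nF_{k^*,n}(Q_{XX},\Sigma_{k^*}(\hat\theta_{k^*,n}))$ satisfies $$T_{k^*,n}\to\chi^2_{\bar p-q_{k^*}}\quad\text{in distribution.}$$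
   Context: Fix integers $1\le k^*<p$ and $r\ge1$. Parameter: $\theta_{k^*}=(\mathrm{vec}(A_{k^*})^\top,\mathrm{vech}(\Sigma_{ff,k^*})^\top,\sigma_1^2,\dots,\sigma_p^2)^\top\in\Theta_{k^*}\subset\mathbb{R}^{q_{k^*}}$, where $A_{k^*}\in\mathbb{R}^{(p-k^* )\times k^*}$, $\Sigma_{ff,k^*}=S_{k^*}S_{k^*}^\top$ with $S_{k^*}\in\mathbb{R}^{k^*\times r}$, $q_{k^*}=(p-k^* )k^*+\frac{k^*(k^*+1)}2+p$, and $\Theta_{k^*}$ is convex and compact. $\Lambda_{k^*}\in\mathbb{R}^{p\times k^*}$ has top block $I_{k^*}$ and bottom block $A_{k^*}$, and $\Sigma_{k^*}(\theta_{k^*})=\Lambda_{k^*}\Sigma_{ff,k^*}\Lambda_{k^*}^\top+\mathrm{diag}(\sigma_1^2,\dots,\sigma_p^2)$. The true parameter is $\theta_{k^*,0}\in\mathrm{Int}(\Theta_{k^*})$, with components $A_{k^*,0},\Sigma_{ff,k^*,0}=S_{k^*,0}S_{k^*,0}^\top,\sigma_{i,0}^2$ and loading matrix $\Lambda_{k^*,0}$. Under $H_0$ the observed process is $X_t=\Lambda_{k^*,0}f_{k^*,t}+e_t$, $t\in[0,T]$, with $df_{k^*,t}=b_{k^*,0}(f_{k^*,t})dt+S_{k^*,0}dW_t$, $f_{k^*,0}=c_1\in\mathbb{R}^{k^*}$, and $de^{(i)}_t=B_{i,0}(e^{(i)}_t)dt+\sigma_{i,0}dB^{(i)}_t$ ($i=1,\dots,p$),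 $e_0=c_2\in\mathbb{R}^p$; $W$ is an $r$-dimensional standard Wiener process, $B^{(1)},\dots,B^{(p)}$ are independent one-dimensional standard Wiener processes independent of $W$; $b_{k^*,0}:\mathbb{R}^{k^*}\to\mathbb{R}^{k^*}$, $B_{i,0}:\mathbb{R}\to\mathbb{R}$; initial values are deterministic. Suprema over $t$ are over $[0,T]$. No ergodicity is assumed. Observations are $X_{t_i^n}$, $t_i^n=ih_n$, $0\le i\le n$, $T=nh_n$, and $Q_{XX}=\frac1T\sum_{i=1}^n(X_{t_i^n}-X_{t_{i-1}^n})(X_{t_i^n}-X_{t_{i-1}^n})^\top$. $\bar p=p(p+1)/2$; vec and vech are vectorization and half-vectorization; $D_p$ is the $p^2\times\bar p$ duplication matrix ($\mathrm{vec}A=D_p\mathrm{vech}A$ for symmetric $A$), $D_p^+=(D_p^\top D_p)^{-1}D_p^\top$, $W_{k^*}(\theta_{k^*})=2D_p^+(\Sigma_{k^*}(\theta_{k^*})\otimes\Sigma_{k^*}(\theta_{k^*}))D_p^{+\top}$. $\Delta_{k^*}$ is the $\bar p\times q_{k^*}$ Jacobian of $\theta_{k^*}\mapsto\mathrm{vech}(\Sigma_{k^*}(\theta_{k^*}))$ at $\theta_{k^*,0}$. The contrast function is $F_{k^*,n}(Q_{XX},\Sigma_{k^*}(\theta_{k^*}))=(\mathrm{vech}(Q_{XX})-\mathrm{vech}(\Sigma_{k^*}(\theta_{k^*})))^\top W_{k^*}^{-1}(\theta_{k^*})(\mathrm{vech}(Q_{XX})-\mathrm{vech}(\Sigma_{k^*}(\theta_{k^*})))$,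 and $\hat\theta_{k^*,n}$ is a minimizer of $\theta_{k^*}\mapsto F_{k^*,n}(Q_{XX},\Sigma_{k^*}(\theta_{k^*}))$ over $\Theta_{k^*}$. $\chi^2_m$ is the chi-squared distribution with $m$ degrees of freedom ($\chi^2_0$ being the point mass at $0$). $C^4_\uparrow(\mathbb{R}^d)$ is the set of functions that are four times continuously differentiable and that, together with all derivatives up to order 4, have polynomial growth, i.e. are bounded in absolute value by $C(1+|x|)^C$ for some $C>0$ (componentwise for vector-valued functions). *)

(* Defs.v *)
From HB Require Import structures.
From mathcomp Require Import all_boot all_order all_algebra.
From mathcomp Require Import mxtens.
From mathcomp Require Import all_classical all_reals all_analysis measurable_realfun.

Set Implicit Arguments.
Unset Strict Implicit.
Unset Printing Implicit Defensive.
Set SsrOldRewriteGoalsOrder.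

Import Order.TTheory GRing.Theory Num.Theory.
Import numFieldNormedType.Exports.

Local Open Scope classical_set_scope.
Local Open Scope ring_scope.

(* Vectors of R^d are column vectors throughout. [mxtens_index (j, i)] is the
   position j * m + i, which makes [vec] column stacking and consistent with
   the row and column indexing of the Kronecker product [*t]. *)
Definition vec (R : Type) (m n : nat) (A : 'M[R]_(m, n)) : 'cV[R]_(n * m) :=
  \col_l A (mxtens_unindex l).2 (mxtens_unindex l).1.

Definition unvec (R : Type) (m n : nat) (v : 'cV[R]_(n * m)) : 'M[R]_(m, n) :=
  \matrix_(i, j) v (mxtens_index (j, i)) ord0.

Lemma vecK (R : Type) (m n : nat) : cancel (@vec R m n) (@unvec R m n).
Proof. by move=> A; apply/matrixP => i j; rewrite !mxE mxtens_indexK. Qed.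

Definition pbar (p : nat) : nat := (p * p.+1)./2.

Definition vech_pairs (p : nat) : seq ('I_p * 'I_p) :=
  [seq (i, j) | j : 'I_p <- enum 'I_p,
                i : 'I_p <- [seq i : 'I_p <- enum 'I_p | (j <= i)%N]].

Lemma size_vech_pairs p : size (vech_pairs p) == pbar p.
Proof.
rewrite size_allpairs_dep /pbar sumnE big_map big_enum /=.
rewrite (eq_bigr (fun j : 'I_p => p - j)%N); last first.
  move=> j _; rewrite size_filter.
  have -> : count (fun i : 'I_p => j <= i)%N (enum 'I_p)
          = count (fun i : nat => j <= i)%N (iota 0 p).
    by rewrite -val_enum_ord count_map; apply: eq_count.
  have -> : iota 0 p = iota 0 j ++ iota j (p - j).
    by rewrite -[X in _ ++ iota X _]add0n -iotaD subnKC // ltnW.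
  rewrite count_cat.
  rewrite (@eq_in_count _ _ pred0) ?count_pred0 ?add0n; last first.
    by move=> i; rewrite mem_iota add0n => /andP[_ ij]; rewrite leqNgt ij.
  rewrite (@eq_in_count _ _ predT) ?count_predT ?size_iota //.
  by move=> i; rewrite mem_iota => /andP[->].
rewrite (reindex_inj rev_ord_inj) /=.
rewrite (eq_bigr (fun i : 'I_p => i.+1)); last by move=> i _; rewrite subKn.
rewrite -(big_mkord xpredT succn) -(big_add1 _ _ 0%N p.+1 xpredT id) /=.
by apply/eqP; rewrite -[LHS]add0n -(@big_ltn _ _ _ 0%N p.+1 id) // bin2_sum bin2 mulnC.
Qed.

(* The position (row, column) of the l-th entry of the half-vectorization,
   which stacks the columns of the lower triangle. *)
Definition vech_pos (p : nat) (l : 'I_(pbar p)) : 'I_p * 'I_p :=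
  tnth (Tuple (size_vech_pairs p)) l.

Definition vech (R : Type) (p : nat) (A : 'M[R]_p) : 'cV[R]_(pbar p) :=
  \col_l A (vech_pos l).1 (vech_pos l).2.

Lemma vech_pos_le p (l : 'I_(pbar p)) : ((vech_pos l).2 <= (vech_pos l).1)%N.
Proof.
have := mem_tnth l (Tuple (size_vech_pairs p)); rewrite -/(vech_pos l).
case/allpairsPdep => j [i [_]]; rewrite mem_filter => /andP[ji _] ->; exact: ji.
Qed.

Lemma vech_pos_inj p : injective (@vech_pos p).
Proof.
apply/tuple_uniqP; rewrite allpairs_uniq_dep ?enum_uniq //.
  by move=> j _; rewrite filter_uniq ?enum_uniq.
by move=> [a b] [c d] _ _ /= [-> ->].
Qed.

Lemma vech_pos_surj p (i j : 'I_p) : (j <= i)%N -> exists l, vech_pos l = (i, j).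
Proof.
move=> ji; have : (i, j) \in Tuple (size_vech_pairs p).
  apply/allpairsPdep; exists j, i; split=> //; rewrite ?mem_filter ?ji /=;
    by rewrite -enumT mem_enum.
by case/tnthP => l ->; exists l.
Qed.

Definition dup_mx (R : pzRingType) (p : nat) : 'M[R]_(p * p, pbar p) :=
  \matrix_(l, m) ((vech_pos m == ((mxtens_unindex l).2, (mxtens_unindex l).1))
               || (vech_pos m == mxtens_unindex l))%:R.

Lemma dup_mxP (R : pzRingType) (p : nat) (A : 'M[R]_p) :
  A^T = A -> vec A = dup_mx R p *m vech A.
Proof.
move=> sA; apply/colP => l; rewrite !mxE.
have [m Em] : exists m, vech_pos m = ((mxtens_unindex l).2, (mxtens_unindex l).1)
                     \/ vech_pos m = mxtens_unindex l.
  have [/vech_pos_surj[m]|/ltnW/vech_pos_surj[m]] :=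
    leqP (mxtens_unindex l).1 (mxtens_unindex l).2; exists m; first by left.
  by right.
rewrite (bigD1 m) //= big1 ?addr0 => [|m' m'm]; rewrite !mxE.
  case: Em => Em; rewrite Em eqxx ?orbT mul1r //.
  by rewrite -[in LHS]sA mxE.
case: (mxtens_unindex l) Em (vech_pos_le m) (vech_pos_le m') => j i /= Em lem lem'.
case: orP => [Em'|]; last by rewrite mul0r.
case/eqP: m'm; apply: vech_pos_inj; move: lem lem'.
have {}Em' : vech_pos m' = (i, j) \/ vech_pos m' = (j, i).
  by case: Em' => /eqP; [left|right].
by case: Em Em' => -> [] -> //= h1 h2; have /val_inj -> : val i = val j
  by apply/eqP; rewrite eqn_leq h1 h2.
Qed.

Definition dup_pinv (R : comUnitRingType) (p : nat) : 'M[R]_(pbar p, p * p) :=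
  invmx ((dup_mx R p)^T *m dup_mx R p) *m (dup_mx R p)^T.

(* The symmetric matrix with half-vectorization [v]. *)
Definition unvech (R : pzRingType) (p : nat) (v : 'cV[R]_(pbar p)) : 'M[R]_p :=
  unvec (dup_mx R p *m v).

Lemma vechK (R : pzRingType) (p : nat) (A : 'M[R]_p) :
  A^T = A -> unvech (vech A) = A.
Proof. by move=> sA; rewrite /unvech -dup_mxP // vecK. Qed.

Definition qdim (p k : nat) : nat := (k * (p - k) + pbar k + p)%N.

(* theta = (vec A, vech Sigma_ff, sigma_1^2, ..., sigma_p^2). *)
Definition loadA (R : Type) (p k : nat) (theta : 'cV[R]_(qdim p k)) :
  'M[R]_(p - k, k) := unvec (usubmx (usubmx theta)).

Definition Sigma_ff (R : pzRingType) (p k : nat) (theta : 'cV[R]_(qdim p k)) :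
  'M[R]_k := unvech (dsubmx (usubmx theta)).

Definition sigma2 (R : Type) (p k : nat) (theta : 'cV[R]_(qdim p k)) :
  'cV[R]_p := dsubmx theta.

(* The volatility sigma_i is the nonnegative root of the component sigma_i^2. *)
Definition sigma (R : rcfType) (p k : nat) (theta : 'cV[R]_(qdim p k))
  (i : 'I_p) : R := Num.sqrt (sigma2 theta i ord0).

Definition Lambda (R : pzRingType) (p k : nat) (kp : (k <= p)%N)
    (theta : 'cV[R]_(qdim p k)) : 'M[R]_(p, k) :=
  castmx (subnKC kp, erefl k) (col_mx 1%:M (loadA theta)).

Definition Sigma (R : pzRingType) (p k : nat) (kp : (k <= p)%N)
    (theta : 'cV[R]_(qdim p k)) : 'M[R]_p :=
  Lambda kp theta *m Sigma_ff theta *m (Lambda kp theta)^T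
  + diag_mx (sigma2 theta)^T.

Definition Wmx (R : comUnitRingType) (p k : nat) (kp : (k <= p)%N)
    (theta : 'cV[R]_(qdim p k)) : 'M[R]_(pbar p) :=
  2%:R *: (dup_pinv R p *m (Sigma kp theta *t Sigma kp theta)
           *m (dup_pinv R p)^T).

(* The library Jacobian ['J] acts on row vectors by right multiplication, so
   it is the transpose of the usual one. *)
Definition Delta (R : realType) (p k : nat) (kp : (k <= p)%N)
    (theta : 'cV[R]_(qdim p k)) : 'M[R]_(pbar p, qdim p k) :=
  ('J (fun x : 'rV[R]_(qdim p k) => (vech (Sigma kp x^T))^T) theta^T)^T.

Definition contrast (R : comUnitRingType) (p k : nat) (kp : (k <= p)%N)
    (Q : 'M[R]_p) (theta : 'cV[R]_(qdim p k)) : R :=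
  let u := vech Q - vech (Sigma kp theta) in
  (u^T *m invmx (Wmx kp theta) *m u) ord0 ord0.

Definition is_minimizer (R : realType) (V : Type) (D : set V) (F : V -> R)
    (x : V) : Prop :=
  D x /\ forall y, D y -> F x <= F y.

(* The norm of the library on column vectors is the sup norm. *)
Definition enorm (R : rcfType) (d : nat) (x : 'cV[R]_d) : R :=
  Num.sqrt (\sum_i x i ord0 ^+ 2).

Definition poly_growth (R : realType) (d : nat) (g : 'cV[R]_d -> R) : Prop :=
  exists2 C : R, 0 < C & forall x, `|g x| <= C * (1 + enorm x) `^ C.

(* n times continuously differentiable, with polynomial growth of the function
   and of its partial derivatives up to order n. *)
Fixpoint C_up (R : realType) (d n : nat) (g : 'cV[R]_d -> R^o) : Prop :=
  [/\ continuous g, poly_growth g &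
    if n is n'.+1 then
      forall i : 'I_d, (forall x, derivable g x (delta_mx i ord0)) /\
        C_up n' (fun x => 'D_(delta_mx i ord0) g x)
    else True].

Definition history (R : realType) (d : measure_display) (Omega : measurableType d)
    (Y : R -> Omega -> R) (t : R) : set (set Omega) :=
  <<s [set E | exists (u : R) (B : set R),
       [/\ 0 <= u <= t, measurable B & E = Y u @^-1` B]] >>.

Definition independent_families (R : realType) (d : measure_display)
    (Omega : measurableType d) (P : probability Omega R) (I : finType)
    (G : I -> set (set Omega)) : Prop :=
  forall E : I -> set Omega, (forall i, G i (E i)) ->
    P (\bigcap_i E i) = (\prod_i fine (P (E i)))%:E.

(* One-dimensional standard Wiener process on [0, T]. [normal_prob] takes the
   standard deviation. *)
Definition wiener (R : realType) (d : measure_display) (Omega : measurableType d)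
    (P : probability Omega R) (T : R) (Y : R -> Omega -> R) : Prop :=
  [/\ forall t : R, 0 <= t <= T -> measurable_fun setT (Y t),
      {ae P, forall omega, Y 0 omega = 0},
      forall s t : R, 0 <= s -> s < t -> t <= T ->
        forall B : set R, measurable B ->
          P [set omega | B (Y t omega - Y s omega)] =
            normal_prob 0 (Num.sqrt (t - s)) B,
      forall s t : R, 0 <= s -> s < t -> t <= T ->
        forall (E : set Omega) (B : set R), history Y s E -> measurable B ->
          P (E `&` [set omega | B (Y t omega - Y s omega)]) =
            (P E * P [set omega | B (Y t omega - Y s omega)%R])%E &
      {ae P, forall omega, {within `[0, T], continuous (fun t => Y t omega)}}].

(* Y_t = c + \int_0^t (drift)_s ds + noise_t on [0, T]: as every diffusion
   coefficient is constant, the stochastic integral of S dW is S W_t. *)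
Definition solves_sde (R : realType) (d : measure_display)
    (Omega : measurableType d) (P : probability Omega R) (T c : R)
    (drift noise Y : R -> Omega -> R) : Prop :=
  [/\ forall t : R, 0 <= t <= T -> measurable_fun setT (Y t),
      {ae P, forall omega, {within `[0, T], continuous (fun t => Y t omega)}} &
      {ae P, forall omega, forall t : R, 0 <= t <= T ->
        Y t omega = c + (\int[lebesgue_measure]_(s in `[0, t]) drift s omega)
                    + noise t omega}].

Definition bounded_moments (R : realType) (d : measure_display)
    (Omega : measurableType d) (P : probability Omega R) (T : R) (m : nat)
    (Y : R -> Omega -> 'cV[R]_m) : Prop :=
  forall l : R, 0 <= l ->
    (ereal_sup [set 'E_P[fun omega => (enorm (Y t omega) `^ l)%R]
               | t in `[0%R, T]] < +oo)%E.

Definition QXX (R : realType) (Omega : Type) (p : nat) (T : R)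
    (X : R -> Omega -> 'cV[R]_p) (n : nat) (omega : Omega) : 'M[R]_p :=
  let h := T / n%:R in
  let dX (i : nat) := X (i.+1%:R * h) omega - X (i%:R * h) omega in
  T^-1 *: \sum_(i < n) dX i *m (dX i)^T.

Definition add_sqr (R : realType) (x : measurableTypeR R * measurableTypeR R) :
  measurableTypeR R := (x.1 : R) + (x.2 : R) ^+ 2.

Lemma measurable_add_sqr (R : realType) : measurable_fun setT (@add_sqr R).
Proof.
have mfst : measurable_fun setT
    (fun x : measurableTypeR R * measurableTypeR R => x.1 : R).
  exact: (@measurable_fst _ _ (measurableTypeR R) (measurableTypeR R)).
have msnd : measurable_fun setT
    (fun x : measurableTypeR R * measurableTypeR R => x.2 : R).
  exact: (@measurable_snd _ _ (measurableTypeR R) (measurableTypeR R)).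
exact: (measurable_funD mfst (measurable_funX 2 msnd)).
Qed.

HB.instance Definition _ (R : realType) :=
  isMeasurableFun.Build _ _ _ _ (@add_sqr R) (@measurable_add_sqr R).

(* The law of the sum of squares of m independent standard normal variables. *)
Fixpoint chi2 (R : realType) (m : nat) : probability (measurableTypeR R) R :=
  if m is m'.+1 then
    distribution (chi2 R m' \x normal_prob 0 1)%E (@add_sqr R)
  else \d_(0 : measurableTypeR R).

Definition cvg_in_distribution (R : realType) (d : measure_display)
    (Omega : measurableType d) (P : probability Omega R)
    (Y : nat -> Omega -> R) (mu : probability (measurableTypeR R) R) : Prop :=
  (forall n, measurable_fun setT (Y n)) /\
  forall g : R -> R, continuous g -> (exists M : R, forall x, `|g x| <= M) ->
    ('E_P[g \o Y n])%E @[n --> \oo] --> (\int[mu]_x (g x)%:E)%E.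

(* Main.v *)
From HB Require Import structures.
From mathcomp Require Import all_boot all_order all_algebra.
From mathcomp Require Import mxtens ring lra.
From mathcomp Require Import all_classical all_reals all_analysis measurable_realfun.
Require Import Defs.

(* With constant diffusion coefficients the increments of X over the grid are
   N dZ + dD, where N N^T = Sigma(theta0), Z collects all driving Wiener
   processes and D is continuously differentiable. Summation by parts against
   the uniformly continuous derivative of D shows, path by path, that the cross
   terms in sqrt n (vech Q_XX - vech Sigma(theta0)) vanish, up to the factor
   1 + |a_n|, where a_n is the same quantity built from N dZ alone; hence neither
   the moment assumptions nor the smoothness of the drifts (beyond continuity)
   matter. Deterministically, n times the minimal contrast is
   |M a_n|^2 + o(1 + |a_n|^2), where M W(theta0) M^T = 1 and M kills the columns
   of Delta. The coordinates of M a_n are normalized sums of quadratic forms in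
   independent Gaussian increments; the Laplace transform of |M a_n|^2 is an
   average of characteristic functions of such sums over an independent Gaussian
   direction, and converges to that of the chi-squared law. Laplace transforms of
   nonnegative variables determine convergence in distribution by the Weierstrass
   approximation theorem. *)

Set Implicit Arguments.
Unset Strict Implicit.
Unset Printing Implicit Defensive.

Import Order.TTheory GRing.Theory Num.Theory.
Import numFieldNormedType.Exports.

Local Open Scope classical_set_scope.
Local Open Scope ring_scope.

(** * Independence *)

(** The vectors $a_n$ converge only in law, so along a path the error is small only relative to
    $1+|a_n|^2$. Hence the almost sure statement is $\min(1,|V_n-q_n|)/(1+|a_n|^2)\to0$, with $V_n$
    the statistic and $q_n=|Ma_n|^2$; a uniform bound on $\mathbb E|a_n|^2$ then gives $\mathbb
    E\min(1,|V_n-q_n|)\to0$, which suffices to compare Laplace transforms. The degrees of freedom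
    come from $M$: its $\bar p-q$ rows form a basis of the left kernel of [Delta], orthonormal for
    $W(\theta_0)$. The factor $2$ in $W$ is the factor $2$ in the variance $2\|H\|_F^2$ of a centred
    quadratic form, which makes the limit law of $Ma_n$ standard normal. The characteristic function
    of the normal law is itself drawn from the quantitative limit theorem: a Wiener increment is,
    for every $n$, a sum of $n$ independent smaller ones. The estimator is any pointwise minimizer,
    possibly not measurable; the statistic is measurable because the minimal value is an infimum
    over a countable dense subset of $\Theta$. *)

Section indep.
Context {R : realType} {d : measure_display} {Omega : measurableType d}.
Variable P : probability Omega R.

Definition mutually_independent (I : finType) (g : I -> Omega -> R) :=
  forall B : I -> set R, (forall i, measurable (B i)) ->
    P (\bigcap_i (g i @^-1` B i)) = (\prod_i fine (P (g i @^-1` B i)))%:E.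

(** A generating $\pi$-system for the $\sigma$-algebra of the coordinates in [J]. Measurability for
    [<<s cylinders g J >>] is how dependence on those coordinates alone is expressed. *)
Definition cylinders (I : finType) (g : I -> Omega -> R) (J : {pred I}) :
    set (set Omega) :=
  [set E | exists2 B : I -> set R, (forall i, measurable (B i)) &
           E = \bigcap_(i in [set` J]) (g i @^-1` B i)].

Lemma cylinders_setI (I : finType) (g : I -> Omega -> R) (J : {pred I}) :
  setI_closed (cylinders g J).
Proof.
move=> _ _ [B mB ->] [C mC ->]; exists (fun i => B i `&` C i).
  by move=> i; exact: measurableI.
rewrite -bigcapI; apply: eq_bigcapr => i _.
by rewrite preimage_setI.
Qed.

Lemma cylinders_setT (I : finType) (g : I -> Omega -> R) (J : {pred I}) :
  cylinders g J setT.
Proof.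
exists (fun=> setT) => //; apply/esym.
by rewrite bigcapT.
Qed.

Lemma sub_cylinders_measurable (I : finType) (g : I -> Omega -> R) (J : {pred I}) :
  (forall i, measurable_fun setT (g i)) -> cylinders g J `<=` measurable.
Proof.
move=> mg _ [B mB ->]; apply: fin_bigcap_measurable => // i _.
by rewrite -[X in measurable X]setTI; exact: mg.
Qed.

Lemma measurable_cylinders (I : finType) (g : I -> Omega -> R) (J : {pred I}) i :
  i \in J -> measurable_fun setT (g i : g_sigma_algebraType (cylinders g J) -> R).
Proof.
move=> iJ _ B mB; rewrite setTI; apply: sub_sigma_algebra.
exists (fun j => if j == i then B else setT).
  by move=> j; case: ifP.
apply/seteqP; split => [w Bw j _|w /(_ i iJ)] /=; last by rewrite eqxx.
by case: eqP => [->|].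
Qed.

(** Sets at indices outside [J] or [K] are padded with [setT], so both events become full product
    events; as [J] and [K] are disjoint, at each index one of the two factors is trivial. *)
Lemma independent_cylinders (I : finType) (g : I -> Omega -> R) (J K : {pred I}) :
  (forall i, measurable_fun setT (g i)) -> mutually_independent g ->
  {in J, forall i, i \notin K} ->
  forall A B, cylinders g J A -> cylinders g K B -> P (A `&` B) = (P A * P B)%E.
Proof.
move=> mg ig JK A B [C mC ->] [D mD ->].
pose restr (L : {pred I}) (F : I -> set R) i := if i \in L then F i else setT.
have restrE (L : {pred I}) F : \bigcap_(i in [set` L]) (g i @^-1` F i)
    = \bigcap_i (g i @^-1` restr L F i).
  apply/seteqP; split => w Fw i /=; first by move=> _; rewrite /restr; case: ifP => // /Fw.
  by move=> iL; have := Fw i Logic.I; rewrite /restr /= ifT.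
have mrestr (L : {pred I}) F : (forall i, measurable (F i)) ->
    forall i, measurable (restr L F i).
  by move=> mF i; rewrite /restr; case: ifP.
rewrite !restrE -bigcapI.
under eq_bigcapr do rewrite -preimage_setI.
have mJ := mrestr J _ mC; have mK := mrestr K _ mD.
rewrite ig ?(ig (restr J C)) ?(ig (restr K D))//; last first.
  by move=> i; exact: measurableI.
rewrite -EFinM -big_split/=; congr EFin; apply: eq_bigr => i _.
rewrite /restr; case: ifPn => iJ.
  by rewrite (negbTE (JK i iJ)) setIT preimage_setT probability_setT/= mulr1.
by rewrite setTI preimage_setT probability_setT/= mul1r.
Qed.

(** Dynkin's argument, one event at a time: for fixed $B$ the finite measures $A\mapsto P(A\cap B)$
    and $A\mapsto P(A)P(B)$ agree on cylinders, which form a $\pi$-system. *)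
Lemma independent_sigma (I : finType) (g : I -> Omega -> R) (J K : {pred I}) :
  (forall i, measurable_fun setT (g i)) -> mutually_independent g ->
  {in J, forall i, i \notin K} ->
  forall A B, <<s cylinders g J >> A -> <<s cylinders g K >> B ->
    P (A `&` B) = (P A * P B)%E.
Proof.
move=> mg ig JK.
have sub L C : <<s cylinders g L >> C -> measurable C.
  move=> sC; apply: sC; split; last exact: sub_cylinders_measurable.
  exact: sigma_algebra_measurable.
have ext L (B : set Omega) : measurable B ->
    (forall A, cylinders g L A -> P (A `&` B) = (P A * P B)%E) ->
    forall A, <<s cylinders g L >> A -> P (A `&` B) = (P A * P B)%E.
  move=> mB AB A sA.
  pose r := NngNum (fine_ge0 (measure_ge0 P B)).
  have rE : r%:num%:E = P B by rewrite /= fineK// fin_num_measure.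
  transitivity (mrestr P mB A) => //.
  transitivity (mscale r P A); last by rewrite /mscale/= rE muleC.
  apply: (g_sigma_algebra_measure_unique (cylinders g L) _ (fun=> setT)) sA.
  - exact: sub_cylinders_measurable.
  - by move=> _; exact: cylinders_setT.
  - by rewrite bigcup_const.
  - exact: cylinders_setI.
  - move=> C cC; change (P (C `&` B) = ((fine (P B))%:E * P C)%E).
    by rewrite AB// fineK ?fin_num_measure// muleC.
  - move=> _; change (P (setT `&` B) < +oo)%E.
    by rewrite setTI -rE ltry.
move=> A B sA sB; apply: (ext J) => //; first exact: sub sB.
move=> C cC; rewrite setIC muleC; apply: (ext K) => //.
  exact: (sub_cylinders_measurable mg) cC.
by move=> D cD; rewrite setIC muleC (independent_cylinders mg ig JK).
Qed.

Lemma measurable_of_cylinders (I : finType) (g : I -> Omega -> R) (J : {pred I})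
    (U : Omega -> R) : (forall i, measurable_fun setT (g i)) ->
  measurable_fun setT (U : g_sigma_algebraType (cylinders g J) -> R) ->
  measurable_fun setT U.
Proof.
move=> mg mU _ B mB; rewrite setTI.
have := mU measurableT B mB; rewrite setTI => sC; apply: sC; split.
  exact: sigma_algebra_measurable.
exact: sub_cylinders_measurable.
Qed.

(* The joint law of two independent variables is the product of their laws. *)
Lemma independent_expectationM (U V : Omega -> R) :
  measurable_fun setT U -> measurable_fun setT V ->
  (forall A B : set R, measurable A -> measurable B ->
     P (U @^-1` A `&` V @^-1` B) = (P (U @^-1` A) * P (V @^-1` B))%E) ->
  P.-integrable setT (EFin \o U) -> P.-integrable setT (EFin \o V) ->
  P.-integrable setT (fun w => (U w * V w)%:E) ->
  \int[P]_w (U w * V w) = (\int[P]_w U w) * (\int[P]_w V w).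
Proof.
move=> mU mV UV iU iV iUV.
have mUV : measurable_fun setT (fun w => (U w, V w) : R * R).
  exact: measurable_fun_pair.
pose Um : {mfun Omega >-> R} := HB.pack U (isMeasurableFun.Build _ _ _ _ _ mU).
pose Vm : {mfun Omega >-> R} := HB.pack V (isMeasurableFun.Build _ _ _ _ _ mV).
pose W : {mfun Omega >-> (R * R)%type} :=
  HB.pack (fun w => (U w, V w)) (isMeasurableFun.Build _ _ _ _ _ mUV).
pose xy (z : R * R) := (z.1 * z.2)%:E.
have mxy : measurable_fun setT xy.
  by apply/measurable_EFinP; apply: measurable_funM; [exact: measurable_fst|exact: measurable_snd].
(* Independence is the factorization on rectangles, and rectangles determine the product measure. *)
have WE (X : set (R * R)) : measurable X ->
    (distribution P Um \x distribution P Vm)%E X = distribution P W X.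
  move=> mX; apply: (@product_measure_unique _ _ _ _ _ _ _ (distribution P W)) => //.
have ixyW : (distribution P W).-integrable setT xy.
  by apply: integrable_pushforward => //.
have ixy : (distribution P Um \x distribution P Vm)%E.-integrable setT xy.
  apply/integrableP; split => //.
  rewrite (eq_measure_integral (distribution P W)); last by move=> A mA _; exact: WE.
  by case/integrableP: ixyW.
rewrite /Rintegral.
have -> : (\int[P]_w (U w * V w)%:E = \int[distribution P W]_z xy z)%E.
  by rewrite integral_distribution.
rewrite -(@eq_measure_integral _ _ _ _ (distribution P W) (distribution P Um \x distribution P Vm)%E); last first.
  by move=> A mA _; exact: WE.
rewrite -integral12_prod_meas1//.
have iVm : (distribution P Vm).-integrable setT (EFin : R -> \bar R).
  by apply: integrable_pushforward => //; exact/measurable_EFinP.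
have iUm : (distribution P Um).-integrable setT (EFin : R -> \bar R).
  by apply: integrable_pushforward => //; exact/measurable_EFinP.
have EV : (\int[distribution P Vm]_y y%:E = \int[P]_w (V w)%:E)%E.
  by rewrite integral_distribution//; exact/measurable_EFinP.
have EU : (\int[distribution P Um]_y y%:E = \int[P]_w (U w)%:E)%E.
  by rewrite integral_distribution//; exact/measurable_EFinP.
have fV : (\int[P]_w (V w)%:E)%E \is a fin_num by exact: integrable_fin_num.
transitivity (fine (\int[distribution P Um]_x (x%:E * \int[P]_w (V w)%:E))%E).
  congr fine; apply: eq_integral => x _.
  by rewrite -EV -integralZl.
by rewrite -{1}(fineK fV) integralZr// EU fineM ?integrable_fin_num.
Qed.

Lemma independent_cylinders_expectationM (I : finType) (g : I -> Omega -> R)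
    (J K : {pred I}) (U V : Omega -> R) :
  (forall i, measurable_fun setT (g i)) -> mutually_independent g ->
  {in J, forall i, i \notin K} ->
  measurable_fun setT (U : g_sigma_algebraType (cylinders g J) -> R) ->
  measurable_fun setT (V : g_sigma_algebraType (cylinders g K) -> R) ->
  P.-integrable setT (EFin \o U) -> P.-integrable setT (EFin \o V) ->
  P.-integrable setT (fun w => (U w * V w)%:E) ->
  \int[P]_w (U w * V w) = (\int[P]_w U w) * (\int[P]_w V w).
Proof.
move=> mg ig JK mU mV; apply: independent_expectationM.
- exact: measurable_of_cylinders mU.
- exact: measurable_of_cylinders mV.
move=> A B mA mB; apply: (independent_sigma mg ig JK).
- by have := mU measurableT A mA; rewrite setTI.
- by have := mV measurableT B mB; rewrite setTI.
Qed.

End indep.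

(** * Gaussian moments *)

Section normal_moments.
Context {R : realType}.
Notation mu := (@lebesgue_measure R).

(** The Radon-Nikodym derivative of [normal_prob] and the function [normal_pdf] have equal integrals
    over every measurable set, hence agree almost everywhere and may be exchanged under the
    integral. *)
Lemma ge0_integral_normal_prob (s : R) (f : R -> \bar R) :
  measurable_fun setT f -> (forall x, 0 <= f x)%E ->
  (\int[normal_prob 0 s]_x f x = \int[mu]_x (f x * (normal_pdf 0 s x)%:E))%E.
Proof.
move=> mf f0; pose nu := normal_prob 0 s.
have dom := normal_prob_dominates 0 s.
rewrite -(Radon_Nikodym_SigmaFinite.change_of_variables dom)//.
apply: ae_eq_integral => //.
- apply: emeasurable_funM => //; apply: (measurable_int mu).
  exact: Radon_Nikodym_SigmaFinite.f_integrable dom.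
- apply: emeasurable_funM => //; apply/measurable_EFinP.
  exact: measurable_normal_pdf.
- apply: ae_eqe_mul2l; apply: integral_ae_eq => //.
  + exact: Radon_Nikodym_SigmaFinite.f_integrable dom.
  + by apply/measurable_EFinP; exact: measurable_normal_pdf.
  + by move=> E _ mE; rewrite -(Radon_Nikodym_SigmaFinite.f_integral dom).
Qed.

(** Half of the exponent is spent on the power: in $e^{-x^2/(2s^2)}=e^{-x^2/(4s^2)}e^{-x^2/(4s^2)}$
    the first factor absorbs $|x|^k$ and the second is the normal kernel of deviation $\sqrt2\,s$.
    This yields both integrability of the moments and decay of the boundary terms. *)
Lemma normal_fun_moment_bound (s : R) (k : nat) : s != 0 ->
  exists2 C, 0 <= C & forall x : R,
    `|x| ^+ k * normal_fun 0 s x <= C * normal_fun 0 (Num.sqrt 2 * s) x.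
Proof.
move=> s0; have s2 : 0 < s ^+ 2 by rewrite exprn_even_gt0.
pose C : R := (k.+1)`!%:R * (4 * s ^+ 2) ^+ k.+1.
have C0 : 0 <= C by rewrite mulr_ge0// exprn_ge0// mulr_ge0// ltW.
exists (1 + C) => [|x]; first by rewrite addr_ge0.
have xk : `|x| ^+ k <= 1 + (x ^+ 2) ^+ k.+1.
  have -> : (x ^+ 2) ^+ k.+1 = `|x| ^+ (2 * k.+1) by rewrite exprM real_normK// num_real.
  have [x1|x1] := leP `|x| 1.
    by rewrite (@le_trans _ _ 1)// ?exprn_ile1// lerDl exprn_ge0.
  rewrite (@le_trans _ _ (`|x| ^+ (2 * k.+1)))// ?lerDr// ler_eXn2l//.
  by rewrite mul2n -addnn (leq_trans (leqnSn k))// leq_addr.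
have y0 : 0 <= x ^+ 2 / (4 * s ^+ 2).
  by rewrite divr_ge0 ?sqr_ge0// mulr_ge0// ltW.
have yk : (x ^+ 2) ^+ k.+1 <= C * expR (x ^+ 2 / (4 * s ^+ 2)).
  have s4 : 0 < (4 * s ^+ 2) ^+ k.+1 by rewrite exprn_gt0// mulr_gt0.
  have := expR_ge1Dxn k y0; rewrite expr_div_n => h.
  have {}h : (x ^+ 2) ^+ k.+1 / (4 * s ^+ 2) ^+ k.+1 / (k.+1)`!%:R <=
    expR (x ^+ 2 / (4 * s ^+ 2)) by apply: le_trans h; rewrite lerDr.
  move: h; rewrite ler_pdivrMr ?ltr0n ?fact_gt0// ler_pdivrMr//.
  by move=> /le_trans; apply; rewrite /C le_eqVlt; apply/orP; left; apply/eqP; ring.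
have e1 : 1 <= expR (x ^+ 2 / (4 * s ^+ 2)) by rewrite -[leLHS]expR0 ler_expR.
have -> : normal_fun 0 s x =
    expR (- (x ^+ 2 / (4 * s ^+ 2))) * normal_fun 0 (Num.sqrt 2 * s) x.
  rewrite /normal_fun -expRD subr0 exprMn sqr_sqrtr//; congr expR; field.
  by rewrite s0.
rewrite mulrA ler_wpM2r ?expR_ge0// expRN ler_pdivrMr ?expR_gt0//.
by rewrite mulrDl mul1r (le_trans xk)// lerD.
Qed.

Lemma integrable_normal_fun_moment (s : R) (k : nat) : s != 0 ->
  mu.-integrable setT (fun x => (x ^+ k * normal_pdf 0 s x)%:E).
Proof.
move=> s0; have [C C0 hC] := normal_fun_moment_bound k s0.
have s20 : Num.sqrt 2 * s != 0 by rewrite mulf_neq0// gt_eqF// sqrtr_gt0.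
have i2 := integrable_normal_pdf 0 (Num.sqrt 2 * s).
pose D := normal_peak s * C / normal_peak (Num.sqrt 2 * s).
apply: (@le_integrable _ _ _ mu setT _ _
  (fun x => (D * normal_pdf 0 (Num.sqrt 2 * s) x)%:E)) => //.
- apply/measurable_EFinP; apply: measurable_funM; first exact: measurable_funX.
  exact: measurable_normal_pdf.
- move=> x _; rewrite !lee_fin [leRHS]ger0_norm; last first.
    rewrite mulr_ge0 ?normal_pdf_ge0// divr_ge0 ?normal_peak_ge0//.
    by rewrite mulr_ge0 ?normal_peak_ge0.
  rewrite !normal_pdfE// normrM normrX [`|_ * normal_fun _ _ _|]ger0_norm; last first.
    by rewrite mulr_ge0 ?normal_peak_ge0// expR_ge0.
  rewrite /D mulrCA [leRHS]mulrA divfK ?gt_eqF ?normal_peak_gt0// -mulrA.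
  by rewrite ler_wpM2l ?normal_peak_ge0.
- exact: (integrableZl measurableT D i2).
Qed.

(** The fundamental theorem on $[-n-1,n+1]$ leaves boundary values that vanish in the limit;
    dominated convergence by $|f|$ identifies this limit with the full integral. *)
Lemma integral_derive_eq0 (F f : R -> R) :
  (forall x : R, is_derive x (1 : R) F (f x)) -> continuous f ->
  mu.-integrable setT (EFin \o f) ->
  F n%:R @[n --> \oo] --> 0 -> F (- n%:R) @[n --> \oo] --> 0 ->
  (\int[mu]_x (f x)%:E = 0)%E.
Proof.
move=> dF cf intf Fp Fn.
pose I (n : nat) : set R := [set` `[- n.+1%:R, n.+1%:R]].
have F0 : (\int[mu]_(x in I n) (f x)%:E)%E @[n --> \oo] --> 0%E.
  have -> : (fun n => \int[mu]_(x in I n) (f x)%:E)%E =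
            (fun n => ((F n.+1%:R - F (- n.+1%:R))%:E)).
    apply/funext => n.
    rewrite (@continuous_FTC2 _ f F) ?EFinB//.
    - by rewrite gtrN.
    - by apply: continuous_subspaceT => x; exact: cf.
    - have dFx x : derivable F x 1 by have [] := dF x.
      have cF : continuous F by move=> x; apply/differentiable_continuous/derivable1_diffP.
      split; first by move=> x _.
      + exact/cvg_at_right_filter/cF.
      + exact/cvg_at_left_filter/cF.
    - by move=> x _; rewrite derive1E; apply/derive_val.
  apply: cvg_EFin; first exact: nearW.
  rewrite -[0]subr0; apply: cvgB.
    by have := Fp; rewrite -(cvg_shiftS (fun n => F n%:R)).
  by have := Fn; rewrite -(cvg_shiftS (fun n => F (- n%:R))).
have mf : measurable_fun setT (EFin \o f) := measurable_int mu intf.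
pose fI n : R -> \bar R := (EFin \o f) \_ (I n).
have mfI n : measurable_fun setT (fI n).
  have mI : measurable (I n) by exact: measurable_itv.
  by apply: (measurable_restrictT _ mI).1; exact: measurable_funTS.
have fI_f : {ae mu, forall x, setT x -> fI n x @[n --> \oo] --> (f x)%:E}.
  apply: aeW => x _; apply: cvg_near_cst.
  exists (Num.truncn `|x|) => // n /= nx.
  rewrite /fI patchE ifT//; apply/mem_set; rewrite /I/= in_itv/= -ler_norml.
  by rewrite (le_trans (ltW (truncnS_gt _)))// ler_nat ltnS.
have fI_le : {ae mu, forall x n, setT x -> (`|fI n x| <= `|(f x)%:E|)%E}.
  apply: aeW => x n _; rewrite /fI patchE; case: ifP => // _; rewrite abse0.
  exact: abse_ge0.
have [_ _ h] := @dominated_convergence _ _ R mu setT measurableT fI (EFin \o f) _ mfI mf fI_f (integrable_abse intf) fI_le.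
apply: (cvg_unique _ h) => //.
have -> : [sequence (\int[mu]_x fI n x)%E]_n = (fun n => \int[mu]_(x in I n) (f x)%:E)%E.
  by apply/funext => n /=; rewrite -integral_mkcond.
exact: F0.
Qed.

(** The moment bound with exponent $k+1$ leaves a spare factor $1/n$. *)
Lemma cvg_moment_normal (s : R) (k : nat) : s != 0 ->
  (fun n => (n%:R : R) ^+ k * normal_pdf 0 s n%:R) @ \oo --> (0 : R).
Proof.
move=> s0; have [C C0 hC] := normal_fun_moment_bound k.+1 s0.
have bnd n : `|(n.+1%:R : R) ^+ k * normal_pdf 0 s n.+1%:R| <= normal_peak s * C * n.+1%:R^-1.
  rewrite ger0_norm ?mulr_ge0 ?exprn_ge0 ?normal_pdf_ge0// ler_pdivlMr ?ltr0n//.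
  rewrite normal_pdfE// mulrAC -exprSr mulrCA ler_wpM2l ?normal_peak_ge0//.
  have := hC n.+1%:R; rewrite ger0_norm// => /le_trans; apply.
  rewrite ler_piMr// /normal_fun -[leRHS]expR0 ler_expR subr0 mulNr oppr_le0.
  by rewrite divr_ge0 ?sqr_ge0// mulrn_wge0// sqr_ge0.
rewrite -(cvg_shiftS (fun n => (n%:R : R) ^+ k * normal_pdf 0 s n%:R)).
apply/cvgr0Pnorm_le => e e0.
near=> n; apply: (le_trans (bnd n)).
have [D0|D0] := leP (normal_peak s * C) 0.
  by rewrite (le_trans _ (ltW e0))// mulr_le0_ge0// invr_ge0.
rewrite ler_pdivrMr// [e * _]mulrC -ler_pdivrMr//.
apply: ltW; apply: lt_le_trans (truncnS_gt _) _; rewrite ler_nat ltnS.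
near: n; exact: nbhs_infty_ge.
Unshelve. all: by end_near. Qed.

Lemma normal_pdfN (s x : R) : s != 0 -> normal_pdf 0 s (- x) = normal_pdf 0 s x.
Proof. by move=> s0; rewrite normal_pdfE// /normal_fun !subr0 sqrrN. Qed.

Lemma is_derive_pow (n : nat) (x : R) :
  is_derive x (1 : R) (fun y : R => y ^+ n) (n%:R * x ^+ n.-1).
Proof.
have := is_deriveX n (is_derive_id x (1 : R)).
rewrite (_ : id ^+ n = (fun y : R => y ^+ n)); last by apply/funext => y; rewrite fctE.
by move=> h; apply: is_derive_eq; rewrite /GRing.scale/= mulr1.
Qed.

Lemma is_derive_normal_pdf (s x : R) : s != 0 ->
  is_derive x (1 : R) (normal_pdf 0 s) (- x / s ^+ 2 * normal_pdf 0 s x).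
Proof.
move=> s0; rewrite normal_pdfE// /normal_fun.
pose g (y : R) := - (2 * s ^+ 2)^-1 * y ^+ 2.
have dg : is_derive x (1 : R) g (- x / s ^+ 2).
  have := is_deriveZ (- (2 * s ^+ 2)^-1) (is_derive_pow 2 x).
  move=> h; apply: is_derive_eq; rewrite /GRing.scale/=; field; exact: s0.
have -> : (fun x0 => normal_peak s * expR (- (x0 - 0) ^+ 2 / (s ^+ 2 *+ 2))) =
    (fun y => normal_peak s * (expR \o g) y).
  apply/funext => y /=; congr (_ * expR _); rewrite /g subr0 -mulr_natl.
  by field.
have de : is_derive x (1 : R) (expR \o g) (expR (g x) * (- x / s ^+ 2)).
  by apply: is_derive1_comp.
have := is_deriveZ (normal_peak s) de => h; apply: is_derive_eq.
have -> : (- (x - 0) ^+ 2 / (s ^+ 2 *+ 2)) = g x.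
  by rewrite /g subr0 -mulr_natl; field.
by rewrite /GRing.scale/=; ring.
Qed.

Lemma is_derive_moment_normal (s x : R) (k : nat) : s != 0 ->
  is_derive x (1 : R) (fun y => y ^+ k * normal_pdf 0 s y)
    ((k%:R * x ^+ k.-1 - x ^+ k.+1 / s ^+ 2) * normal_pdf 0 s x).
Proof.
move=> s0; have := is_deriveM (is_derive_pow k x) (is_derive_normal_pdf x s0).
by move=> h; apply: is_derive_eq; rewrite /GRing.scale/= (exprS x k); ring.
Qed.

Lemma continuous_moment_normal (s : R) (k : nat) : s != 0 ->
  continuous (fun y : R => y ^+ k * normal_pdf 0 s y).
Proof.
move=> s0 x; apply: cvgM; first exact: exprn_continuous.
exact: continuous_normal_pdf.
Qed.

(** Integration by parts: the derivative of $y^k\varphi_s(y)$ is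
    $(ky^{k-1}-y^{k+1}/s^2)\varphi_s(y)$ and integrates to zero. For [k = 0] the truncated
    predecessor is harmless, its coefficient being [k%:R]. *)
Lemma moment_normal_recl (s : R) (k : nat) : s != 0 ->
  \int[mu]_x (x ^+ k.+1 * normal_pdf 0 s x) =
  s ^+ 2 * (k%:R * \int[mu]_x (x ^+ k.-1 * normal_pdf 0 s x)).
Proof.
move=> s0; pose F (y : R) := y ^+ k * normal_pdf 0 s y.
pose f (y : R) := k%:R * (y ^+ k.-1 * normal_pdf 0 s y) - (s ^+ 2)^-1 * (y ^+ k.+1 * normal_pdf 0 s y).
have i1 := integrable_normal_fun_moment k.-1 s0.
have i2 := integrable_normal_fun_moment k.+1 s0.
have dF (x : R) : is_derive x (1 : R) F (f x).
  have h := is_derive_moment_normal x k s0; apply: is_derive_eq.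
  by rewrite /f; ring.
have intf : mu.-integrable setT (EFin \o f).
  have := integrableB measurableT (integrableZl measurableT k%:R i1)
    (integrableZl measurableT (s ^+ 2)^-1 i2).
  by apply: eq_integrable => //.
have cf : continuous f.
  move=> x; apply: cvgB; apply: cvgMr; exact: continuous_moment_normal.
have Fp : F n%:R @[n --> \oo] --> 0 by exact: cvg_moment_normal.
have Fn : F (- n%:R) @[n --> \oo] --> 0.
  have -> : (fun n => F (- n%:R)) = (fun n => (-1) ^+ k * F n%:R).
    apply/funext => n; by rewrite /F normal_pdfN// (exprNn n%:R) mulrA.
  have : (fun n => (-1) ^+ k * F n%:R) @ \oo --> ((-1) ^+ k * 0 : R) by exact: cvgMr.
  by rewrite mulr0.
have := integral_derive_eq0 dF cf intf Fp Fn.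
have E : \int[mu]_x f x = k%:R * \int[mu]_x (x ^+ k.-1 * normal_pdf 0 s x) -
    (s ^+ 2)^-1 * \int[mu]_x (x ^+ k.+1 * normal_pdf 0 s x).
  rewrite RintegralB ?RintegralZl//.
  - exact: (integrableZl measurableT k%:R i1).
  - exact: (integrableZl measurableT (s ^+ 2)^-1 i2).
move=> f0; move: E; rewrite {1}/Rintegral f0/= => /esym/eqP; rewrite subr_eq0 => /eqP ->.
by rewrite mulrA divff ?mul1r// expf_neq0.
Qed.

(** For even [k] this is the double factorial $(k-1)!!$, the [k]-th moment of the standard normal
    law. *)
Definition gauss_moment (k : nat) : R :=
  if odd k then 0 else \prod_(i < k./2) (i.*2.+1)%:R.

Lemma moment_normal (s : R) (k : nat) : s != 0 ->
  \int[mu]_x (x ^+ k * normal_pdf 0 s x) = s ^+ k * gauss_moment k.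
Proof.
(* The recursion lowers the exponent by two, hence the induction on an upper bound of the
   exponent. *)
move=> s0; elim: k {-2}k (leqnn k) => [|k IH] [|[|j]] //= jk.
- under eq_Rintegral do rewrite expr0 mul1r.
  by rewrite /Rintegral integral_normal_pdf /gauss_moment/= big_ord0 mulr1.
- under eq_Rintegral do rewrite expr0 mul1r.
  by rewrite /Rintegral integral_normal_pdf /gauss_moment/= big_ord0 mulr1.
- by rewrite moment_normal_recl// mulr0n mul0r /gauss_moment/= !mulr0.
rewrite moment_normal_recl//= IH; last by rewrite ltnW.
rewrite /gauss_moment/= negbK; have [jo|jo] := boolP (odd j); first by rewrite !mulr0.
by rewrite big_ord_recr/= even_halfK// !exprS; ring.
Qed.

End normal_moments.

(** * Trigonometric and exponential bounds *)

Section trig_bounds.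
Context {R : realType}.
Implicit Types x u : R.

Lemma norm_sin_le x : `|sin x| <= `|x|.
Proof.
wlog x0 : x / 0 <= x.
  move=> h; have [/h//|/ltW x0] := leP 0 x.
  by rewrite -normrN -sinN -[leRHS]normrN; apply: h; rewrite oppr_ge0.
have [c _] := @MVT_segment R sin cos 0 x x0
  (fun y _ => is_derive_sin y) (continuous_subspaceT (@continuous_sin R)).
rewrite sin0 !subr0 => ->; rewrite normrM ler_piMl//.
by rewrite ler_norml cos_le1 cos_geN1.
Qed.

Lemma cos_double_sin x : cos x = 1 - 2 * sin (x / 2) ^+ 2.
Proof.
have {1}-> : x = x / 2 + x / 2 by field.
by rewrite cosD -!expr2 cos2sin2; ring.
Qed.

(** Mean value theorem for $\sin x-x$, whose derivative at $c$ is $-2\sin^2(c/2)$, at most $c^2/2$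
    in absolute value. *)
Lemma norm_sin_sub_le x : `|sin x - x| <= `|x| ^+ 3 / 2.
Proof.
wlog x0 : x / 0 <= x.
  move=> h; have [/h//|/ltW x0] := leP 0 x.
  have := h (- x); rewrite oppr_ge0 => /(_ x0).
  by rewrite sinN opprK normrN addrC distrC.
have dg (y : R) : is_derive y (1 : R) (sin \- id : R -> R) (cos y - 1).
  exact: is_deriveB.
have [|c /[!in_itv]/= /andP[c0 cx]] := @MVT_segment R (sin \- id) (fun y => cos y - 1) 0 x x0
  (fun y _ => dg y).
  by apply: continuous_subspaceT => y; apply: cvgB => //; exact: continuous_sin.
rewrite /= sin0 !subr0 => ->; rewrite normrM exprSr mulrAC ler_wpM2r//.
rewrite cos_double_sin addrC addKr normrN ger0_norm; last by rewrite mulr_ge0// sqr_ge0.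
rewrite -real_normK ?num_real//.
have h : `|sin (c / 2)| <= `|x| / 2.
  rewrite (le_trans (norm_sin_le _))// normrM ger0_norm// [`|x|]ger0_norm//.
  by rewrite ger0_norm// ler_wpM2r.
have : `|sin (c / 2)| ^+ 2 <= (`|x| / 2) ^+ 2 by rewrite lerXn2r ?nnegrE ?divr_ge0.
by lra.
Qed.

(** By $\cos x=1-2\sin^2(x/2)$ the error is twice the difference of squares $(x/2)^2-\sin^2(x/2)$,
    whose factors are of order $x^3$ and $x$. The order four is what counts, since fourth moments
    will be available. *)
Lemma norm_cos_sub_le x : `|cos x - (1 - x ^+ 2 / 2)| <= x ^+ 4.
Proof.
have -> : cos x - (1 - x ^+ 2 / 2) = 2 * ((x / 2 - sin (x / 2)) * (x / 2 + sin (x / 2))).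
  by rewrite cos_double_sin; field.
rewrite normrM ger0_norm// normrM.
have h1 : `|x / 2 - sin (x / 2)| <= `|x / 2| ^+ 3 / 2 by rewrite distrC norm_sin_sub_le.
have h2 : `|x / 2 + sin (x / 2)| <= `|x / 2| + `|x / 2|.
  by rewrite (le_trans (ler_normD _ _))// lerD2l norm_sin_le.
have := ler_pM (normr_ge0 _) (normr_ge0 _) h1 h2.
have -> : x ^+ 4 = `|x| ^+ 4 by rewrite -normrX ger0_norm// exprn_even_ge0.
have -> : `|x / 2| = `|x| / 2 by rewrite normrM [X in _ * X]ger0_norm.
have -> : (`|x| / 2) ^+ 3 / 2 * (`|x| / 2 + `|x| / 2) = `|x| ^+ 4 / 16 by field.
have : 0 <= `|x| ^+ 4 by rewrite exprn_ge0.
lra.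
Qed.

Lemma expRN_sub_le u : 0 <= u -> `|expR (- u) - (1 - u)| <= u ^+ 2.
Proof.
move=> u0; have h := expR_ge1Dx (- u).
rewrite ger0_norm ?subr_ge0// expRN.
have u1 : 0 < 1 + u by rewrite ltr_pwDl.
have : (expR u)^-1 <= (1 + u)^-1 by rewrite lef_pV2 ?posrE ?expR_gt0// expR_ge1Dx.
have : (1 + u)^-1 <= 1 - u + u ^+ 2.
  rewrite -[leLHS]mul1r ler_pdivrMr// -subr_ge0.
  have -> : (1 - u + u ^+ 2) * (1 + u) - 1 = u ^+ 3 by ring.
  by rewrite exprn_ge0.
lra.
Qed.

Lemma expRN_lipschitz (a b : R) : 0 <= a -> 0 <= b ->
  `|expR (- a) - expR (- b)| <= `|a - b|.
Proof.
wlog ab : a b / a <= b.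
  move=> h a0 b0; have [ab|/ltW ab] := leP a b; first exact: h.
  by rewrite distrC [leRHS]distrC; exact: h.
move=> a0 b0; rewrite ger0_norm ?subr_ge0 ?ler_expR ?lerN2//.
rewrite distrC ger0_norm ?subr_ge0//.
have -> : - b = - a + (a - b) by ring.
rewrite expRD -{1}[expR (- a)]mulr1 -mulrBr.
have h := expR_ge1Dx (a - b).
have e1 : expR (- a) <= 1 by rewrite -[leRHS]expR0 ler_expR oppr_le0.
have : 1 - expR (a - b) <= b - a by lra.
apply: le_trans; rewrite ler_piMl// subr_ge0 -[leRHS]expR0 ler_expR subr_le0//.
Qed.

End trig_bounds.

(** * Variables with all moments, and expectations of functions of Gaussian variables *)

Section moments.
Context {R : realType} {d : measure_display} {Omega : measurableType d}.
Variable P : probability Omega R.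

(** This class is closed under sums and products and contains the constants, so integrability of a
    polynomial in Gaussian variables follows from its shape alone. *)
Definition has_moments (X : Omega -> R) :=
  measurable_fun setT X /\
  forall k, P.-integrable setT (fun w => (X w ^+ k)%:E).

Lemma bounded_integrable (X : Omega -> R) (M : R) :
  measurable_fun setT X -> (forall w, `|X w| <= M) ->
  P.-integrable setT (fun w => (X w)%:E).
Proof.
move=> mX XM; apply: measurable_bounded_integrable => //.
  by rewrite -ge0_fin_numE// fin_num_measure.
exists M; split; first exact: num_real.
by move=> y My w _ /=; rewrite (le_trans (XM w))// ltW.
Qed.

Lemma has_moments_integrable X : has_moments X -> P.-integrable setT (fun w => (X w)%:E).
Proof. by move=> [_ /(_ 1%N)]; apply: eq_integrable => // w _; rewrite expr1. Qed.

Lemma has_moments_of_le (X : Omega -> R) :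
  measurable_fun setT X ->
  (forall k, exists2 Y, P.-integrable setT (fun w => (Y w)%:E) &
     forall w, `|X w| ^+ k <= Y w) -> has_moments X.
Proof.
move=> mX h; split=> // k; have [Y iY XY] := h k.
apply: (le_integrable measurableT _ _ iY).
  by apply/measurable_EFinP; exact: measurable_funX.
by move=> w _; rewrite lee_fin normrX (le_trans (XY w))// ler_norm.
Qed.

Lemma integrable_norm_pow X k : has_moments X ->
  P.-integrable setT (fun w => (`|X w| ^+ k)%:E).
Proof.
move=> [_ /(_ k)] /integrable_abse; apply: eq_integrable => // w _.
by rewrite /= normrX.
Qed.

Lemma has_moments_cst c : has_moments (fun=> c).
Proof.
split=> // k; apply: (@bounded_integrable _ `|c ^+ k|) => //.
Qed.

Lemma has_momentsD X Y : has_moments X -> has_moments Y ->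
  has_moments (fun w => X w + Y w).
Proof.
move=> hX hY; apply: has_moments_of_le.
  by case: hX => mX _; case: hY => mY _; exact: measurable_funD.
move=> k; exists (fun w => 2 ^+ k * (`|X w| ^+ k + `|Y w| ^+ k)).
  have := integrableD measurableT (integrable_norm_pow k hX) (integrable_norm_pow k hY).
  by move/(integrableZl measurableT (2 ^+ k)).
move=> w; set x := X w; set y := Y w.
wlog xy : x y / `|x| <= `|y|.
  move=> h; have [xy|/ltW xy] := leP `|x| `|y|; first exact: h.
  by rewrite [x + y]addrC [X in _ * X]addrC; exact: h.
rewrite (@le_trans _ _ ((2 * `|y|) ^+ k))//.
  rewrite lerXn2r ?nnegrE ?mulr_ge0//.
  by rewrite (le_trans (ler_normD _ _))// mulr_natl mulr2n lerD2r.
by rewrite exprMn ler_wpM2l ?exprn_ge0// lerDr exprn_ge0.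
Qed.

Lemma has_momentsM X Y : has_moments X -> has_moments Y ->
  has_moments (fun w => X w * Y w).
Proof.
move=> hX hY; apply: has_moments_of_le.
  by case: hX => mX _; case: hY => mY _; exact: measurable_funM.
move=> k; exists (fun w => `|X w| ^+ (k * 2) + `|Y w| ^+ (k * 2)).
  exact: (integrableD measurableT (integrable_norm_pow _ hX) (integrable_norm_pow _ hY)).
move=> w; rewrite normrM exprMn !exprM.
have := sqr_ge0 (`|X w| ^+ k - `|Y w| ^+ k).
have := mulr_ge0 (exprn_ge0 k (normr_ge0 (X w))) (exprn_ge0 k (normr_ge0 (Y w))).
by rewrite sqrrB; set a := _ ^+ k; set b := `|Y w| ^+ k; lra.
Qed.

Lemma has_momentsZ c X : has_moments X -> has_moments (fun w => c * X w).
Proof. by move=> hX; apply: has_momentsM => //; exact: has_moments_cst. Qed.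

Lemma has_momentsB X Y : has_moments X -> has_moments Y ->
  has_moments (fun w => X w - Y w).
Proof.
move=> hX hY; have := has_momentsD hX (has_momentsZ (-1) hY).
by under eq_fun do rewrite mulN1r.
Qed.

Lemma has_momentsX n X : has_moments X -> has_moments (fun w => X w ^+ n).
Proof.
move=> hX; elim: n => [|n IH]; first exact: has_moments_cst.
by under eq_fun do rewrite exprS; exact: has_momentsM.
Qed.

Lemma has_moments_sum (I : Type) (s : seq I) (F : I -> Omega -> R) :
  (forall i, has_moments (F i)) -> has_moments (fun w => \sum_(i <- s) F i w).
Proof.
move=> hF; elim: s => [|i s IH].
  by under eq_fun do rewrite big_nil; exact: has_moments_cst.
by under eq_fun do rewrite big_cons; exact: has_momentsD.
Qed.

Lemma expectation_sum_fun (I : Type) (s : seq I) (F : I -> Omega -> R) :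
  (forall i, P.-integrable setT (fun w => (F i w)%:E)) ->
  \int[P]_w (\sum_(i <- s) F i w) = \sum_(i <- s) \int[P]_w F i w.
Proof.
move=> hF; elim: s => [|i s IH].
  under eq_Rintegral do rewrite big_nil.
  by rewrite big_nil Rintegral_cst//= mul0r.
under eq_Rintegral do rewrite big_cons.
have iS : P.-integrable setT (fun w => (\sum_(i <- s) F i w)%:E).
  have := @integrable_sum _ _ _ P setT measurableT _ s xpredT (fun i w => (F i w)%:E) (fun i _ => hF i).
  by apply: eq_integrable => // w _; rewrite /= sumEFin.
by rewrite big_cons (RintegralD measurableT (hF i) iS) IH.
Qed.

Lemma expectation_cst (c : R) : \int[P]_w c = c.
Proof.
rewrite Rintegral_cst//; have -> : (P : {measure set _ -> \bar R}) setT = 1%E by exact: probability_setT.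
by rewrite mulr1.
Qed.

Definition gaussian (s : R) (X : Omega -> R) :=
  measurable_fun setT X /\
  forall B, measurable B -> P (X @^-1` B) = normal_prob 0 s B.

Notation mu := (@lebesgue_measure R).

Lemma ge0_expectation_gaussian s X (f : R -> R) : gaussian s X ->
  measurable_fun setT f -> (forall x, 0 <= f x) ->
  (\int[P]_w (f (X w))%:E = \int[mu]_x (f x * normal_pdf 0 s x)%:E)%E.
Proof.
move=> [mX XE] mf f0.
have mX' : measurable_fun setT (X : Omega -> measurableTypeR R) by exact: mX.
pose Xm : {mfun Omega >-> measurableTypeR R} :=
  HB.pack (X : Omega -> measurableTypeR R) (isMeasurableFun.Build _ _ _ _ _ mX').
transitivity (\int[distribution P Xm]_x (f x)%:E)%E.
  by rewrite ge0_integral_distribution//; exact/measurable_EFinP.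
transitivity (\int[normal_prob 0 s]_x (f x)%:E)%E.
  by apply: eq_measure_integral => A mA _; exact: XE.
by rewrite ge0_integral_normal_prob//; exact/measurable_EFinP.
Qed.

Lemma integrable_gaussian s X (f : R -> R) : gaussian s X ->
  measurable_fun setT f ->
  mu.-integrable setT (fun x => (f x * normal_pdf 0 s x)%:E) ->
  P.-integrable setT (fun w => (f (X w))%:E).
Proof.
move=> gX mf /integrableP[_ ifin]; apply/integrableP; split.
  by apply/measurable_EFinP; apply: measurableT_comp => //; case: gX.
under eq_integral do rewrite /=.
rewrite (@ge0_expectation_gaussian s X (fun x => `|f x|))//.
  move: ifin; under eq_integral do rewrite /= normrM [X in _ * X]ger0_norm ?normal_pdf_ge0//.
  by [].
exact: measurableT_comp.
Qed.

(** The transfer formula is first known for nonnegative functions; it is applied to $f+|f|$ and to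
    $|f|$, and the results are subtracted. *)
Lemma expectation_gaussian s X (f : R -> R) : gaussian s X ->
  measurable_fun setT f ->
  mu.-integrable setT (fun x => (f x * normal_pdf 0 s x)%:E) ->
  \int[P]_w f (X w) = \int[mu]_x (f x * normal_pdf 0 s x).
Proof.
move=> gX mf intf.
have mnf : measurable_fun setT (fun x => `|f x|) by exact: measurableT_comp.
have intnf : mu.-integrable setT (fun x => (`|f x| * normal_pdf 0 s x)%:E).
  have := integrable_abse intf; apply: eq_integrable => // x _ /=.
  by rewrite normrM [X in _ * X]ger0_norm ?normal_pdf_ge0.
have i1 := integrable_gaussian gX mf intf.
have i2 := integrable_gaussian gX mnf intnf.
have E0 : \int[P]_w (f (X w) + `|f (X w)|) = \int[mu]_x ((f x + `|f x|) * normal_pdf 0 s x).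
  rewrite /Rintegral (@ge0_expectation_gaussian s X (fun x => f x + `|f x|))//.
    exact: measurable_funD.
  by move=> x; rewrite addrC -lerBlDr sub0r -normrN ler_norm.
have E1 : \int[P]_w `|f (X w)| = \int[mu]_x (`|f x| * normal_pdf 0 s x).
  by rewrite /Rintegral (@ge0_expectation_gaussian s X (fun x => `|f x|)).
move: E0; rewrite RintegralD// E1.
under [X in _ = X -> _]eq_Rintegral do rewrite mulrDl.
by rewrite RintegralD// => /addIr.
Qed.

Lemma gaussian_moment s X k : s != 0 -> gaussian s X ->
  \int[P]_w (X w ^+ k) = s ^+ k * @gauss_moment R k.
Proof.
move=> s0 gX; rewrite (@expectation_gaussian s X (fun x => x ^+ k))//.
- exact: (@moment_normal R s k s0).
- exact: integrable_normal_fun_moment.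
Qed.

Lemma gaussian_has_moments s X : s != 0 -> gaussian s X -> has_moments X.
Proof.
move=> s0 gX; split=> [|k]; first by case: gX.
apply: (@integrable_gaussian s X (fun x => x ^+ k)) => //.
exact: integrable_normal_fun_moment.
Qed.

(** Multiplying a centred normal density by $e^{-lx^2}$ gives, up to the factor $1/q$, the normal
    density of deviation $|s|/q$, where $q=\sqrt{1+2ls^2}$. *)
Lemma laplace_normal_sqr (s l : R) : s != 0 -> 0 <= l ->
  (\int[mu]_x (expR (- (l * x ^+ 2)) * normal_pdf 0 s x)%:E =
   (Num.sqrt (1 + 2 * (l * s ^+ 2)))^-1%:E)%E.
Proof.
move=> s0 l0.
have s2 : 0 < s ^+ 2 by rewrite exprn_even_gt0.
have q0 : 0 < 1 + 2 * (l * s ^+ 2) by rewrite ltr_pwDl// mulr_ge0// mulr_ge0// ltW.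
pose q := Num.sqrt (1 + 2 * (l * s ^+ 2)).
have q1 : 0 < q by rewrite sqrtr_gt0.
have qE : q ^+ 2 = 1 + 2 * (l * s ^+ 2) by rewrite sqr_sqrtr// ltW.
pose s' := `|s| / q.
have s'0 : s' != 0 by rewrite mulf_neq0 ?normr_eq0// invr_neq0// gt_eqF.
have s'E : s' ^+ 2 = s ^+ 2 / q ^+ 2 by rewrite expr_div_n real_normK ?num_real.
have key x : expR (- (l * x ^+ 2)) * normal_pdf 0 s x = q^-1 * normal_pdf 0 s' x.
  rewrite !normal_pdfE//.
  have -> : normal_peak s' = q * normal_peak s.
    rewrite /normal_peak s'E.
    have -> : s ^+ 2 / q ^+ 2 * pi *+ 2 = (s ^+ 2 * pi *+ 2) * (q ^+ 2)^-1 by ring.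
    rewrite sqrtrM; last by rewrite mulrn_wge0// mulr_ge0 ?pi_ge0// ltW.
    by rewrite invfM sqrtrV ?sqr_ge0// invrK sqrtr_sqr gtr0_norm// mulrC.
  rewrite mulrA mulKf ?gt_eqF// mulrCA; congr (_ * _).
  rewrite /normal_fun -expRD; congr expR; rewrite s'E qE !subr0.
  by field; rewrite s0 gt_eqF.
under eq_integral do rewrite key EFinM.
rewrite integralZl//; last exact: integrable_normal_pdf.
by rewrite integral_normal_pdf mule1.
Qed.

Lemma laplace_gaussian_sqr s X l : s != 0 -> gaussian s X -> 0 <= l ->
  \int[P]_w expR (- (l * (X w / s) ^+ 2)) = (Num.sqrt (1 + 2 * l))^-1.
Proof.
move=> s0 gX l0.
rewrite /Rintegral (@ge0_expectation_gaussian s X (fun x => expR (- (l * (x / s) ^+ 2))))//.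
- have s2 : 0 < s ^+ 2 by rewrite exprn_even_gt0.
  under eq_integral => x _.
    have -> : l * (x / s) ^+ 2 = (l / s ^+ 2) * x ^+ 2 by rewrite expr_div_n; ring.
    over.
  by rewrite laplace_normal_sqr// ?divr_ge0 ?(ltW s2)//= divfK// gt_eqF.
- apply: measurableT_comp => //; apply: measurableT_comp => //.
  by apply: measurable_funM => //; apply: measurable_funX; exact: measurable_funM.
Qed.

End moments.

(** * A central limit theorem for sums of uncorrelated steps *)

Section clt.
Context {R : realType} {d : measure_display} {Omega : measurableType d}.
Variable P : probability Omega R.

Lemma measurable_sum_fun (I : Type) (s : seq I) (F : I -> Omega -> R) :
  (forall i, measurable_fun setT (F i)) ->
  measurable_fun setT (fun w => \sum_(i <- s) F i w).
Proof.
move=> hF; elim: s => [|i s IH].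
  by under eq_fun do rewrite big_nil; exact: measurable_cst.
by under eq_fun do rewrite big_cons; exact: measurable_funD.
Qed.

Lemma measurable_cos_comp (X : Omega -> R) : measurable_fun setT X ->
  measurable_fun setT (fun w => cos (X w)).
Proof.
move=> mX; apply: (@measurableT_comp _ _ _ _ _ _ (@cos R)) => //.
by apply: continuous_measurable_fun; exact: continuous_cos.
Qed.

Lemma measurable_sin_comp (X : Omega -> R) : measurable_fun setT X ->
  measurable_fun setT (fun w => sin (X w)).
Proof.
move=> mX; apply: (@measurableT_comp _ _ _ _ _ _ (@sin R)) => //.
by apply: continuous_measurable_fun; exact: continuous_sin.
Qed.

Lemma integrable_cos (X : Omega -> R) : measurable_fun setT X ->
  P.-integrable setT (fun w => (cos (X w))%:E).
Proof.
by move=> mX; apply: (@bounded_integrable _ _ _ _ _ 1); [exact: measurable_cos_comp|move=> w; exact: cos_max].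
Qed.

Lemma integrable_sin (X : Omega -> R) : measurable_fun setT X ->
  P.-integrable setT (fun w => (sin (X w))%:E).
Proof.
by move=> mX; apply: (@bounded_integrable _ _ _ _ _ 1); [exact: measurable_sin_comp|move=> w; exact: sin_max].
Qed.

Lemma norm_expectation_le (X : Omega -> R) (M : R) : measurable_fun setT X ->
  (forall w, `|X w| <= M) -> `|\int[P]_w X w| <= M.
Proof.
move=> mX XM; have iX := @bounded_integrable _ _ _ P _ _ mX XM.
rewrite (le_trans (le_normr_Rintegral measurableT iX))//.
rewrite -[leRHS](expectation_cst P) le_Rintegral//.
  exact: integrable_abse iX.
exact: has_moments_integrable (has_moments_cst P M).
Qed.

(** Independence tested on functions bounded by $1$: this covers cosine, sine and a clamped
    exponential, and integrability is then automatic. *)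
Definition uncorrelated_bounded (X Y : Omega -> R) := forall u v : R -> R,
  measurable_fun setT u -> measurable_fun setT v ->
  (forall x, `|u x| <= 1) -> (forall x, `|v x| <= 1) ->
  \int[P]_w (u (X w) * v (Y w)) = (\int[P]_w u (X w)) * (\int[P]_w v (Y w)).

Variables (n : nat) (x : nat -> Omega -> R).
Let S m w := \sum_(i < m) x i w.
Hypothesis mx : forall i, measurable_fun setT (x i).
Hypothesis indep : forall i, (i < n)%N -> uncorrelated_bounded (S i) (x i).

Let mS m : measurable_fun setT (S m).
Proof. by apply: measurable_sum_fun => i; exact: mx. Qed.

Let mcos : measurable_fun setT (@cos R).
Proof. by apply: continuous_measurable_fun; exact: continuous_cos. Qed.
Let msin : measurable_fun setT (@sin R).
Proof. by apply: continuous_measurable_fun; exact: continuous_sin. Qed.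

Let cosS m : (m < n)%N ->
  \int[P]_w cos (S m.+1 w) = (\int[P]_w cos (S m w)) * (\int[P]_w cos (x m w)) -
    (\int[P]_w sin (S m w)) * (\int[P]_w sin (x m w)).
Proof.
move=> mn.
rewrite -(indep mn mcos mcos (@cos_max R) (@cos_max R)).
rewrite -(indep mn msin msin (@sin_max R) (@sin_max R)) -RintegralB//.
- by apply: eq_Rintegral => w _; rewrite /S big_ord_recr/= cosD.
- apply: (@bounded_integrable _ _ _ _ _ 1).
    by apply: measurable_funM; exact: measurable_cos_comp.
  by move=> w; rewrite normrM mulr_ile1// cos_max.
- apply: (@bounded_integrable _ _ _ _ _ 1).
    by apply: measurable_funM; exact: measurable_sin_comp.
  by move=> w; rewrite normrM mulr_ile1// sin_max.
Qed.

(** A real version of the comparison of products of characteristic functions: by the addition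
    formula each step multiplies $\mathbb E\cos S$ by $\mathbb E\cos x_i$ up to a sine term, and the
    errors simply add up because $0\le a\le1$ and $|\cos|,|\sin|\le1$. *)
Lemma expectation_cos_sum_bound (a : R) : 0 <= a <= 1 ->
  `|\int[P]_w cos (S n w) - a ^+ n| <=
  \sum_(i < n) (`|\int[P]_w cos (x i w) - a| + `|\int[P]_w sin (x i w)|).
Proof.
move=> /andP[a0 a1].
suff h m : (m <= n)%N -> `|\int[P]_w cos (S m w) - a ^+ m| <=
  \sum_(i < m) (`|\int[P]_w cos (x i w) - a| + `|\int[P]_w sin (x i w)|) by exact: h.
elim: m => [_|m IH mn].
  rewrite big_ord0 expr0; under eq_Rintegral do rewrite /S big_ord0 cos0.
  by rewrite expectation_cst subrr normr0.
rewrite big_ord_recr/= cosS// exprSr.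
set c := \int[P]_w cos (S m w); set s := \int[P]_w sin (S m w).
set A := \int[P]_w cos (x m w); set B := \int[P]_w sin (x m w).
have -> : c * A - s * B - a ^+ m * a = (c - a ^+ m) * a + (c * (A - a) - s * B) by ring.
rewrite (le_trans (ler_normD _ _))// lerD//.
  rewrite normrM (le_trans _ (IH (ltnW mn)))// ler_piMr//.
  by rewrite ger0_norm.
rewrite (le_trans (ler_normB _ _))// !normrM lerD// ler_piMl//.
  by apply: norm_expectation_le => [|w]; [exact: measurable_cos_comp|exact: cos_max].
by apply: norm_expectation_le => [|w]; [exact: measurable_sin_comp|exact: sin_max].
Qed.

Lemma expectation_cos_sum_symmetric :
  (forall i, (i < n)%N -> \int[P]_w sin (x i w) = 0) ->
  \int[P]_w cos (S n w) = \prod_(i < n) \int[P]_w cos (x i w).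
Proof.
move=> s0.
suff h m : (m <= n)%N -> \int[P]_w cos (S m w) = \prod_(i < m) \int[P]_w cos (x i w) by exact: h.
elim: m => [_|m IH mn].
  by rewrite big_ord0; under eq_Rintegral do rewrite /S big_ord0 cos0; rewrite expectation_cst.
by rewrite big_ord_recr/= cosS// s0// mulr0 subr0 IH// ltnW.
Qed.

(** The previous bound with $a=e^{-v/(2n)}$, each step contributing $O(n^{-3/2})$. In $2K+v^2+v$,
    one $K$ comes from the Taylor error of the cosine, $v^2$ from that of the exponential, and $K+v$
    from the sine, which for a centred variable costs a third moment. *)
Lemma expectation_cos_sum_gaussian (v K : R) : (0 < n)%N -> 0 <= v ->
  (forall i, (i < n)%N -> has_moments P (x i)) ->
  (forall i, (i < n)%N -> \int[P]_w x i w = 0) ->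
  (forall i, (i < n)%N -> \int[P]_w (x i w ^+ 2) = v / n%:R) ->
  (forall i, (i < n)%N -> \int[P]_w (x i w ^+ 4) <= K / n%:R ^+ 2) ->
  `|\int[P]_w cos (S n w) - expR (- (v / 2))| <=
     (2 * K + v ^+ 2 + v) / Num.sqrt n%:R.
Proof.
move=> n0 v0 hx x1 x2 x4.
have n0' : 0 < n%:R :> R by rewrite ltr0n.
have q0 : 0 < Num.sqrt n%:R :> R by rewrite sqrtr_gt0.
set q := Num.sqrt n%:R in q0 *.
have qE : n%:R = q ^+ 2 by rewrite sqr_sqrtr// ltW.
pose u : R := v / 2 / n%:R.
have u0 : 0 <= u by rewrite !divr_ge0// ltW.
have aE : expR (- (v / 2)) = expR (- u) ^+ n.
  by rewrite -expRM_natl; congr expR; rewrite /u; field; rewrite gt_eqF.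
have a01 : 0 <= expR (- u) <= 1.
  by rewrite expR_ge0 -[leRHS]expR0 ler_expR oppr_le0.
have q1 : 1 <= q by rewrite -[leLHS]sqrtr1 ler_wsqrtr// ler1n.
have K0 : 0 <= K.
  have := x4 0%N n0; rewrite ler_pdivlMr ?exprn_gt0// => /(le_trans _); apply.
  apply: mulr_ge0; last by rewrite exprn_ge0// ltW.
  by apply: Rintegral_ge0 => w _; rewrite exprn_even_ge0.
rewrite aE (le_trans (expectation_cos_sum_bound a01))//.
have bnd i : (i < n)%N -> `|\int[P]_w cos (x i w) - expR (- u)| + `|\int[P]_w sin (x i w)|
    <= (2 * K + v ^+ 2 + v) / q ^+ 3.
  move=> ni; have hxi := hx i ni.
  have i1 := has_moments_integrable hxi.
  have i2 := has_moments_integrable (has_momentsX 2 hxi).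
  have i4 := has_moments_integrable (has_momentsX 4 hxi).
  have ic := integrable_cos (mx i); have isn := integrable_sin (mx i).
  have b1 : `|\int[P]_w cos (x i w) - (1 - u)| <= K / n%:R ^+ 2.
    have iq : P.-integrable setT (fun w => (1 - x i w ^+ 2 / 2)%:E).
      by apply: has_moments_integrable; apply: has_momentsB; [exact: has_moments_cst|
        apply: has_momentsM; [exact: has_momentsX|exact: has_moments_cst]].
    have -> : 1 - u = \int[P]_w (1 - x i w ^+ 2 / 2).
      rewrite RintegralB//.
      - rewrite expectation_cst RintegralZr// x2// /u; ring.
      - exact: has_moments_integrable (has_moments_cst P 1).
      - exact: (integrableZr measurableT _ i2).
    rewrite -RintegralB//.
    have idf := integrableB measurableT ic iq.
    rewrite (le_trans (le_normr_Rintegral measurableT idf))// (le_trans _ (x4 i ni))//.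
    apply: le_Rintegral => //; first exact: integrable_abse idf.
    by move=> w _; exact: norm_cos_sub_le.
  have b2 : `|1 - u - expR (- u)| <= v ^+ 2 / n%:R ^+ 2.
    rewrite distrC (le_trans (expRN_sub_le u0))// /u !expr_div_n.
    rewrite ler_pM2r ?invr_gt0 ?exprn_gt0// ler_pdivrMr ?exprn_gt0//.
    by rewrite ler_peMr ?sqr_ge0// -natrX ler1n.
  have b3 : `|\int[P]_w sin (x i w)| <= (K + v) / q ^+ 3.
    have -> : \int[P]_w sin (x i w) = \int[P]_w (sin (x i w) - x i w).
      by rewrite RintegralB// x1// subr0.
    have idf := integrableB measurableT isn i1.
    rewrite (le_trans (le_normr_Rintegral measurableT idf))//.
    have iq4 := integrableZl measurableT q i4.
    have iq2 := integrableZl measurableT q^-1 i2.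
    apply: (@le_trans _ _ (\int[P]_w (q * x i w ^+ 4 + q^-1 * x i w ^+ 2))).
      apply: le_Rintegral => //.
      + exact: integrable_abse idf.
      + exact: (integrableD measurableT iq4 iq2).
      + move=> w _; rewrite (le_trans (norm_sin_sub_le _))//.
        set y := x i w.
        have -> : y ^+ 4 = `|y| ^+ 4 by rewrite -normrX ger0_norm// exprn_even_ge0.
        have -> : y ^+ 2 = `|y| ^+ 2 by rewrite real_normK ?num_real.
        (* Arithmetic-geometric mean with weight $q=\sqrt n$: $2|y|^3\le qy^4+q^{-1}y^2$, trading
           the third moment for the second and the fourth. *)
        have h : 0 <= q * (`|y| ^+ 2 - `|y| / q) ^+ 2 by rewrite mulr_ge0 ?sqr_ge0// ltW.
        have h3 : 0 <= `|y| ^+ 3 by rewrite exprn_ge0.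
        have e : q * (`|y| ^+ 2 - `|y| / q) ^+ 2 =
          q * `|y| ^+ 4 + q^-1 * `|y| ^+ 2 - 2 * `|y| ^+ 3.
          by field; rewrite gt_eqF.
        by move: h; rewrite e; lra.
    rewrite RintegralD// !RintegralZl// x2//.
    rewrite (@le_trans _ _ (q * (K / n%:R ^+ 2) + q^-1 * (v / n%:R)))//.
      by rewrite lerD2r ler_wpM2l ?x4// ltW.
    by rewrite qE le_eqVlt; apply/orP; left; apply/eqP; field; rewrite gt_eqF.
  have e4 (c : R) : 0 <= c -> c / n%:R ^+ 2 <= c / q ^+ 3.
    move=> c0; rewrite ler_wpM2l// lef_pV2 ?posrE ?exprn_gt0//.
    by rewrite qE -exprM ler_weXn2l.
  have hA : `|\int[P]_w cos (x i w) - expR (- u)| <= K / q ^+ 3 + v ^+ 2 / q ^+ 3.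
    have -> : \int[P]_w cos (x i w) - expR (- u) =
      (\int[P]_w cos (x i w) - (1 - u)) + (1 - u - expR (- u)) by ring.
    rewrite (le_trans (ler_normD _ _))// lerD//.
      by rewrite (le_trans b1)// e4.
    by rewrite (le_trans b2)// e4// sqr_ge0.
  rewrite (le_trans (lerD hA b3))// le_eqVlt; apply/orP; left; apply/eqP; ring.
apply: (@le_trans _ _ (\sum_(i < n) (2 * K + v ^+ 2 + v) / q ^+ 3)).
  by apply: ler_sum => i _; exact: bnd.
rewrite sumr_const card_ord -[_ *+ n]mulr_natr qE le_eqVlt; apply/orP; left; apply/eqP.
by field; rewrite gt_eqF.
Qed.

End clt.

(** * Increments of Wiener processes on the grid *)

Section grid.
Context {R : realType} {d : measure_display} {Omega : measurableType d}.
Variable P : probability Omega R.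
Variables (T : R) (T0 : 0 < T) (L : finType) (Y : L -> R -> Omega -> R).
Hypothesis wY : forall l, wiener P T (Y l).
Hypothesis iY : independent_families P (fun l => history (Y l) T).

Definition grid_increment (n : nat) (il : 'I_n * L) (w : Omega) : R :=
  Y il.2 (il.1.+1%:R * (T / n%:R)) w - Y il.2 (il.1%:R * (T / n%:R)) w.

Lemma grid_time_in (n i : nat) : (0 < n)%N -> (i <= n)%N ->
  0 <= i%:R * (T / n%:R) <= T.
Proof.
move=> n0 ni; have n0' : 0 < n%:R :> R by rewrite ltr0n.
rewrite mulr_ge0 ?divr_ge0 ?ler0n ?(ltW T0)//=.
by rewrite mulrCA ler_piMr ?(ltW T0)// ler_pdivrMr// mul1r ler_nat.
Qed.

Lemma grid_time_lt (n i : nat) : (0 < n)%N ->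
  i%:R * (T / n%:R) < i.+1%:R * (T / n%:R).
Proof.
by move=> n0; rewrite ltr_pM2r ?ltr_nat// divr_gt0// ltr0n.
Qed.

Lemma gaussian_grid_increment (n : nat) (il : 'I_n * L) :
  gaussian P (Num.sqrt (T / n%:R)) (grid_increment il).
Proof.
have n0 : (0 < n)%N by case: il.1 => i; exact: leq_ltn_trans.
have /andP[t0 t1] := grid_time_in n0 (ltn_ord il.1).
have /andP[s0 s1] := grid_time_in n0 (ltnW (ltn_ord il.1)).
have [mY _ gY _ _] := wY il.2; split.
  by apply: measurable_funB; apply: mY; rewrite ?t0 ?t1 ?s0 ?s1.
move=> B mB; have := gY _ _ s0 (grid_time_lt il.1 n0) t1 B mB.
by rewrite -mulrBl -natrB// subSnn mul1r.
Qed.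

Let hgen l t := [set E | exists (u : R) (B : set R),
  [/\ 0 <= u <= t, measurable B & E = Y l u @^-1` B]].

Let measurable_history l t u : 0 <= u <= t ->
  measurable_fun setT (Y l u : g_sigma_algebraType (hgen l t) -> R).
Proof.
move=> ut _ B mB; rewrite setTI; apply: sub_sigma_algebra.
by exists u, B.
Qed.

Let history_increments (n m : nat) l (B : 'I_n * L -> set R) (t : R) :
  (0 < n)%N -> (m <= n)%N -> m%:R * (T / n%:R) <= t ->
  (forall il, measurable (B il)) ->
  history (Y l) t (\bigcap_(i in [set i : 'I_n | (i < m)%N])
     (grid_increment (i, l) @^-1` B (i, l))).
Proof.
move=> n0 mn mt mB.
change (measurable (\bigcap_(i in [set i : 'I_n | (i < m)%N])
     (grid_increment (i, l) @^-1` B (i, l)) : set (g_sigma_algebraType (hgen l t)))).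
apply: fin_bigcap_measurable => // i /= im.
rewrite -[X in measurable X]setTI.
have h0 : 0 < T / n%:R by rewrite divr_gt0// ltr0n.
have hh : forall j : nat, (j <= m)%N -> 0 <= j%:R * (T / n%:R) <= t.
  move=> j jm; rewrite mulr_ge0 ?ler0n ?(ltW h0)//=.
  by rewrite (le_trans _ mt)// ler_pM2r// ler_nat.
by apply: measurable_funB => //; apply: measurable_history; apply: hh => //; exact: ltnW.
Qed.

Let measurable_incr (n : nat) (il : 'I_n * L) : measurable_fun setT (grid_increment il).
Proof. by case: (gaussian_grid_increment il). Qed.

(** Induction on the number of steps: the first [m] increments belong to the history at time $mT/n$,
    and the next one is independent of that history. *)
Let path_independent (n : nat) l (B : 'I_n * L -> set R) (m : nat) :
  (0 < n)%N -> (m <= n)%N -> (forall il, measurable (B il)) ->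
  P (\bigcap_(i in [set i : 'I_n | (i < m)%N]) (grid_increment (i, l) @^-1` B (i, l)))
  = (\prod_(i < n | (i < m)%N) fine (P (grid_increment (i, l) @^-1` B (i, l))))%:E.
Proof.
move=> n0 + mB; elim: m => [_|m IH mn].
  rewrite big_pred0// (_ : [set i : 'I_n | _] = set0); last by apply/seteqP; split.
  by rewrite bigcap_set0 probability_setT.
pose i0 := Ordinal mn.
have -> : [set i : 'I_n | (i < m.+1)%N] = [set i : 'I_n | (i < m)%N] `|` [set i0].
  apply/seteqP; split => i /=.
    by rewrite ltnS leq_eqVlt => /orP[/eqP im|]; [right; exact: val_inj|left].
  by move=> [/ltnW//|->] /=.
rewrite bigcap_setU bigcap_set1.
have [_ _ _ inc _] := wY l.
have /andP[t0 t1] := grid_time_in n0 mn.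
have /andP[s0 s1] := grid_time_in n0 (ltnW mn).
have := inc _ _ s0 (grid_time_lt m n0) t1 _ _
  (@history_increments n m l B _ n0 (ltnW mn) (lexx _) mB) (mB (i0, l)).
move=> ->; rewrite IH; last exact: ltnW.
have fin0 : P (grid_increment (i0, l) @^-1` B (i0, l)) \is a fin_num.
  by apply: fin_num_measure; rewrite -[X in measurable X]setTI; exact: measurable_incr.
rewrite [in RHS](bigD1 i0)//= [in RHS]mulrC EFinM fineK//.
congr (_%:E * _)%E; apply: eq_bigl => i.
by rewrite ltnS [RHS]andbC -(inj_eq val_inj)/= -ltn_neqAle.
Qed.

(** Across processes independence comes from the histories up to [T], along one process from
    [path_independent]; the double product is then reordered over pairs. *)
Lemma grid_increment_independent (n : nat) :
  mutually_independent P (@grid_increment n).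
Proof.
move=> B mB; case: n B mB => [|n] B mB.
  rewrite big1; last by move=> [[]].
  rewrite (_ : bigcap _ _ = setT) ?probability_setT//.
  by apply/seteqP; split => // w _ [[]].
have -> : \bigcap_il (grid_increment il @^-1` B il) =
    \bigcap_l (\bigcap_(i in [set i : 'I_n.+1 | (i < n.+1)%N]) (grid_increment (i, l) @^-1` B (i, l))).
  apply/seteqP; split => w h; first by move=> l _ i _; exact: (h (i, l)).
  by move=> [i l] _; apply: (h l Logic.I i); rewrite /= ltn_ord.
rewrite iY; last first.
  move=> l; apply: history_increments => //.
  by rewrite mulrCA divff ?mulr1// pnatr_eq0.
congr EFin; rewrite (eq_bigr (fun l => \prod_(i < n.+1)
    fine (P (grid_increment (i, l) @^-1` B (i, l))))); last first.
  move=> l _; rewrite path_independent//=; apply: eq_bigl => i; exact: ltn_ord.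
by rewrite exchange_big/= pair_bigA/=; apply: eq_bigr => -[].
Qed.

End grid.

(** * Quadratic forms in independent Gaussian variables *)

Section normal_scaling.
Context {R : realType}.
Notation mu := (@lebesgue_measure R).

(** Substitution $x\mapsto x/s$; it shows that the law of a Gaussian variable divided by its
    deviation does not depend on that deviation. *)
Lemma normal_scaling (s : R) (G : R -> R) : 0 < s -> continuous G ->
  (forall x, 0 <= G x) ->
  (\int[mu]_x (G (x / s) * normal_pdf 0 s x)%:E =
   \int[mu]_x (G x * normal_pdf 0 1 x)%:E)%E.
Proof.
move=> s0 cG G0; pose F (x : R^o) : R := x / s.
have F'E : F^`()%classic = cst s^-1.
  apply/funext => x; rewrite /F derive1E deriveM// derive_cst scaler0.
  by rewrite add0r derive_id scaler1.
have -> : (\int[mu]_x (G x * normal_pdf 0 1 x)%:E = \int[mu]_x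
    ((((fun x => G x * normal_pdf 0 1 x) \o F) * F^`()%classic) x)%:E)%E.
  rewrite -(@increasing_ge0_integration_by_substitutionT _ F (fun x => G x * normal_pdf 0 1 x))//.
  - by move=> x y xy; rewrite /F ltr_pM2r// invr_gt0.
  - by rewrite F'E => ?; exact: cvg_cst.
  - by rewrite F'E; exact: is_cvg_cst.
  - by rewrite F'E; exact: is_cvg_cst.
  - by apply/gt0_cvgMlNy; [rewrite invr_gt0|exact: cvg_id].
  - by apply/gt0_cvgMly; [rewrite invr_gt0|exact: cvg_id].
  - by move=> x; apply: cvgM; [exact: cG|exact: continuous_normal_pdf].
  - by move=> x; rewrite mulr_ge0 ?normal_pdf_ge0.
apply: eq_integral => x _; congr EFin; rewrite F'E/= !fctE/= -mulrA; congr (_ * _).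
rewrite !normal_pdfE ?oner_neq0 ?gt_eqF// mulrAC; congr (_ * _).
  have -> : normal_peak s = (Num.sqrt (s ^+ 2 * (1 ^+ 2 * pi *+ 2)))^-1.
    by rewrite /normal_peak; congr (Num.sqrt _)^-1; ring.
  rewrite sqrtrM ?sqr_ge0//.
  by rewrite sqrtr_sqr gtr0_norm// invfM mulrC.
by rewrite /normal_fun; congr expR; rewrite /F !subr0; field; rewrite gt_eqF.
Qed.

End normal_scaling.

(** The gap in this Cauchy-Schwarz inequality is half of $\sum_{i,j}(x_i-x_j)^2$. *)
Lemma sqr_sum_le (R : realFieldType) (I : finType) (x : I -> R) :
  (\sum_i x i) ^+ 2 <= #|I|%:R * \sum_i x i ^+ 2.
Proof.
have h : 0 <= \sum_i \sum_j (x i - x j) ^+ 2.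
  by apply: sumr_ge0 => i _; apply: sumr_ge0 => j _; exact: sqr_ge0.
have e : \sum_i \sum_j (x i - x j) ^+ 2 =
    2 * (#|I|%:R * \sum_i x i ^+ 2) - 2 * (\sum_i x i) ^+ 2.
  under eq_bigr => i _.
    under eq_bigr => j _ do rewrite sqrrB -mulr_natl.
    rewrite big_split sumrB/= sumr_const -[_ *+ #|_|]mulr_natl -mulr_sumr -mulr_sumr.
    over.
  rewrite big_split sumrB/= sumr_const -mulr_sumr -mulr_sumr -mulr_suml expr2.
  by rewrite -[_ *+ #|_|]mulr_natl; ring.
by move: h; rewrite e; lra.
Qed.

Section expectation_moments.
Context {R : realType} {d : measure_display} {Omega : measurableType d}.
Variable P : probability Omega R.
Variables X Y : Omega -> R.
Hypotheses (hX : has_moments P X) (hY : has_moments P Y).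

Lemma expectation_momentsB :
  \int[P]_w (X w - Y w) = \int[P]_w X w - \int[P]_w Y w.
Proof. by rewrite RintegralB//; exact: has_moments_integrable. Qed.

Lemma expectation_momentsZ (c : R) : \int[P]_w (c * X w) = c * \int[P]_w X w.
Proof. by rewrite RintegralZl//; exact: has_moments_integrable. Qed.

End expectation_moments.

Section quadratic_forms.
Context {R : realType} {d : measure_display} {Omega : measurableType d}.
Variables (P : probability Omega R) (I : finType) (g : I -> Omega -> R) (s : R).
Hypothesis s0 : s != 0.
Hypothesis gg : forall i, gaussian P s (g i).
Hypothesis ig : mutually_independent P g.

Definition standardized (i : I) (w : Omega) : R := g i w / s.
Local Notation z := standardized.

Let mg i : measurable_fun setT (g i).
Proof. by case: (gg i). Qed.

Lemma standardized_has_moments i : has_moments P (z i).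
Proof.
apply: has_momentsM; last exact: has_moments_cst.
exact: gaussian_has_moments s0 (gg i).
Qed.

Lemma standardized_moment i k : \int[P]_w (z i w ^+ k) = @gauss_moment R k.
Proof.
under eq_Rintegral do rewrite /standardized exprMn mulrC.
rewrite RintegralZl//; last exact: (gaussian_has_moments s0 (gg i)).2.
by rewrite (gaussian_moment k s0 (gg i)) mulrA exprVn mulVf ?mul1r// expf_neq0.
Qed.

Lemma gauss_moment1 : @gauss_moment R 1 = 0. Proof. by []. Qed.

Lemma gauss_moment2 : @gauss_moment R 2 = 1.
Proof. by rewrite /gauss_moment/= big_ord1. Qed.

Lemma gauss_moment4 : @gauss_moment R 4 = 3.
Proof. by rewrite /gauss_moment/= big_ord_recr/= big_ord1 mul1r. Qed.

Lemma gauss_moment8 : @gauss_moment R 8 = 105.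
Proof. by rewrite /gauss_moment/= !big_ord_recr/= big_ord0 mul1r -!natrM. Qed.

Let mzc (J : {pred I}) i : i \in J ->
  measurable_fun setT (z i : g_sigma_algebraType (cylinders g J) -> R).
Proof.
by move=> iJ; apply: measurable_funM => //; exact: measurable_cylinders.
Qed.

(** An index occurring once contributes an independent factor of mean zero. *)
Lemma expectation_isolated a b c e : a \notin [:: b; c; e] ->
  \int[P]_w (z a w * (z b w * z c w * z e w)) = 0.
Proof.
move=> abce; rewrite (independent_cylinders_expectationM (J := pred1 a) (K := [pred i | i \in [:: b; c; e]]) mg ig).
- have := standardized_moment a 1; under eq_Rintegral do rewrite expr1.
  by move=> ->; rewrite mul0r.
- by move=> i; rewrite !inE => /eqP ->; move: abce; rewrite !inE.
- by apply: mzc; rewrite inE.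
- by do 2 (apply: measurable_funM; last by apply: mzc; rewrite !inE eqxx ?orbT); apply: mzc; rewrite !inE eqxx.
- exact/has_moments_integrable/standardized_has_moments.
- by apply/has_moments_integrable; do 2 (apply: has_momentsM; last exact: standardized_has_moments); exact: standardized_has_moments.
- apply/has_moments_integrable; apply: has_momentsM; first exact: standardized_has_moments.
  by do 2 (apply: has_momentsM; last exact: standardized_has_moments); exact: standardized_has_moments.
Qed.

Lemma expectation_isolated2 a b : a != b -> \int[P]_w (z a w * z b w) = 0.
Proof.
move=> ab; rewrite (independent_cylinders_expectationM (J := pred1 a) (K := pred1 b) mg ig).
- have := standardized_moment a 1; under eq_Rintegral do rewrite expr1.
  by move=> ->; rewrite mul0r.
- by move=> i; rewrite !inE => /eqP ->.
- by apply: mzc; rewrite inE.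
- by apply: mzc; rewrite inE.
- exact/has_moments_integrable/standardized_has_moments.
- exact/has_moments_integrable/standardized_has_moments.
- by apply/has_moments_integrable/has_momentsM; exact: standardized_has_moments.
Qed.

Lemma expectation_two_pairs a b : a != b -> \int[P]_w (z a w ^+ 2 * z b w ^+ 2) = 1.
Proof.
move=> ab; rewrite (independent_cylinders_expectationM (J := pred1 a) (K := pred1 b) mg ig).
- by rewrite !standardized_moment gauss_moment2 mulr1.
- by move=> i; rewrite !inE => /eqP ->.
- by apply: measurable_funX; apply: mzc; rewrite inE.
- by apply: measurable_funX; apply: mzc; rewrite inE.
- exact/has_moments_integrable/has_momentsX/standardized_has_moments.
- exact/has_moments_integrable/has_momentsX/standardized_has_moments.
- by apply/has_moments_integrable/has_momentsM; apply/has_momentsX; exact: standardized_has_moments.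
Qed.

Lemma covariance_standardized a b : \int[P]_w (z a w * z b w) = (a == b)%:R.
Proof.
have [<-|ab] := eqVneq a b; last exact: expectation_isolated2.
by rewrite -gauss_moment2 -(standardized_moment a); apply: eq_Rintegral => w _; rewrite expr2.
Qed.

(** Wick's rule. Either some index is isolated and the expectation vanishes, or the indices pair up;
    when all four coincide the fourth moment $3$ counts the three pairings. *)
Lemma isserlis4 a b c e :
  \int[P]_w (z a w * (z b w * z c w * z e w)) =
  (a == b)%:R * (c == e)%:R + (a == c)%:R * (b == e)%:R + (a == e)%:R * (b == c)%:R.
Proof.
have two x y : \int[P]_w (z x w * (z x w * z y w * z y w)) = 1 + 2 * (x == y)%:R.
  have [->|xy] := eqVneq x y.
    transitivity (\int[P]_w (z y w ^+ 4)); first by apply: eq_Rintegral => w _; ring.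
    by rewrite standardized_moment gauss_moment4/=; ring.
  rewrite mulr0 addr0 -(expectation_two_pairs xy).
  by apply: eq_Rintegral => w _; ring.
have [ab|ab] := eqVneq a b.
  subst b; have [ce|ce] := eqVneq c e.
    by subst e; rewrite two; case: (a == c) => /=; ring.
  have [ac|ac] := eqVneq a c.
    subst c; rewrite (negbTE ce) !mulr0 !mul0r !addr0.
    rewrite -(@expectation_isolated e a a a); last by rewrite !inE eq_sym (negbTE ce).
    by apply: eq_Rintegral => w _; ring.
  rewrite mulr0 mul0r mulr0 !addr0.
  rewrite -(@expectation_isolated c a a e); last by rewrite !inE eq_sym (negbTE ac)/= (negbTE ce).
  by apply: eq_Rintegral => w _; ring.
have [ac|ac] := eqVneq a c.
  subst c; have [be|be] := eqVneq b e.
    subst e; rewrite (negbTE ab) !mul0r !addr0 add0r mulr1.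
    rewrite -[RHS](_ : 1 + 2 * (a == b)%:R = _); last by rewrite (negbTE ab) mulr0 addr0.
    by rewrite -two; apply: eq_Rintegral => w _; ring.
  rewrite mul0r mulr0 [b == a]eq_sym (negbTE ab) mulr0 !addr0.
  rewrite -(@expectation_isolated b a a e); last by rewrite !inE eq_sym (negbTE ab)/= (negbTE be).
  by apply: eq_Rintegral => w _; ring.
have [ae|ae] := eqVneq a e; last first.
  rewrite !mul0r !addr0 expectation_isolated// !inE.
  by rewrite (negbTE ab) (negbTE ac) (negbTE ae).
subst e; have [bc|bc] := eqVneq b c.
  subst c; rewrite !mul0r !add0r mulr1.
  rewrite -[RHS](_ : 1 + 2 * (a == b)%:R = _); last by rewrite (negbTE ab) mulr0 addr0.
  by rewrite -two; apply: eq_Rintegral => w _; ring.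
rewrite !mul0r mulr0 !addr0.
rewrite -(@expectation_isolated b a a c); last first.
  by rewrite !inE (negbTE bc) eq_sym (negbTE ab).
by apply: eq_Rintegral => w _; ring.
Qed.

Variables (L : finType) (iota : L -> I).
Hypothesis iota_inj : injective iota.

(** This is $z^\top Hz-\operatorname{tr}H$ in the variables selected by [iota]: those of one time
    step, or of the whole grid when [iota] is the identity. *)
Definition centered_form (H : L -> L -> R) w :=
  \sum_(ab : L * L) H ab.1 ab.2 * (z (iota ab.1) w * z (iota ab.2) w - (ab.1 == ab.2)%:R).

Let pr_moments (ab : L * L) : has_moments P
  (fun w => z (iota ab.1) w * z (iota ab.2) w - (ab.1 == ab.2)%:R).
Proof.
apply: has_momentsB; last exact: has_moments_cst.
by apply: has_momentsM; exact: standardized_has_moments.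
Qed.

Lemma centered_form_has_moments H : has_moments P (centered_form H).
Proof. by apply: has_moments_sum => ab; exact: has_momentsZ. Qed.

Lemma expectation_centered_form H : \int[P]_w centered_form H w = 0.
Proof.
rewrite expectation_sum_fun; last first.
  by move=> ab; apply/has_moments_integrable/has_momentsZ.
apply: big1 => -[a b] _; rewrite RintegralZl//=; last exact: has_moments_integrable (pr_moments (a, b)).
rewrite RintegralB//.
- by rewrite covariance_standardized expectation_cst (inj_eq iota_inj) subrr mulr0.
- by apply/has_moments_integrable/has_momentsM; exact: standardized_has_moments.
- exact/has_moments_integrable/has_moments_cst.
Qed.

(** Centring removes the pairing inside each form; the two remaining pairings of Wick's rule each
    give $\|H\|_F^2$, by symmetry of [H]. *)
Lemma expectation_centered_form_sqr H : (forall a b, H a b = H b a) ->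
  \int[P]_w (centered_form H w ^+ 2) = 2 * \sum_(ab : L * L) H ab.1 ab.2 ^+ 2.
Proof.
move=> symH.
pose y (ab : L * L) w := z (iota ab.1) w * z (iota ab.2) w - (ab.1 == ab.2)%:R.
transitivity (\int[P]_w (\sum_(p : (L * L) * (L * L))
    (H p.1.1 p.1.2 * H p.2.1 p.2.2) * (y p.1 w * y p.2 w))).
  apply: eq_Rintegral => w _; rewrite expr2 /centered_form big_distrlr/= pair_bigA/=.
  by apply: eq_bigr => -[[a b] [c e]] _ /=; rewrite /y/=; ring.
have hyy p : has_moments P (fun w => y p.1 w * y p.2 w).
  by apply: has_momentsM; exact: pr_moments.
rewrite expectation_sum_fun; last first.
  by move=> p; apply/has_moments_integrable/has_momentsZ.
have Eyy a b c e : \int[P]_w (y (a, b) w * y (c, e) w) =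
    (a == c)%:R * (b == e)%:R + (a == e)%:R * (b == c)%:R.
  transitivity (\int[P]_w ((z (iota a) w * (z (iota b) w * z (iota c) w * z (iota e) w)
     - (c == e)%:R * (z (iota a) w * z (iota b) w))
     - ((a == b)%:R * (z (iota c) w * z (iota e) w) - (a == b)%:R * (c == e)%:R))).
    by apply: eq_Rintegral => w _; rewrite /y/=; ring.
  have h2 i j : has_moments P (fun w => z i w * z j w).
    by apply: has_momentsM; exact: standardized_has_moments.
  have h4 : has_moments P (fun w => z (iota a) w * (z (iota b) w * z (iota c) w * z (iota e) w)).
    apply: has_momentsM; first exact: standardized_has_moments.
    by apply: has_momentsM => //; exact: standardized_has_moments.
  have hc (r : R) : has_moments P (fun=> r) by exact: has_moments_cst.
  rewrite expectation_momentsB; last 2 first.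
  - by apply: has_momentsB => //; exact: has_momentsZ.
  - by apply: has_momentsB => //; exact: has_momentsZ.
  rewrite !expectation_momentsB//; try exact: has_momentsZ.
  rewrite !expectation_momentsZ// isserlis4 !covariance_standardized expectation_cst.
  by rewrite !(inj_eq iota_inj); ring.
transitivity (\sum_(p : (L * L) * (L * L)) (H p.1.1 p.1.2 * H p.2.1 p.2.2) *
    ((p.1.1 == p.2.1)%:R * (p.1.2 == p.2.2)%:R + (p.1.1 == p.2.2)%:R * (p.1.2 == p.2.1)%:R)).
  apply: eq_bigr => -[[a b] [c e]] _ /=; rewrite RintegralZl ?Eyy//.
  exact: has_moments_integrable (hyy ((a, b), (c, e))).
rewrite -(pair_bigA _ (fun p q : L * L => (H p.1 p.2 * H q.1 q.2) *
    ((p.1 == q.1)%:R * (p.2 == q.2)%:R + (p.1 == q.2)%:R * (p.2 == q.1)%:R)))/=.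
rewrite mulr_sumr; apply: eq_bigr => -[a b] _ /=.
under eq_bigr do rewrite mulrDr.
rewrite big_split/= (bigD1 (a, b))//= big1 ?addr0; last first.
  move=> [c e] /=; rewrite xpair_eqE negb_and => /orP[]/negbTE;
    by rewrite eq_sym => ->; rewrite ?mul0r ?mulr0.
rewrite (bigD1 (b, a))//= big1 ?addr0; last first.
  move=> [c e] /=; rewrite xpair_eqE negb_and => /orP[]/negbTE;
    by rewrite eq_sym => ->; rewrite ?mul0r ?mulr0.
by rewrite !eqxx (symH b a) /=; ring.
Qed.

(** Cauchy-Schwarz used twice produces the cube of the number of pairs. For one pair
    $(uv-\delta)^4\le8(uv)^4+8\le4u^8+4v^8+8$, and the eighth moment $105$ gives
    $8\cdot105+8=848$. *)
Lemma expectation_centered_form_pow4 H :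
  \int[P]_w (centered_form H w ^+ 4) <=
  848 * (#|{: L * L}|%:R ^+ 3 * \sum_(ab : L * L) H ab.1 ab.2 ^+ 4).
Proof.
pose N : R := #|{: L * L}|%:R.
pose y (ab : L * L) w := z (iota ab.1) w * z (iota ab.2) w - (ab.1 == ab.2)%:R.
have hy (ab : L * L) : has_moments P (fun w => (H ab.1 ab.2 * y ab w) ^+ 4).
  by apply: has_momentsX; apply: has_momentsZ; exact: pr_moments.
have b1 w : centered_form H w ^+ 4 <= N ^+ 3 * \sum_(ab : L * L) (H ab.1 ab.2 * y ab w) ^+ 4.
  have N0 : 0 <= N by rewrite ler0n.
  rewrite -[4%N]/(2 * 2)%N exprM.
  apply: (@le_trans _ _ ((N * \sum_(ab : L * L) (H ab.1 ab.2 * y ab w) ^+ 2) ^+ 2)).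
    rewrite lerXn2r ?nnegrE ?sqr_ge0//; last exact: sqr_sum_le.
    by rewrite mulr_ge0// sumr_ge0// => i _; exact: sqr_ge0.
  rewrite exprMn [N ^+ 3]exprSr -mulrA ler_wpM2l ?sqr_ge0//.
  have := sqr_sum_le (fun ab : L * L => (H ab.1 ab.2 * y ab w) ^+ 2).
  by under [X in _ <= _ * X -> _]eq_bigr do rewrite -exprM.
have h4 := has_momentsX 4 (centered_form_has_moments H).
apply: (@le_trans _ _ (\int[P]_w (N ^+ 3 * \sum_(ab : L * L) (H ab.1 ab.2 * y ab w) ^+ 4))).
  apply: le_Rintegral => //; first exact: has_moments_integrable.
  by apply/has_moments_integrable/has_momentsZ/has_moments_sum.
rewrite RintegralZl//; last exact/has_moments_integrable/has_moments_sum.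
rewrite expectation_sum_fun; last by move=> ab; exact: has_moments_integrable.
rewrite mulrCA ler_wpM2l ?exprn_ge0 ?ler0n// mulr_sumr ler_sum// => -[a b] _ /=.
under eq_Rintegral do rewrite exprMn.
have hy4 : has_moments P (fun w => y (a, b) w ^+ 4) by apply/has_momentsX; exact: pr_moments.
rewrite RintegralZl//; last exact: has_moments_integrable.
rewrite [leRHS]mulrC ler_wpM2l ?exprn_even_ge0//.
have h8 i : has_moments P (fun w => z i w ^+ 8) by exact/has_momentsX/standardized_has_moments.
have hZ i j : has_moments P (fun w => 4 * z i w ^+ 8 + 4 * z j w ^+ 8).
  by apply: has_momentsD; exact: has_momentsZ.
apply: (@le_trans _ _ (\int[P]_w ((4 * z (iota a) w ^+ 8 + 4 * z (iota b) w ^+ 8) + 8))).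
  apply: le_Rintegral => //; first exact: has_moments_integrable.
    by apply/has_moments_integrable/has_momentsD => //; exact: has_moments_cst.
  move=> w _; rewrite /y/=; set u := z (iota a) w; set v := z (iota b) w.
  have e01 : ((a == b)%:R : R) = 0 \/ ((a == b)%:R : R) = 1 by case: (a == b); [right|left].
  have q (p e : R) : (p - e) ^+ 4 <= 8 * p ^+ 4 + 8 * e ^+ 4.
    have h1 : (p - e) ^+ 2 <= 2 * p ^+ 2 + 2 * e ^+ 2 by have := sqr_ge0 (p + e); rewrite sqrrD sqrrB; lra.
    have h2 : ((p - e) ^+ 2) ^+ 2 <= (2 * p ^+ 2 + 2 * e ^+ 2) ^+ 2.
      rewrite lerXn2r ?nnegrE ?sqr_ge0//.
      by have := sqr_ge0 p; have := sqr_ge0 e; lra.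
    have h3 := sqr_ge0 (p ^+ 2 - e ^+ 2).
    have e1 : (p - e) ^+ 4 = ((p - e) ^+ 2) ^+ 2 by rewrite -exprM.
    have e2 : (2 * p ^+ 2 + 2 * e ^+ 2) ^+ 2 = 8 * p ^+ 4 + 8 * e ^+ 4 - 4 * (p ^+ 2 - e ^+ 2) ^+ 2 by ring.
    by rewrite e1; move: h2; rewrite e2; lra.
  have h1 := q (u * v) (a == b)%:R.
  have h2 := sqr_ge0 (u ^+ 4 - v ^+ 4).
  have e2 : (u ^+ 4 - v ^+ 4) ^+ 2 = u ^+ 8 + v ^+ 8 - 2 * (u * v) ^+ 4 by ring.
  have h3 : ((a == b)%:R : R) ^+ 4 <= 1 by case: e01 => ->; rewrite ?expr1n// expr0n.
  by move: h1 h2; rewrite e2; lra.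
rewrite RintegralD//; [|exact: has_moments_integrable|exact: has_moments_integrable (has_moments_cst P 8)].
rewrite RintegralD//; [|exact/has_moments_integrable/has_momentsZ|exact/has_moments_integrable/has_momentsZ].
rewrite !RintegralZl//; [|exact: has_moments_integrable|exact: has_moments_integrable].
by rewrite !standardized_moment gauss_moment8 expectation_cst; lra.
Qed.

End quadratic_forms.

Section uncorrelated.
Context {R : realType} {d : measure_display} {Omega : measurableType d}.
Variable P : probability Omega R.

Lemma uncorrelated_cylinders (I : finType) (g : I -> Omega -> R) (J K : {pred I})
    (U V : Omega -> R) :
  (forall i, measurable_fun setT (g i)) -> mutually_independent P g ->
  {in J, forall i, i \notin K} ->
  measurable_fun setT (U : g_sigma_algebraType (cylinders g J) -> R) ->
  measurable_fun setT (V : g_sigma_algebraType (cylinders g K) -> R) ->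
  uncorrelated_bounded P U V.
Proof.
move=> mg ig JK mU mV u v mu mv u1 v1.
have mU' := measurable_of_cylinders mg mU.
have mV' := measurable_of_cylinders mg mV.
have muU : measurable_fun setT (fun w => u (U w)) by exact: measurableT_comp.
have mvV : measurable_fun setT (fun w => v (V w)) by exact: measurableT_comp.
apply: (independent_cylinders_expectationM mg ig JK).
- exact: measurableT_comp.
- exact: measurableT_comp.
- exact: (@bounded_integrable _ _ _ _ _ 1).
- exact: (@bounded_integrable _ _ _ _ _ 1).
- apply: (@bounded_integrable _ _ _ _ _ 1); first exact: measurable_funM.
  by move=> w; rewrite normrM mulr_ile1.
Qed.

Lemma expectation_expN_sum (n : nat) (x : nat -> Omega -> R) :
  (forall i, measurable_fun setT (x i)) -> (forall i w, 0 <= x i w) ->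
  (forall i, (i < n)%N -> uncorrelated_bounded P (fun w => \sum_(j < i) x j w) (x i)) ->
  \int[P]_w expR (- \sum_(i < n) x i w) = \prod_(i < n) \int[P]_w expR (- x i w).
Proof.
move=> mx x0 ind.
(* The clamp at zero keeps the exponential bounded by $1$ on the whole line, as
   [uncorrelated_bounded] requires of its test functions. *)
pose u (y : R) : R := expR (- Num.max 0 y).
have uE y : 0 <= y -> u y = expR (- y) by move=> y0; rewrite /u max_r.
have mu : measurable_fun setT u.
  apply: measurableT_comp => //; apply: measurableT_comp => //.
  exact: measurable_maxr.
have u1 y : `|u y| <= 1.
  rewrite ger0_norm ?expR_ge0// -[leRHS]expR0 ler_expR oppr_le0.
  by rewrite le_max lexx.
have s0 m w : 0 <= \sum_(i < m) x i w by apply: sumr_ge0 => i _.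
suff h m : (m <= n)%N ->
    \int[P]_w expR (- \sum_(i < m) x i w) = \prod_(i < m) \int[P]_w expR (- x i w) by exact: h.
elim: m => [_|m IH mn].
  by rewrite big_ord0; under eq_Rintegral do rewrite big_ord0 oppr0 expR0; rewrite expectation_cst.
rewrite big_ord_recr/= -(IH (ltnW mn)).
have := ind m mn u u mu mu u1 u1.
under eq_Rintegral do rewrite !uE//.
under [X in _ = X * _ -> _]eq_Rintegral do rewrite uE//.
under [X in _ = _ * X -> _]eq_Rintegral do rewrite uE//.
by move=> <-; apply: eq_Rintegral => w _; rewrite big_ord_recr/= opprD expRD.
Qed.

End uncorrelated.

(** * Characteristic functions of forms and of Gaussian variables on the grid *)

Section gaussian_characteristic.
Context {R : realType} {d : measure_display} {Omega : measurableType d}.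
Variable P : probability Omega R.
Variables (T : R) (T0 : 0 < T) (L : finType) (Y : L -> R -> Omega -> R) (l0 : L).
Hypothesis wY : forall l, wiener P T (Y l).
Hypothesis iY : independent_families P (fun l => history (Y l) T).
Notation mu := (@lebesgue_measure R).

Definition grid_noise (n : nat) : 'I_n * L -> Omega -> R :=
  standardized (@grid_increment R d Omega T L Y n) (Num.sqrt (T / n%:R)).

(** The limit lemmas take sequences indexed by [nat]; indices beyond the grid receive the value
    $0$. *)
Definition nat_extend (n : nat) (F : 'I_n -> Omega -> R) (i : nat) (w : Omega) : R :=
  oapp (fun j => F j w) 0 (insub i).

Lemma nat_extendE (n : nat) (F : 'I_n -> Omega -> R) (i : 'I_n) w :
  nat_extend F i w = F i w.
Proof. by rewrite /nat_extend valK. Qed.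

Lemma nat_extend_sum (n : nat) (F : 'I_n -> Omega -> R) w :
  \sum_(i < n) nat_extend F i w = \sum_(i < n) F i w.
Proof. by apply: eq_bigr => i _; rewrite nat_extendE. Qed.

Lemma measurable_nat_extend (n : nat) (F : 'I_n -> Omega -> R) i :
  (forall j, measurable_fun setT (F j)) -> measurable_fun setT (nat_extend F i).
Proof.
move=> mF; rewrite /nat_extend.
by case: insubP => [j _ _|_] /=; [exact: mF|exact: measurable_cst].
Qed.

Let sd0 n : (0 < n)%N -> Num.sqrt (T / n%:R) != 0.
Proof. by move=> n0; rewrite gt_eqF// sqrtr_gt0 divr_gt0// ltr0n. Qed.

Let gg n il : gaussian P (Num.sqrt (T / n%:R)) (@grid_increment R d Omega T L Y n il).
Proof. exact: gaussian_grid_increment. Qed.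

Let ig n : mutually_independent P (@grid_increment R d Omega T L Y n).
Proof. exact: grid_increment_independent. Qed.

Let mg n il : measurable_fun setT (@grid_increment R d Omega T L Y n il).
Proof. by case: (gg il). Qed.

Lemma measurable_grid_noise_cylinders n (J : {pred 'I_n * L}) il : il \in J ->
  measurable_fun setT (@grid_noise n il :
    g_sigma_algebraType (cylinders (@grid_increment R d Omega T L Y n) J) -> R).
Proof.
by move=> iJ; apply: measurable_funM => //; exact: measurable_cylinders.
Qed.

(* [F i] depends on the increments of the [i]-th time step only. *)
Definition step_measurable n (F : 'I_n -> Omega -> R) := forall (J : {pred 'I_n * L}) i,
  (forall l, (i, l) \in J) ->
  measurable_fun setT (F i :
    g_sigma_algebraType (cylinders (@grid_increment R d Omega T L Y n) J) -> R).

(** The earlier steps and the current one are functions of disjoint sets of grid increments. *)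
Lemma step_uncorrelated n (F : 'I_n -> Omega -> R) i : step_measurable F ->
  (i < n)%N ->
  uncorrelated_bounded P (fun w => \sum_(j < i) nat_extend F j w) (nat_extend F i).
Proof.
move=> sF ni; pose io := Ordinal ni.
apply: (@uncorrelated_cylinders _ _ _ _ _ (@grid_increment R d Omega T L Y n)
  [pred jl : 'I_n * L | (jl.1 < i)%N] [pred jl : 'I_n * L | jl.1 == io]) => //.
- by move=> [j l]; rewrite !inE /= => ji; rewrite -(inj_eq val_inj)/= ltn_eqF.
- have := @measurable_sum_fun R _ (g_sigma_algebraType
    (cylinders (@grid_increment R d Omega T L Y n) [pred jl : 'I_n * L | (jl.1 < i)%N]))
    _ (index_enum 'I_i) (fun j => nat_extend F j).
  apply=> j; have jn : (j < n)%N by rewrite (leq_trans (ltn_ord j))// ltnW.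
  rewrite (_ : nat_extend F j = F (Ordinal jn)); last first.
    by apply/funext => w; rewrite -(nat_extendE F (Ordinal jn)).
  by apply: sF => l; rewrite inE/=.
- rewrite (_ : nat_extend F i = F io); last first.
    by apply/funext => w; rewrite -(nat_extendE F io).
  by apply: sF => l; rewrite inE/=.
Qed.

Lemma measurable_step n (F : 'I_n -> Omega -> R) i : step_measurable F ->
  measurable_fun setT (F i).
Proof.
move=> sF; apply: (measurable_of_cylinders (@mg n)).
by apply: (sF predT i) => l; rewrite inE.
Qed.

Lemma step_measurable_form n H :
  step_measurable (fun (i : 'I_n) w =>
    (Num.sqrt n%:R)^-1 * centered_form (@grid_increment R d Omega T L Y n)
       (Num.sqrt (T / n%:R)) (fun l => (i, l)) H w).
Proof.
move=> J i iJ; apply: measurable_funM => //.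
apply: (@measurable_sum_fun R _ (g_sigma_algebraType
    (cylinders (@grid_increment R d Omega T L Y n) J)) _ _
    (fun ab w => H ab.1 ab.2 * (@grid_noise n (i, ab.1) w * @grid_noise n (i, ab.2) w - (ab.1 == ab.2)%:R))).
move=> ab; apply: measurable_funM => //; apply: measurable_funB => //.
by apply: measurable_funM; exact: measurable_grid_noise_cylinders.
Qed.

Lemma step_measurable_linear n (c : 'I_n -> R) :
  step_measurable (fun (i : 'I_n) w => c i * @grid_noise n (i, l0) w).
Proof.
by move=> J i iJ; apply: measurable_funM => //; exact: measurable_grid_noise_cylinders.
Qed.

(** A normalized step has variance $2\|H\|_F^2/n$, so the limit theorem is used with $v=2\|H\|_F^2$
    and the exponent $v/2$ is $\|H\|_F^2$. *)
Lemma clt_forms_bound (H : L -> L -> R) : (forall a b, H a b = H b a) ->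
  exists C, forall n, (0 < n)%N ->
  `|\int[P]_w cos (\sum_(i < n) (Num.sqrt n%:R)^-1 *
       centered_form (@grid_increment R d Omega T L Y n) (Num.sqrt (T / n%:R)) (fun l => (i, l)) H w)
    - expR (- \sum_(ab : L * L) H ab.1 ab.2 ^+ 2)| <= C / Num.sqrt n%:R.
Proof.
move=> symH; set v2 := \sum_(ab : L * L) _.
have v20 : 0 <= v2 by apply: sumr_ge0 => ab _; exact: sqr_ge0.
pose K : R := 848 * (#|{: L * L}|%:R ^+ 3 * \sum_(ab : L * L) H ab.1 ab.2 ^+ 4).
exists (2 * K + (2 * v2) ^+ 2 + 2 * v2) => n n0.
have n0' : 0 < n%:R :> R by rewrite ltr0n.
have q0 : 0 < Num.sqrt n%:R :> R by rewrite sqrtr_gt0.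
set F : 'I_n -> Omega -> R := fun i w => (Num.sqrt n%:R)^-1 *
  centered_form (@grid_increment R d Omega T L Y n) (Num.sqrt (T / n%:R)) (fun l => (i, l)) H w.
have hcf (i : 'I_n) := centered_form_has_moments (sd0 n0) (@gg n) (fun l => (i, l)) H.
have inj (i : 'I_n) : injective (fun l : L => (i, l)) by move=> a b [].
have xE i (ni : (i < n)%N) : nat_extend F i = F (Ordinal ni).
  by apply/funext => w; rewrite -(nat_extendE F (Ordinal ni)).
have sF : step_measurable F by exact: step_measurable_form.
have := @expectation_cos_sum_gaussian R d Omega P n (nat_extend F)
  (fun i => measurable_nat_extend i (fun j => measurable_step j sF))
  (fun i => step_uncorrelated sF) (2 * v2) K n0.
rewrite mulr_ge0// => /(_ isT).
have -> : 2 * v2 / 2 = v2 by field.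
under eq_Rintegral do rewrite nat_extend_sum.
apply.
- by move=> i ni; rewrite xE; exact: has_momentsZ.
- move=> i ni; rewrite xE expectation_momentsZ// (expectation_centered_form (sd0 n0) (@gg n) (@ig n) (@inj _)).
  by rewrite mulr0.
- move=> i ni; rewrite xE; under eq_Rintegral do rewrite exprMn.
  rewrite expectation_momentsZ; last exact: has_momentsX.
  rewrite (expectation_centered_form_sqr (sd0 n0) (@gg n) (@ig n) (@inj _))//.
  by rewrite exprVn sqr_sqrtr ?ler0n// mulrC.
- move=> i ni; rewrite xE; under eq_Rintegral do rewrite exprMn.
  rewrite expectation_momentsZ; last exact: has_momentsX.
  rewrite mulrC exprVn -[4%N]/(2 * 2)%N exprM sqr_sqrtr ?ler0n//.
  rewrite ler_pM2r ?invr_gt0 ?exprn_gt0//.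
  exact: (expectation_centered_form_pow4 (sd0 n0) (@gg n)).
Qed.

(** The right-hand side involves neither [s] nor [X], so all standardized Gaussian variables share
    these expectations. Adding $1$ makes the integrand nonnegative for the change of variables. *)
Lemma expectation_standard_gaussian (s : R) (X : Omega -> R) (u : R -> R) :
  0 < s -> gaussian P s X -> continuous u -> (forall x, `|u x| <= 1) ->
  \int[P]_w u (X w / s) = fine (\int[mu]_x ((1 + u x) * normal_pdf 0 1 x)%:E) - 1.
Proof.
move=> s0 gX cu u1.
have mu : measurable_fun setT u by exact: continuous_measurable_fun.
have mX : measurable_fun setT X by case: gX.
have iu : P.-integrable setT (fun w => (u (X w / s))%:E).
  apply: (@bounded_integrable _ _ _ _ _ 1) => //.
  by apply: measurableT_comp => //; exact: measurable_funM.
have cG : continuous (fun x : R => 1 + u x) by move=> x; apply: cvgD; [exact: cvg_cst|exact: cu].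
have G0 x : 0 <= 1 + u x.
  by have := u1 x; rewrite ler_norml => /andP[+ _]; lra.
rewrite -(normal_scaling s0 cG G0).
rewrite -(@ge0_expectation_gaussian _ _ _ _ _ _ (fun x => 1 + u (x / s)) gX)//.
  rewrite -/(Rintegral P setT (fun w => 1 + u (X w / s))) RintegralD//.
    by rewrite expectation_cst addrC addKr.
  exact: has_moments_integrable (has_moments_cst P 1).
apply: measurable_funD => //; apply: measurableT_comp => //.
exact: measurable_funM.
Qed.

Lemma grid_noise_telescope n w : (0 < n)%N ->
  \sum_(i < n) (Num.sqrt n%:R)^-1 * @grid_noise n (i, l0) w =
  (Y l0 T w - Y l0 0 w) / Num.sqrt T.
Proof.
move=> n0; have n0' : 0 < n%:R :> R by rewrite ltr0n.
have qT : 0 < Num.sqrt T by rewrite sqrtr_gt0.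
have qn : 0 < Num.sqrt n%:R :> R by rewrite sqrtr_gt0.
rewrite -mulr_sumr /grid_noise /standardized -mulr_suml /grid_increment/=.
rewrite -(big_mkord xpredT (fun i => Y l0 (i.+1%:R * (T / n%:R)) w - Y l0 (i%:R * (T / n%:R)) w)).
rewrite (telescope_sumr (fun i => Y l0 (i%:R * (T / n%:R)) w))// mul0r.
have -> : n%:R * (T / n%:R) = T by field; rewrite gt_eqF.
rewrite sqrtrM ?(ltW T0)// sqrtrV ?ler0n//.
by field; rewrite !gt_eqF.
Qed.

Lemma gaussian_total_increment :
  gaussian P (Num.sqrt T) (fun w => Y l0 T w - Y l0 0 w).
Proof.
have := gg ((ord0, l0) : 'I_1 * L); rewrite divr1 => -[mX XE].
have e : @grid_increment R d Omega T L Y 1 (ord0, l0) = (fun w => Y l0 T w - Y l0 0 w).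
  by apply/funext => w; rewrite /grid_increment/= divr1 mul1r mul0r.
by rewrite -e; split.
Qed.

(** The left-hand side does not depend on a grid, yet for every [n] it concerns a sum of [n]
    independent standardized increments; the bound $C/\sqrt n$ for all [n] forces equality. *)
Lemma expectation_cos_total (a : R) :
  \int[P]_w cos (a * ((Y l0 T w - Y l0 0 w) / Num.sqrt T)) = expR (- (a ^+ 2 / 2)).
Proof.
apply/eqP; rewrite -subr_eq0 -normr_eq0 eq_le normr_ge0 andbT.
set D := `|_|; rewrite leNgt; apply/negP => D0.
(* This is $2K+v^2+v$ with $v=a^2$ and $K=3a^4$, the standard normal fourth moment being $3$. *)
pose C : R := 2 * (a ^+ 4 * 3) + (a ^+ 2) ^+ 2 + a ^+ 2.
have C0 : 0 <= C.
  have h4 : 0 <= a ^+ 4 by rewrite exprn_even_ge0.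
  by rewrite /C; have := sqr_ge0 (a ^+ 2); have := sqr_ge0 a; lra.
suff hC n : (0 < n)%N -> D <= C / Num.sqrt n%:R.
  (* For this [n] one has $\sqrt n>C/D$, against $D\le C/\sqrt n$. *)
  pose n := (Num.truncn ((C / D) ^+ 2)).+1.
  have := hC n isT; apply/negP; rewrite -ltNge ltr_pdivrMr ?sqrtr_gt0 ?ltr0n//.
  rewrite mulrC -ltr_pdivrMr//.
  rewrite -[ltLHS]ger0_norm ?divr_ge0 ?(ltW D0)// -sqrtr_sqr ltr_sqrt ?ltr0n//.
  exact: truncnS_gt.
move=> n0; have q0 : 0 < Num.sqrt n%:R :> R by rewrite sqrtr_gt0 ltr0n.
pose F : 'I_n -> Omega -> R := fun i w => ((Num.sqrt n%:R)^-1 * a) * @grid_noise n (i, l0) w.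
have sF : step_measurable F by exact: (step_measurable_linear (fun=> (Num.sqrt n%:R)^-1 * a)).
have xE i (ni : (i < n)%N) : nat_extend F i = F (Ordinal ni).
  by apply/funext => w; rewrite -(nat_extendE F (Ordinal ni)).
have hz il := standardized_has_moments (sd0 n0) (@gg n) il.
have mz := standardized_moment (sd0 n0) (@gg n).
have := @expectation_cos_sum_gaussian R d Omega P n (nat_extend F)
  (fun i => measurable_nat_extend i (fun j => measurable_step j sF))
  (fun i => step_uncorrelated sF) (a ^+ 2) (a ^+ 4 * 3) n0 (sqr_ge0 a).
under eq_Rintegral do rewrite nat_extend_sum.
have e w : \sum_(i < n) F i w = a * ((Y l0 T w - Y l0 0 w) / Num.sqrt T).
  by rewrite -(grid_noise_telescope w n0) mulr_sumr; apply: eq_bigr => i _; rewrite /F; ring.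
under eq_Rintegral do rewrite e.
apply.
- by move=> i ni; rewrite xE; exact/has_momentsZ/hz.
- move=> i ni; rewrite xE (expectation_momentsZ (hz _)).
  have := mz (Ordinal ni, l0) 1%N; under eq_Rintegral do rewrite expr1.
  by rewrite gauss_moment1 => ->; rewrite mulr0.
- move=> i ni; rewrite xE; under eq_Rintegral do rewrite exprMn.
  rewrite (expectation_momentsZ (has_momentsX 2 (hz _))).
  rewrite mz gauss_moment2 mulr1 exprMn exprVn sqr_sqrtr ?ler0n//.
  by rewrite mulrC.
- move=> i ni; rewrite xE; under eq_Rintegral do rewrite exprMn.
  rewrite (expectation_momentsZ (has_momentsX 4 (hz _))).
  rewrite mz gauss_moment4 exprMn exprVn.
  have -> : Num.sqrt n%:R ^+ 4 = n%:R ^+ 2 :> R.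
    by rewrite -[4%N]/(2 * 2)%N exprM sqr_sqrtr ?ler0n.
  by rewrite le_eqVlt; apply/orP; left; apply/eqP; field; rewrite pnatr_eq0 -lt0n.
Qed.

Lemma expectation_cos_gaussian (s a : R) (X : Omega -> R) : 0 < s -> gaussian P s X ->
  \int[P]_w cos (a * (X w / s)) = expR (- (a ^+ 2 / 2)).
Proof.
move=> s0 gX; have ca : continuous (fun x : R => cos (a * x)).
  move=> x; apply: (@continuous_comp _ _ _ ( *%R a) (@cos R)); last exact: continuous_cos.
  exact: mulrl_continuous.
have c1 (x : R) : `|cos (a * x)| <= 1 by exact: cos_max.
rewrite (expectation_standard_gaussian s0 gX ca c1).
have qT : 0 < Num.sqrt T by rewrite sqrtr_gt0.
by rewrite -expectation_cos_total -(expectation_standard_gaussian qT gaussian_total_increment ca c1).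
Qed.

(** Reflection of Lebesgue measure and evenness of the density give the same value for [a] and
    [- a], while the sine is odd. *)
Lemma expectation_sin_gaussian (s a : R) (X : Omega -> R) : 0 < s -> gaussian P s X ->
  \int[P]_w sin (a * (X w / s)) = 0.
Proof.
move=> s0 gX; have ca (b : R) : continuous (fun x : R => sin (b * x)).
  move=> x; apply: (@continuous_comp _ _ _ ( *%R b) (@sin R)); last exact: continuous_sin.
  exact: mulrl_continuous.
have c1 (b x : R) : `|sin (b * x)| <= 1 by exact: sin_max.
suff : \int[P]_w sin (a * (X w / s)) = \int[P]_w sin ((- a) * (X w / s)).
  under [RHS]eq_Rintegral do rewrite mulNr sinN -mulN1r.
  rewrite RintegralZl//; last first.
    apply: integrable_sin; apply: measurable_funM => //; apply: measurable_funM => //.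
    by case: gX.
  by move=> h; lra.
rewrite (expectation_standard_gaussian s0 gX (ca a) (c1 a)).
rewrite (expectation_standard_gaussian s0 gX (ca (- a)) (c1 (- a))).
congr (fine _ - _).
transitivity (\int[pushforward mu (-%R : R -> measurableTypeR R)]_x ((1 + sin (a * x)) * normal_pdf 0 1 x)%:E)%E.
  by apply: eq_measure_integral => A mA _; exact/esym/lebesgue_measureN.
have G0 x : (0 <= ((1 + sin (a * x)) * normal_pdf 0 1 x)%:E)%E.
  have h : 0 <= 1 + sin (a * x) by have := c1 a x; rewrite ler_norml => /andP[+ _]; lra.
  by rewrite lee_fin mulr_ge0// normal_pdf_ge0.
have mG : measurable_fun setT (fun x : R => ((1 + sin (a * x)) * normal_pdf 0 1 x)%:E).
  apply/measurable_EFinP; apply: measurable_funM; last exact: measurable_normal_pdf.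
  by apply: measurable_funD => //; exact: continuous_measurable_fun.
rewrite ge0_integral_pushforward//=.
by apply: eq_integral => x _; rewrite normal_pdfN ?oner_neq0// mulrN mulNr.
Qed.

End gaussian_characteristic.

Lemma near_div_sqrt (R : realType) (C e : R) : 0 < e ->
  \forall n \near \oo, C / Num.sqrt n%:R <= e.
Proof.
move=> e0; near=> n.
have n0 : 0 < n%:R :> R by rewrite ltr0n; near: n; exact: nbhs_infty_gt.
rewrite ler_pdivrMr ?sqrtr_gt0// mulrC -ler_pdivrMr//.
rewrite (le_trans (ler_norm _))// -sqrtr_sqr ler_sqrt//.
rewrite (le_trans (ltW (truncnS_gt _)))// ler_nat.
by near: n; exact: nbhs_infty_ge.
Unshelve. all: by end_near. Qed.

Section expectation_swap.
Context {R : realType} {d1 d2 : measure_display}.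
Context {O1 : measurableType d1} {O2 : measurableType d2}.
Variables (P1 : probability O1 R) (P2 : probability O2 R).

Lemma expectation_swap (F : O1 * O2 -> R) : measurable_fun setT F ->
  (forall z, `|F z| <= 1) ->
  \int[P1]_x (\int[P2]_y F (x, y)) = \int[P2]_y (\int[P1]_x F (x, y)).
Proof.
move=> mF F1.
have iF : (P1 \x P2)%E.-integrable setT (EFin \o F).
  apply: (@bounded_integrable _ _ _ (P1 \x P2)%E _ 1) => //.
have m1 x : measurable_fun setT (fun y => F (x, y)) by exact: measurableT_comp.
have m2 y : measurable_fun setT (fun x => F (x, y)) by exact: measurableT_comp.
have i1 x : P2.-integrable setT (fun y => (F (x, y))%:E).
  exact: (@bounded_integrable _ _ _ P2 _ 1).
have i2 y : P1.-integrable setT (fun x => (F (x, y))%:E).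
  exact: (@bounded_integrable _ _ _ P1 _ 1).
have := @Fubini _ _ _ _ _ P1 P2 _ iF => /= FE.
rewrite /Rintegral; congr fine.
transitivity (\int[P1]_x \int[P2]_y (F (x, y))%:E)%E.
  by apply: eq_integral => x _; rewrite fineK// integrable_fin_num.
rewrite FE; apply: eq_integral => y _.
by rewrite fineK// integrable_fin_num.
Qed.

End expectation_swap.

Section bounded_convergence.
Context {R : realType} {d : measure_display} {Omega : measurableType d}.
Variable P : probability Omega R.

Lemma bounded_convergence_ae (X : nat -> Omega -> R) (Z : Omega -> R) (M : R) :
  (forall n, measurable_fun setT (X n)) -> measurable_fun setT Z ->
  {ae P, forall w, X n w @[n --> \oo] --> Z w} ->
  (forall n w, `|X n w| <= M) ->
  \int[P]_w X n w @[n --> \oo] --> \int[P]_w Z w.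
Proof.
move=> mX mZ XZ XM.
have iM : P.-integrable setT (fun=> M%:E) by exact: has_moments_integrable (has_moments_cst P M).
have cXZ : {ae P, forall w, setT w -> (EFin \o X n) w @[n --> \oo] --> (EFin \o Z) w}.
  by apply: filterS XZ => w h _; apply: cvg_EFin => //; exact: nearW.
have bX : {ae P, forall w n, setT w -> (`|(EFin \o X n) w| <= M%:E)%E}.
  by apply: aeW => w n _; rewrite lee_fin.
have mX' n : measurable_fun setT (EFin \o X n) by exact/measurable_EFinP.
have mZ' : measurable_fun setT (EFin \o Z) by exact/measurable_EFinP.
have [iZ _ h] := @dominated_convergence _ _ R P setT measurableT (fun n => EFin \o X n)
  (EFin \o Z) (fun=> M%:E) mX' mZ' cXZ iM bX.
apply: fine_cvg; rewrite /Rintegral fineK//; exact: integrable_fin_num.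
Qed.

Lemma bounded_convergence (X : nat -> Omega -> R) (Z : Omega -> R) (M : R) :
  (forall n, measurable_fun setT (X n)) -> measurable_fun setT Z ->
  (forall w, X n w @[n --> \oo] --> Z w) ->
  (forall n w, `|X n w| <= M) ->
  \int[P]_w X n w @[n --> \oo] --> \int[P]_w Z w.
Proof. by move=> mX mZ XZ; apply: bounded_convergence_ae => //; exact: aeW. Qed.

End bounded_convergence.

(** * Laplace transforms of squared norms of form sums *)

Section laplace_clt.
Context {R : realType} {d : measure_display} {Omega : measurableType d}.
Variable P : probability Omega R.
Variables (T : R) (T0 : 0 < T) (L : finType) (Y : L -> R -> Omega -> R) (l0 : L).
Hypothesis wY : forall l, wiener P T (Y l).
Hypothesis iY : independent_families P (fun l => history (Y l) T).

Definition form_sum (n : nat) (H : L -> L -> R) (w : Omega) : R :=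
  \sum_(i < n) (Num.sqrt n%:R)^-1 *
    centered_form (@grid_increment R d Omega T L Y n) (Num.sqrt (T / n%:R)) (fun l => (i, l)) H w.

Lemma measurable_form_sum n H : measurable_fun setT (form_sum n H).
Proof.
apply: measurable_sum_fun => i.
exact: (measurable_step T0 wY i (step_measurable_form (n := n) H)).
Qed.

(** An [m]-dimensional Gaussian direction is read off the [m]-step grid of the single process
    [Y l0]; the factor $\sqrt{2l}$ turns the exponent $|y|^2/2$ into $l|y|^2$. *)
Lemma expectation_cos_grid (m : nat) (y : 'I_m -> R) (l : R) : 0 <= l ->
  \int[P]_w cos (\sum_(j < m) (Num.sqrt (2 * l) * y j) * @grid_noise R d Omega T L Y m (j, l0) w) =
  expR (- (l * \sum_j y j ^+ 2)).
Proof.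
move=> l0'; set c := Num.sqrt _.
have cE : c ^+ 2 = 2 * l by rewrite sqr_sqrtr// mulr_ge0.
pose F (j : 'I_m) (w : Omega) := (c * y j) * @grid_noise R d Omega T L Y m (j, l0) w.
have sF : step_measurable T Y F by exact: (@step_measurable_linear R d Omega T L Y l0 m (fun j => c * y j)).
have xE i (ni : (i < m)%N) : nat_extend F i = F (Ordinal ni).
  by apply/funext => w; rewrite -(nat_extendE F (Ordinal ni)).
have sd (j : 'I_m) : 0 < Num.sqrt (T / m%:R).
  by rewrite sqrtr_gt0 divr_gt0// ltr0n; case: j => j; exact: leq_ltn_trans.
have gg (j : 'I_m) : gaussian P (Num.sqrt (T / m%:R)) (@grid_increment R d Omega T L Y m (j, l0)).
  exact: gaussian_grid_increment.
have := @expectation_cos_sum_symmetric R d Omega P m (nat_extend F)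
  (fun i => measurable_nat_extend i (fun j => measurable_step T0 wY j sF))
  (fun i => step_uncorrelated T0 wY iY sF).
under eq_Rintegral do rewrite nat_extend_sum.
move=> ->; last first.
  by move=> i mi; rewrite xE; exact: (expectation_sin_gaussian _ (sd (Ordinal mi)) (gg (Ordinal mi))).
rewrite mulr_sumr -sumrN expR_sum; apply: eq_bigr => j _.
under eq_Rintegral do rewrite nat_extendE.
rewrite (expectation_cos_gaussian T0 l0 wY iY _ (sd j) (gg j)).
by congr expR; rewrite exprMn cE; field.
Qed.

Lemma laplace_grid (m : nat) (l : R) : 0 <= l ->
  \int[P]_w expR (- (l * \sum_(j < m) @grid_noise R d Omega T L Y m (j, l0) w ^+ 2)) =
  (Num.sqrt (1 + 2 * l))^-1 ^+ m.
Proof.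
move=> l0'.
pose F (j : 'I_m) (w : Omega) := l * @grid_noise R d Omega T L Y m (j, l0) w ^+ 2.
have sF : step_measurable T Y F.
  move=> J i iJ; apply: measurable_funM => //; apply: measurable_funX.
  exact: measurable_grid_noise_cylinders.
have sd (j : 'I_m) : 0 < Num.sqrt (T / m%:R).
  by rewrite sqrtr_gt0 divr_gt0// ltr0n; case: j => j; exact: leq_ltn_trans.
have gg (j : 'I_m) : gaussian P (Num.sqrt (T / m%:R)) (@grid_increment R d Omega T L Y m (j, l0)).
  exact: gaussian_grid_increment.
have F0 i w : 0 <= nat_extend F i w.
  by rewrite /nat_extend; case: insubP => //= j _ _; rewrite mulr_ge0 ?sqr_ge0.
have := @expectation_expN_sum R d Omega P m (nat_extend F)
  (fun i => measurable_nat_extend i (fun j => measurable_step T0 wY j sF)) F0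
  (fun i => step_uncorrelated T0 wY iY sF).
under eq_Rintegral do rewrite nat_extend_sum -mulr_sumr.
move=> ->; rewrite -[in RHS](card_ord m) -prodr_const; apply: eq_bigr => j _.
under eq_Rintegral do rewrite nat_extendE.
by rewrite (laplace_gaussian_sqr _ (gg j) l0')// gt_eqF// sd.
Qed.

Variables (m : nat) (H : 'I_m -> L -> L -> R).
Hypothesis symH : forall j a b, H j a b = H j b a.
(** The value $1/2$ compensates the factor $2$ in the variance of a centred form, so that the limit
    law of the [m] form sums is standard normal. *)
Hypothesis orthH : forall i j : 'I_m,
  \sum_(ab : L * L) H i ab.1 ab.2 * H j ab.1 ab.2 = (i == j)%:R / 2.

Lemma form_sum_linear n (a : 'I_m -> R) w :
  form_sum n (fun p q => \sum_j a j * H j p q) w = \sum_j a j * form_sum n (H j) w.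
Proof.
rewrite /form_sum; under [RHS]eq_bigr do rewrite mulr_sumr.
rewrite exchange_big/=; apply: eq_bigr => i _.
under [RHS]eq_bigr do rewrite mulrCA.
rewrite -mulr_sumr; congr (_ * _); rewrite /centered_form.
under [RHS]eq_bigr do rewrite mulr_sumr.
rewrite exchange_big/=; apply: eq_bigr => ab _.
by rewrite mulr_suml; apply: eq_bigr => j _; rewrite -mulrA.
Qed.

(** As in the Cramér-Wold device: a linear combination of form sums is the form sum of the combined
    matrix, whose squared Frobenius norm is $|a|^2/2$ by [orthH]. *)
Lemma form_sum_cos_cvg (a : 'I_m -> R) :
  (fun n => \int[P]_w cos (\sum_j a j * form_sum n (H j) w)) @ \oo -->
  expR (- (2^-1 * \sum_j a j ^+ 2)).
Proof.
pose Ha p q := \sum_j a j * H j p q.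
have symHa p q : Ha p q = Ha q p by apply: eq_bigr => j _; rewrite symH.
have [C hC] := clt_forms_bound T0 wY iY symHa.
have HaE : \sum_(ab : L * L) Ha ab.1 ab.2 ^+ 2 = 2^-1 * \sum_j a j ^+ 2.
  transitivity (\sum_i \sum_j a i * a j * \sum_(ab : L * L) H i ab.1 ab.2 * H j ab.1 ab.2).
    transitivity (\sum_(ab : L * L) \sum_i \sum_j
        a i * a j * (H i ab.1 ab.2 * H j ab.1 ab.2)).
      apply: eq_bigr => ab _; rewrite /Ha expr2 big_distrlr/=.
      by apply: eq_bigr => i _; apply: eq_bigr => j _; ring.
    rewrite exchange_big/=; apply: eq_bigr => i _.
    by rewrite exchange_big/=; apply: eq_bigr => j _; rewrite mulr_sumr.
  rewrite mulr_sumr; apply: eq_bigr => i _.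
  under eq_bigr do rewrite orthH.
  rewrite (bigD1 i)//= big1 ?addr0; first by rewrite eqxx/=; ring.
  by move=> j ji; rewrite eq_sym (negbTE ji) mul0r mulr0.
apply/cvgrPdist_le => e e0; near=> n.
have n0 : (0 < n)%N by near: n; exact: nbhs_infty_gt.
rewrite distrC; have := hC n n0; rewrite HaE.
under eq_Rintegral do rewrite -/(form_sum n Ha _) form_sum_linear.
move=> /le_trans; apply.
by near: n; exact: near_div_sqrt.
Unshelve. all: by end_near. Qed.

(* The Laplace transform of a squared norm is the average of the
   characteristic function over an independent Gaussian direction, here carried
   by the increments of [Y l0] on a second copy of the probability space. *)
Lemma laplace_clt (l : R) : 0 <= l ->
  (fun n => \int[P]_w expR (- (l * \sum_j form_sum n (H j) w ^+ 2))) @ \oo -->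
  (Num.sqrt (1 + 2 * l))^-1 ^+ m.
Proof.
move=> l0'; set c := Num.sqrt (2 * l).
have cE : c ^+ 2 = 2 * l by rewrite sqr_sqrtr// mulr_ge0.
pose N j w := @grid_noise R d Omega T L Y m (j, l0) w.
have mN j : measurable_fun setT (N j).
  apply: measurable_funM => //.
  by case: (gaussian_grid_increment T0 wY (j, l0)).
pose F n (z : Omega * Omega) := cos (\sum_j (c * form_sum n (H j) z.1) * N j z.2).
have mF n : measurable_fun setT (F n).
  apply: measurable_cos_comp; apply: measurable_sum_fun => j.
  apply: measurable_funM; last exact: (measurableT_comp (mN j) measurable_snd).
  apply: measurable_funM => //.
  exact: (measurableT_comp (measurable_form_sum n (H j)) measurable_fst).
(* Exchanging the two expectations leaves, for each frozen direction, the characteristic function of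
   one linear combination of form sums. *)
have E1 n : \int[P]_w expR (- (l * \sum_j form_sum n (H j) w ^+ 2)) =
    \int[P]_w' (\int[P]_w cos (\sum_j (c * N j w') * form_sum n (H j) w)).
  transitivity (\int[P]_w (\int[P]_w' F n (w, w'))).
    by apply: eq_Rintegral => w _; rewrite /F/= (expectation_cos_grid (fun j => form_sum n (H j) w) l0').
  rewrite expectation_swap//; last by move=> z; exact: cos_max.
  apply: eq_Rintegral => w' _; apply: eq_Rintegral => w _; rewrite /F/=.
  by congr cos; apply: eq_bigr => j _; ring.
under eq_fun do rewrite E1.
rewrite -(laplace_grid m l0').
pose G n w' := \int[P]_w cos (\sum_j (c * N j w') * form_sum n (H j) w).
pose g w' := expR (- (l * \sum_j N j w' ^+ 2)).
have mG n : measurable_fun setT (G n).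
  (* The inner expectation is measurable by Fubini's theorem, applied with the two coordinates
     exchanged. *)
  have h := mF n; pose F' (z : Omega * Omega) := F n (z.2, z.1).
  have mF' : measurable_fun setT F'.
    apply: (measurableT_comp h); apply: measurable_fun_pair.
      exact: measurable_snd.
    exact: measurable_fst.
  apply/measurable_EFinP.
  have -> : EFin \o G n = fubini_F P (EFin \o F').
    apply/funext => w' /=; rewrite /fubini_F /G /Rintegral fineK.
      apply: eq_integral => w _; rewrite /F' /F/=; congr (_%:E).
      by congr cos; apply: eq_bigr => j _; ring.
    apply: integrable_fin_num => //; apply: integrable_cos.
    apply: measurable_sum_fun => j; apply: measurable_funM => //.
    exact: measurable_form_sum.
  apply: (measurable_fubini_F (m1 := P) (m2 := P)).
  by apply: (@bounded_integrable _ _ _ (P \x P)%E _ 1) => // z; exact: cos_max.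
have mg : measurable_fun setT g.
  apply: measurableT_comp => //; apply: measurableT_comp => //.
  apply: measurable_funM => //; apply: measurable_sum_fun => j.
  exact: measurable_funX.
have Gg w' : G n w' @[n --> \oo] --> g w'.
  have := @form_sum_cos_cvg (fun j => c * N j w').
  have -> : 2^-1 * \sum_j (c * N j w') ^+ 2 = l * \sum_j N j w' ^+ 2.
    by rewrite !mulr_sumr; apply: eq_bigr => j _; rewrite exprMn cE; field.
  exact.
have G1 n w' : `|G n w'| <= 1.
  apply: norm_expectation_le => [|w]; last exact: cos_max.
  apply: measurable_cos_comp; apply: measurable_sum_fun => j.
  by apply: measurable_funM => //; exact: measurable_form_sum.
exact: (bounded_convergence mG mg Gg G1).
Qed.

End laplace_clt.

(** * Convergence of Laplace transforms and convergence in distribution *)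

Section cvg_big.
Context {R : realType} {T : Type} {F : set_system T} {FF : Filter F}.

Lemma cvg_sum_fun (I : Type) (s : seq I) (f : I -> T -> R) (l : I -> R) :
  (forall i, f i x @[x --> F] --> l i) ->
  (\sum_(i <- s) f i x) @[x --> F] --> \sum_(i <- s) l i.
Proof.
move=> fl; elim: s => [|i s IH].
  by under eq_fun do rewrite big_nil; rewrite big_nil; exact: cvg_cst.
by under eq_fun do rewrite big_cons; rewrite big_cons; exact: cvgD.
Qed.

Lemma cvg_prod_fun (I : Type) (s : seq I) (f : I -> T -> R) (l : I -> R) :
  (forall i, f i x @[x --> F] --> l i) ->
  (\prod_(i <- s) f i x) @[x --> F] --> \prod_(i <- s) l i.
Proof.
move=> fl; elim: s => [|i s IH].
  by under eq_fun do rewrite big_nil; rewrite big_nil; exact: cvg_cst.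
by under eq_fun do rewrite big_cons; rewrite big_cons; exact: cvgM.
Qed.

End cvg_big.

Section interval_continuity.
Context {R : realType}.

(** Compactness as a near covering: local moduli, taken at half the radius of continuity, merge into
    one modulus for the interval. *)
Lemma within_uniform_continuity (f : R -> R) (a b : R) :
  {within `[a, b], continuous f} -> forall e, 0 < e ->
  exists2 dl, 0 < dl & forall x y, a <= x <= b -> a <= y <= b ->
    `|x - y| < dl -> `|f x - f y| <= e.
Proof.
move=> cf e e0.
have : near_covering `[a, b].
  by rewrite -compact_near_coveringP; exact: segment_compact.
move=> /(_ R (0^'+) (fun dl x => a <= x <= b -> forall y, a <= y <= b -> `|x - y| < dl -> `|f x - f y| <= e) _).
case.
  move=> x xab.
  have : f x' @[x' --> within [set` `[a, b]] (nbhs x)] --> f x.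
    by move/subspace_continuousP : cf => /(_ x xab).
  move=> /cvgrPdist_lt /(_ (e / 2)); rewrite divr_gt0// => /(_ isT).
  rewrite near_withinE => /nbhs_ballP[r /= r0 hr].
  exists (ball x (r / 2), [set dl | dl < r / 2]) => /=.
    split; first by exists (r / 2) => //=; rewrite divr_gt0.
    by apply: nbhs_right_lt; rewrite divr_gt0.
  move=> [x' dl] /= [xx' dlr] x'ab y yab x'y.
  have rr : r / 2 < r by rewrite ltr_pdivrMr// ltr_pMr// ltr1n.
  have hx' : `|f x - f x'| < e / 2.
    by apply: hr; [exact: lt_trans xx' rr|rewrite /= in_itv].
  have hy : `|f x - f y| < e / 2.
    apply: hr; last by rewrite /= in_itv.
    rewrite /ball/= -(subrKA x') (le_lt_trans (ler_normD _ _))//.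
    by rewrite [r]splitr ltrD// (lt_trans x'y).
  have -> : f x' - f y = (f x - f y) - (f x - f x') by ring.
  by rewrite (le_trans (ler_normB _ _))// [e]splitr ltW// ltrD.
move=> dl /= dl0 h.
exists (dl / 2) => [|x y xab yab xy]; first by rewrite divr_gt0.
apply: (h (dl / 2) _ _ x) => //=.
- by rewrite sub0r normrN gtr0_norm ?divr_gt0// ltr_pdivrMr// ltr_pMr// ltr1n.
- by rewrite divr_gt0.
Qed.

Lemma within_bounded (f : R -> R) (a b : R) :
  {within `[a, b], continuous f} -> exists2 M, 0 <= M & forall x, a <= x <= b -> `|f x| <= M.
Proof.
move=> cf; have := continuous_compact cf (@segment_compact _ a b).
move=> /compact_bounded[N [_ hN]]; exists (`|N| + 1) => [|x xab]; first by rewrite addr_ge0.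
apply: (hN (`|N| + 1)); first by rewrite ltr_pwDr// ler_norm.
by exists x => //; rewrite /= in_itv.
Qed.

End interval_continuity.

(** * Weierstrass approximation by Bernstein polynomials *)

Section weierstrass.
Context {R : realType}.

(* The expectation of [phi] at [k] plus a binomial variable of parameters [n]
   and [u], computed one trial at a time. *)
Fixpoint binomial_mean (n : nat) (u : R) (phi : nat -> R) (k : nat) : R :=
  if n is n'.+1 then u * binomial_mean n' u phi k.+1 + (1 - u) * binomial_mean n' u phi k
  else phi k.

Fixpoint binomial_mean_poly (n : nat) (phi : nat -> R) (k : nat) : {poly R} :=
  if n is n'.+1 then 'X * binomial_mean_poly n' phi k.+1 + (1 - 'X) * binomial_mean_poly n' phi k
  else (phi k)%:P.

Lemma horner_binomial_mean n u phi k :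
  (binomial_mean_poly n phi k).[u] = binomial_mean n u phi k.
Proof. by elim: n k => [|n IH] k /=; rewrite !hornerE ?IH. Qed.

Lemma binomial_mean_le n u phi psi k : 0 <= u <= 1 ->
  (forall j, (j <= k + n)%N -> phi j <= psi j) ->
  binomial_mean n u phi k <= binomial_mean n u psi k.
Proof.
move=> /andP[u0 u1]; elim: n k => [|n IH] k /= h; first by apply: h; rewrite addn0.
rewrite lerD// ler_wpM2l ?subr_ge0// IH// => j jk; apply: h.
  by rewrite -addSnnS.
by rewrite (leq_trans jk)// leq_add2l.
Qed.

Lemma binomial_mean_linear n u phi psi (a b : R) k :
  binomial_mean n u (fun j => a * phi j + b * psi j) k =
  a * binomial_mean n u phi k + b * binomial_mean n u psi k.
Proof. by elim: n k => [|n IH] k //=; rewrite !IH; ring. Qed.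

Lemma binomial_mean_cst n u (c : R) k : binomial_mean n u (fun=> c) k = c.
Proof. by elim: n k => [|n IH] k //=; rewrite !IH; ring. Qed.

(** Squared bias plus the binomial variance $nu(1-u)$. *)
Lemma binomial_mean_sqr n u (a : R) k :
  binomial_mean n u (fun j => (j%:R - a) ^+ 2) k =
  (k%:R + n%:R * u - a) ^+ 2 + n%:R * (u * (1 - u)).
Proof.
elim: n k => [|n IH] k /=; first by rewrite !mul0r !addr0.
by rewrite !IH -!natr1; ring.
Qed.

(** Bernstein's proof, with Chebyshev's inequality replaced by a pointwise majorant:
    $|h(u)-\phi(j)|\le e/2+(C/n^2)(j-nu)^2$. Averaging then uses only monotonicity, linearity and
    the binomial variance. *)
Lemma weierstrass (h : R -> R) : continuous h -> forall e, 0 < e ->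
  exists p : {poly R}, forall u, 0 <= u <= 1 -> `|h u - p.[u]| <= e.
Proof.
move=> ch e e0.
have cw : {within `[0, 1], continuous h} by exact: continuous_subspaceT.
have [M M0 hM] := within_bounded cw.
have e2 : 0 < e / 2 by rewrite divr_gt0.
have [dl dl0 hdl] := within_uniform_continuity cw e2.
(* With this constant the quadratic term is at least $2M$ as soon as $|u-j/n|\ge dl$; [n] is then
   chosen so that $C/n\le e/2$. *)
pose C := 2 * M / dl ^+ 2.
have C0 : 0 <= C by rewrite /C divr_ge0 ?sqr_ge0// mulr_ge0.
pose n := (Num.truncn (C / (e / 2))).+1.
have n0 : 0 < n%:R :> R by rewrite ltr0n.
pose phi (j : nat) := h (j%:R / n%:R).
exists (binomial_mean_poly n phi 0) => u u01; rewrite horner_binomial_mean.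
have u01' := u01; case/andP: u01' => u0 u1.
pose psi (j : nat) := e / 2 * 1 + C / n%:R ^+ 2 * (j%:R - n%:R * u) ^+ 2.
have bnd (j : nat) : (j <= 0 + n)%N -> `|h u - phi j| <= psi j.
  rewrite add0n => jn.
  have j01 : 0 <= (j%:R / n%:R : R) <= 1.
    by rewrite divr_ge0 ?ler0n//= ler_pdivrMr// mul1r ler_nat.
  have q0 : 0 <= C / n%:R ^+ 2 * (j%:R - n%:R * u) ^+ 2.
    by rewrite mulr_ge0 ?sqr_ge0// divr_ge0 ?sqr_ge0.
  have [uj|uj] := ltP `|u - j%:R / n%:R| dl.
    by rewrite /psi mulr1 (le_trans (hdl _ _ u01 j01 uj))// lerDl.
  rewrite /psi mulr1 (@le_trans _ _ (2 * M))//.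
    by rewrite (le_trans (ler_normB _ _))// mulr_natl mulr2n lerD// hM.
  rewrite (@le_trans _ _ (C / n%:R ^+ 2 * (j%:R - n%:R * u) ^+ 2))//; last first.
    by rewrite lerDr ltW.
  have -> : C / n%:R ^+ 2 * (j%:R - n%:R * u) ^+ 2 = 2 * M * ((u - j%:R / n%:R) ^+ 2 / dl ^+ 2).
    by rewrite /C; field; rewrite !gt_eqF.
  rewrite ler_peMr ?mulr_ge0// ler_pdivlMr ?exprn_gt0// mul1r.
  by rewrite -(@real_normK _ (u - _)) ?num_real// lerXn2r ?nnegrE// ltW.
have psiE : binomial_mean n u psi 0 <= e.
  rewrite /psi (binomial_mean_linear n u (fun=> 1) (fun j => (j%:R - n%:R * u) ^+ 2)).
  rewrite binomial_mean_cst binomial_mean_sqr add0r subrr expr0n add0r mulr1.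
  rewrite [leRHS]splitr lerD2l (@le_trans _ _ (C / n%:R))//.
    have -> : C / n%:R ^+ 2 * (n%:R * (u * (1 - u))) = C / n%:R * (u * (1 - u)).
      by field; rewrite gt_eqF.
    by rewrite ler_piMr ?divr_ge0 ?(ltW n0)//; nra.
  rewrite ler_pdivrMr// [e / 2 * _]mulrC -ler_pdivrMr// ltW// truncnS_gt//.
have hcst : h u = binomial_mean n u (fun=> h u) 0 by rewrite binomial_mean_cst.
have dE : h u - binomial_mean n u phi 0 = binomial_mean n u (fun j => 1 * h u + (-1) * phi j) 0.
  by rewrite (binomial_mean_linear n u (fun=> h u) phi) binomial_mean_cst; ring.
rewrite dE ler_norml; apply/andP; split.
  rewrite -[leLHS]mulN1r; apply: (@le_trans _ _ (-1 * binomial_mean n u psi 0)).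
    by rewrite !mulN1r lerN2.
  have -> : -1 * binomial_mean n u psi 0 = binomial_mean n u (fun j => -1 * psi j + 0 * psi j) 0.
    by rewrite (binomial_mean_linear n u psi psi) mul0r addr0.
  apply: binomial_mean_le => // j jn; rewrite mul0r addr0 !mulN1r mul1r.
  by have := bnd j jn; rewrite ler_norml => /andP[].
apply: le_trans psiE; apply: binomial_mean_le => // j jn.
by have := bnd j jn; rewrite mul1r mulN1r ler_norml => /andP[].
Qed.

End weierstrass.

(** * From Laplace transforms to convergence in distribution *)

Section laplace_criterion.
Context {R : realType} {d : measure_display} {Omega : measurableType d}.
Variable P : probability Omega R.

Lemma measurable_expRN (X : Omega -> R) (l : R) : measurable_fun setT X ->
  measurable_fun setT (fun w => expR (- (l * X w))).
Proof.
move=> mX; apply: measurableT_comp => //; apply: measurableT_comp => //.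
exact: measurable_funM.
Qed.

Lemma expectation_poly_expN (p : {poly R}) (c : R) (X : Omega -> R) :
  0 <= c -> measurable_fun setT X -> (forall w, 0 <= X w) ->
  \int[P]_w p.[expR (- (c * X w))] =
  \sum_(i < size p) p`_i * \int[P]_w expR (- ((i%:R * c) * X w)).
Proof.
move=> c0 mX X0.
have iX (i : nat) : P.-integrable setT (fun w => (expR (- ((i%:R * c) * X w)))%:E).
  apply: (@bounded_integrable _ _ _ _ _ 1); first exact: measurable_expRN.
  move=> w; rewrite ger0_norm ?expR_ge0// -[leRHS]expR0 ler_expR oppr_le0.
  by rewrite mulr_ge0// mulr_ge0 ?ler0n.
transitivity (\int[P]_w (\sum_(i < size p) p`_i * expR (- ((i%:R * c) * X w)))).
  apply: eq_Rintegral => w _; rewrite horner_coef; apply: eq_bigr => i _.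
  by congr (_ * _); rewrite -expRM_natl; congr expR; ring.
rewrite expectation_sum_fun; last by move=> i; exact: (integrableZl measurableT _ (iX i)).
by apply: eq_bigr => i _; rewrite (RintegralZl _ measurableT (iX i)).
Qed.

(** Damping $g$ by $e^{-cx}$ costs at most $M(1-e^{-cx})$, and the damped function is close to a
    polynomial in $e^{-cx}$, whose expectation is a combination of Laplace transforms. *)
Lemma damped_expectation_le (g : R -> R) (p : {poly R}) (M c e : R) (X : Omega -> R) :
  0 <= c -> measurable_fun setT X -> (forall w, 0 <= X w) ->
  measurable_fun setT g -> (forall x, `|g x| <= M) ->
  (forall x, 0 <= x -> `|g x * expR (- (c * x)) - p.[expR (- (c * x))]| <= e) ->
  `|\int[P]_w g (X w) - \int[P]_w p.[expR (- (c * X w))]| <=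
  M * (1 - \int[P]_w expR (- (c * X w))) + e.
Proof.
move=> c0 mX X0 mg gM gp.
have M0 : 0 <= M by rewrite (le_trans _ (gM 0)).
have me := measurable_expRN c mX.
have e01 w : 0 <= expR (- (c * X w)) <= 1.
  by rewrite expR_ge0 -[leRHS]expR0 ler_expR oppr_le0 mulr_ge0.
have mp : measurable_fun setT (fun w => p.[expR (- (c * X w))]).
  apply: (measurableT_comp _ me).
  by apply: continuous_measurable_fun; exact: continuous_horner.
have mgX : measurable_fun setT (fun w => g (X w)) by exact: measurableT_comp.
have ig : P.-integrable setT (fun w => (g (X w))%:E).
  exact: (@bounded_integrable _ _ _ _ _ M).
have ie : P.-integrable setT (fun w => (expR (- (c * X w)))%:E).
  apply: (@bounded_integrable _ _ _ _ _ 1) => // w.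
  by have /andP[? ?] := e01 w; rewrite ger0_norm.
have ip : P.-integrable setT (fun w => (p.[expR (- (c * X w))])%:E).
  apply: (@bounded_integrable _ _ _ _ _ (M + e)) => // w.
  have /andP[h0 h1] := e01 w.
  have -> : p.[expR (- (c * X w))] = g (X w) * expR (- (c * X w)) -
    (g (X w) * expR (- (c * X w)) - p.[expR (- (c * X w))]) by ring.
  rewrite (le_trans (ler_normB _ _))// lerD ?gp// normrM (le_trans _ (gM (X w)))//.
  by rewrite ler_piMr// ger0_norm.
have i1 : P.-integrable setT (fun=> (1 : R)%:E) by exact: has_moments_integrable (has_moments_cst P 1).
have ie' : P.-integrable setT (fun=> e%:E) by exact: has_moments_integrable (has_moments_cst P e).
have i1e := integrableB measurableT i1 ie.
have idf := integrableB measurableT ig ip.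
rewrite -RintegralB// (le_trans (le_normr_Rintegral measurableT idf))//.
apply: (@le_trans _ _ (\int[P]_w (M * (1 - expR (- (c * X w))) + e))).
  apply: le_Rintegral => //; first exact: integrable_abse idf.
    exact: (integrableD measurableT (integrableZl measurableT M i1e) ie').
  move=> w _; have /andP[h0 h1] := e01 w.
  have -> : g (X w) - p.[expR (- (c * X w))] = g (X w) * (1 - expR (- (c * X w))) +
    (g (X w) * expR (- (c * X w)) - p.[expR (- (c * X w))]) by ring.
  rewrite (le_trans (ler_normD _ _))// lerD ?gp// normrM [X in _ * X]ger0_norm ?subr_ge0//.
  by rewrite ler_wpM2r ?subr_ge0.
rewrite RintegralD//; last exact: (integrableZl measurableT M i1e).
by rewrite RintegralZl// RintegralB// !expectation_cst.
Qed.

End laplace_criterion.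

Section laplace_convergence.
Context {R : realType} {d : measure_display} {Omega : measurableType d}.
Variable P : probability Omega R.
Variables (mu : probability (measurableTypeR R) R).
Variable Y : nat -> Omega -> R.
Hypothesis mY : forall n, measurable_fun setT (Y n).
Hypothesis Y0 : forall n w, 0 <= Y n w.
Hypothesis mu0 : {ae mu, forall x : R, 0 <= x}.
Hypothesis lapY : forall l : R, 0 <= l ->
  (fun n => \int[P]_w expR (- (l * Y n w))) @ \oo --> \int[mu]_x expR (- (l * x)).

(** Nonnegativity holds only almost surely under [mu]; the clamp makes it hold everywhere. *)
Let pos (x : R) : R := Num.max 0 x.
Let pos0 x : 0 <= pos x. Proof. by rewrite /pos le_max lexx. Qed.
Let mpos : measurable_fun setT pos. Proof. exact: measurable_maxr. Qed.

Let damped_cvg (c : R) (p : {poly R}) : 0 < c ->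
  (fun n => \int[P]_w p.[expR (- (c * Y n w))]) @ \oo --> \int[mu]_x p.[expR (- (c * pos x))].
Proof.
move=> c0.
under eq_fun do rewrite (expectation_poly_expN _ _ (ltW c0))//.
rewrite (expectation_poly_expN _ _ (ltW c0))//.
apply: cvg_sum_fun => i; apply: cvgMr.
have ic : 0 <= i%:R * c by rewrite mulr_ge0 ?ler0n// ltW.
have := lapY ic; rewrite (_ : \int[mu]_x expR (- (i%:R * c * x)) = \int[mu]_x expR (- (i%:R * c * pos x)))//.
congr fine; apply: ae_eq_integral => //.
- by apply/measurable_EFinP; exact: measurable_expRN.
- by apply/measurable_EFinP; exact: measurable_expRN.
- case: mu0 => N [mN N0 sub]; exists N; split => // x /= h.
  by apply: sub => /= x0; apply: h => _; rewrite /pos max_r.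
Qed.

Lemma laplace_cvg_in_distribution : cvg_in_distribution P Y mu.
Proof.
split=> // g cg [M hM].
have M0 : 0 <= M by rewrite (le_trans _ (hM 0)).
have mg : measurable_fun setT g by exact: continuous_measurable_fun.
have bY n : P.-integrable setT (fun w => (g (Y n w))%:E).
  by apply: (@bounded_integrable _ _ _ _ _ M) => //; exact: measurableT_comp.
have bmu : mu.-integrable setT (fun x => (g x)%:E).
  exact: (@bounded_integrable _ _ _ _ _ M).
suff h : (fun n => \int[P]_w g (Y n w)) @ \oo --> \int[mu]_x g x.
  have -> : (\int[mu]_x (g x)%:E)%E = (\int[mu]_x g x)%:E.
    by rewrite /Rintegral fineK// integrable_fin_num.
  have -> : (fun n => ('E_P[g \o Y n])%E) = (fun n => (\int[P]_w g (Y n w))%:E).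
    by apply/funext => n; rewrite unlock /Rintegral fineK// integrable_fin_num.
  by apply: cvg_EFin => //; exact: nearW.
have expc (c x : R) : 0 < c -> 0 <= x -> 0 < expR (- (c * x)) <= 1.
  by move=> c0 x0; rewrite expR_gt0 -[leRHS]expR0 ler_expR oppr_le0 mulr_ge0// ltW.
apply/cvgrPdist_le => e e0.
pose e8 := e / 8.
have e80 : 0 < e8 by rewrite divr_gt0.
(* A small [c] makes the damping cost at most $e/8$ under [mu]; convergence of the Laplace transform
   at [c] carries this over to [Y n]. *)
have [c c0 hc] : exists2 c : R, 0 < c & M * (1 - \int[mu]_x expR (- (c * pos x))) <= e8.
  have : (fun n : nat => \int[mu]_x expR (- (n.+1%:R^-1 * pos x))) @ \oo --> \int[mu]_x (1 : R).
    apply: (@bounded_convergence _ _ _ _ _ _ 1) => //.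
    - by move=> n; exact: measurable_expRN.
    - move=> x; have h : (fun n : nat => - (n.+1%:R^-1 * pos x)) @ \oo --> - (0 * pos x).
        by apply: cvgN; apply: cvgMl; exact: cvg_harmonic.
      rewrite mul0r oppr0 in h.
      have := cvg_comp _ _ h (@continuous_expR R 0).
      by rewrite expR0.
    - move=> n w; rewrite ger0_norm ?expR_ge0// -[leRHS]expR0 ler_expR oppr_le0.
      by rewrite mulr_ge0// invr_ge0.
  rewrite expectation_cst => /cvgrPdist_le /(_ (e8 / (M + 1))).
  have M1 : 0 < M + 1 by rewrite ltr_wpDl.
  rewrite divr_gt0// => /(_ isT)[N _ /(_ N (leqnn N))] /= h.
  exists N.+1%:R^-1; first by rewrite invr_gt0.
  move: h; rewrite ler_pdivlMr// => /(le_trans _); apply.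
  rewrite (le_trans (ler_wpM2l M0 (ler_norm _)))// [leRHS]mulrC.
  by rewrite ler_wpM2r// lerDl.
(* The damped function in the variable $u=e^{-cx}$. As $|G(u)|\le M|u|$, its extension by $0$ to
   $u\le0$ is continuous, so it can be approximated on all of $[0,1]$. *)
pose G (u : R) : R := if 0 < u then g (- (c^-1 * ln u)) * u else 0.
have GE (x : R) : G (expR (- (c * x))) = g x * expR (- (c * x)).
  by rewrite /G expR_gt0 expRK mulrN opprK mulKf// gt_eqF.
have Gle u : `|G u| <= M * `|u|.
  by rewrite /G; case: ifP => _; rewrite ?normr0 ?mulr_ge0// normrM ler_wpM2r.
have cG : continuous G.
  move=> u; have [u0|u0] := ltP 0 u.
    have nu : \near u, g (- (c^-1 * ln u)) * u = G u.
      by near=> v; rewrite /G ifT//; near: v; exact: lt_nbhsr.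
    have Gu : G u = g (- (c^-1 * ln u)) * u by rewrite /G u0.
    rewrite /continuous_at Gu; apply: cvg_trans; first by apply: near_eq_cvg nu.
    apply: cvgM; last exact: cvg_id.
    apply: continuous_cvg; first exact: cg.
    apply: cvgN; apply: cvgMr.
    exact: continuous_ln.
  have Gu : G u = 0 by rewrite /G ltNge u0.
  rewrite /continuous_at Gu; apply/cvgr0Pnorm_le => r r0.
  have M1 : 0 < M + 1 by rewrite ltr_wpDl.
  have r1 : 0 < r / (M + 1) by rewrite divr_gt0.
  have : \near u, `|u - u| <= r / (M + 1) by near=> v; rewrite subrr normr0 ltW.
  move=> _; near=> v.
  have [v0|v0] := ltP 0 v; last by rewrite /G ltNge v0/= normr0 ltW.
  have vr : `|u - v| <= r / (M + 1) by near: v; apply: cvgr_dist_le r1; exact: cvg_id.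
  rewrite (le_trans (Gle v))// (@le_trans _ _ ((M + 1) * (r / (M + 1))))//.
    rewrite ler_pM// ?lerDl// (le_trans _ vr)// gtr0_norm// distrC.
    by rewrite ger0_norm ?subr_ge0 ?(le_trans u0 (ltW v0))// lerDl oppr_ge0.
  by rewrite mulrC divfK// gt_eqF.
have [p hp] := weierstrass cG e80.
have gp (x : R) : 0 <= x -> `|g x * expR (- (c * x)) - p.[expR (- (c * x))]| <= e8.
  by move=> x0; rewrite -GE hp//; have /andP[/ltW -> ->] := expc c x c0 x0.
have gmu : \int[mu]_x g x = \int[mu]_x g (pos x).
  congr fine; apply: ae_eq_integral => //.
  - exact/measurable_EFinP.
  - by apply/measurable_EFinP; exact: measurableT_comp.
  - case: mu0 => N [mN N0 sub]; exists N; split => // x /= h.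
    by apply: sub => /= x0; apply: h => _; rewrite /pos max_r.
have lapmu : \int[mu]_x expR (- (c * x)) = \int[mu]_x expR (- (c * pos x)).
  congr fine; apply: ae_eq_integral => //.
  - by apply/measurable_EFinP; exact: measurable_expRN.
  - by apply/measurable_EFinP; exact: measurable_expRN.
  - case: mu0 => N [mN N0 sub]; exists N; split => // x /= h.
    by apply: sub => /= x0; apply: h => _; rewrite /pos max_r.
have := lapY (ltW c0); rewrite lapmu => /cvgrPdist_le /(_ (e8 / (M + 1))).
have M1 : 0 < M + 1 by rewrite ltr_wpDl.
rewrite divr_gt0// => /(_ isT) hlap.
have /cvgrPdist_le /(_ e8 e80) hpol := @damped_cvg c p c0.
near=> n.
have h1 : `|\int[mu]_x expR (- (c * pos x)) - \int[P]_w expR (- (c * Y n w))| <= e8 / (M + 1).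
  by near: n.
have h2 : `|\int[mu]_x p.[expR (- (c * pos x))] - \int[P]_w p.[expR (- (c * Y n w))]| <= e8.
  by near: n.
have h3 := @damped_expectation_le _ _ _ P g p M c e8 (Y n) (ltW c0) (mY n) (Y0 n) mg hM gp.
have h4 := @damped_expectation_le _ _ _ mu g p M c e8 pos (ltW c0) mpos pos0 mg hM gp.
rewrite gmu.
have h5 : M * (\int[mu]_x expR (- (c * pos x)) - \int[P]_w expR (- (c * Y n w))) <= e8.
  rewrite (@le_trans _ _ ((M + 1) * (e8 / (M + 1))))//; last by rewrite mulrC divfK// gt_eqF.
  rewrite (@le_trans _ _ (M * (e8 / (M + 1))))//.
    by rewrite ler_wpM2l// (le_trans (ler_norm _)).
  by rewrite ler_wpM2r ?lerDl// divr_ge0 ?ltW.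
(* Six portions $e/8$ are spent: one on damping under [mu], two on damping [Y n], two on the
   polynomial approximation and one on the convergence of its expectations. *)
move: h2 h3 h4 h5 hc; rewrite /e8.
set a := \int[mu]_x g _; set b := \int[P]_w g _; set a' := \int[mu]_x p.[_]; set b' := \int[P]_w p.[_].
set la := \int[mu]_x expR _; set lb := \int[P]_w expR _.
rewrite !ler_norml => /andP[p1 p2] /andP[p3 p4] /andP[p5 p6] p7 p8.
by rewrite !mulrBr !mulr1 in p3 p4 p5 p6 p7 p8 *; apply/andP; split; lra.
Unshelve. all: by end_near. Qed.

End laplace_convergence.

(** * The chi-squared law and its Laplace transform *)

Section chi2.
Context {R : realType}.

Lemma chi2_ge0 (m : nat) : {ae chi2 R m, forall x : R, 0 <= x}.
Proof.
have mneg : measurable [set x : measurableTypeR R | (x : R) < 0].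
  rewrite (_ : [set x | _] = [set` `]-oo, 0[%R]); first exact: measurable_itv.
  by apply/seteqP; split => x /=; rewrite in_itv.
exists [set x : measurableTypeR R | (x : R) < 0]; split => //; last first.
  by move=> x /= /negP; rewrite -ltNge.
elim: m => [|m IH] /=.
  by rewrite diracE memNset//= ltxx.
rewrite /distribution /pushforward.
pose N := [set x : measurableTypeR R | (x : R) < 0].
apply/eqP; rewrite eq_le measure_ge0 andbT.
have -> : 0%E = (chi2 R m \x normal_prob 0 1)%E (N `*` setT).
  rewrite product_measure1E//.
  by rewrite [X in (X * _)%E]IH mul0e.
apply: le_measure; rewrite ?inE.
- rewrite -[X in measurable X]setTI.
  exact: (@measurable_add_sqr R measurableT _ mneg).
- exact: measurableX.
- move=> [x y] /=; rewrite /add_sqr/= => xy; split => //=.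
  by apply: le_lt_trans xy; rewrite lerDl sqr_ge0.
Qed.

(** Adding the square of an independent standard normal variable multiplies the transform by
    $(1+2l)^{-1/2}$. *)
Lemma laplace_chi2 (m : nat) (l : R) : 0 <= l ->
  (\int[chi2 R m]_x (expR (- (l * x)))%:E = ((Num.sqrt (1 + 2 * l))^-1 ^+ m)%:E)%E.
Proof.
move=> l0; have ml : measurable_fun setT (fun x : measurableTypeR R => (expR (- (l * x)))%:E).
  by apply/measurable_EFinP; apply: measurable_expRN.
elim: m => [|m IH] /=.
  by rewrite integral_dirac//= diracT mul1e mulr0 oppr0 expR0 expr0.
rewrite ge0_integral_distribution//.
have mF : measurable_fun setT
    ((fun y : measurableTypeR R => (expR (- (l * y)))%:E) \o @add_sqr R).
  by apply: (measurableT_comp ml); exact: measurable_add_sqr.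
rewrite fubini_tonelli1//.
have inner (x : R) : (\int[normal_prob 0 1]_y (expR (- (l * add_sqr (x, y))))%:E =
    (expR (- (l * x)))%:E * (Num.sqrt (1 + 2 * l))^-1%:E)%E.
  rewrite ge0_integral_normal_prob.
  - under eq_integral => y _.
      have -> : ((expR (- (l * add_sqr (x, y))))%:E * (normal_pdf 0 1 y)%:E =
        (expR (- (l * x)))%:E * (expR (- (l * y ^+ 2)) * normal_pdf 0 1 y)%:E)%E.
        by rewrite -!EFinM /add_sqr/= mulrDr opprD expRD; congr EFin; ring.
      over.
    rewrite ge0_integralZl//.
    + by rewrite laplace_normal_sqr ?oner_neq0// expr1n mulr1.
    + apply/measurable_EFinP; apply: measurable_funM; last exact: measurable_normal_pdf.
      by apply: measurable_expRN; exact: measurable_funX.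
    + by move=> y _; rewrite lee_fin mulr_ge0 ?expR_ge0 ?normal_pdf_ge0.
  - have h : measurable_fun setT (fun y : R => x + y ^+ 2).
      by apply: measurable_funD => //; exact: measurable_funX.
    by apply/measurable_EFinP; exact: (measurable_expRN l h).
  - by move=> y; rewrite lee_fin expR_ge0.
rewrite /fubini_F/=.
under eq_integral do rewrite inner.
rewrite ge0_integralZr//; first by rewrite IH -EFinM exprSr.
all: try by move=> *; rewrite lee_fin ?expR_ge0 ?invr_ge0 ?sqrtr_ge0.
Qed.

End chi2.

(** * Positive definite matrices and half-vectorization *)

Section positive_definite.
Context {R : rcfType}.

Definition posdef (n : nat) (A : 'M[R]_n) := A^T = A /\
  forall x : 'cV[R]_n, x != 0 -> 0 < (x^T *m A *m x) ord0 ord0.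

Lemma mulmx_sqrE (n : nat) (x : 'cV[R]_n) :
  (x^T *m x) ord0 ord0 = \sum_i x i ord0 ^+ 2.
Proof. by rewrite mxE; apply: eq_bigr => i _; rewrite mxE expr2. Qed.

Lemma mulmx_sqr_ge0 (n : nat) (x : 'cV[R]_n) : 0 <= (x^T *m x) ord0 ord0.
Proof. by rewrite mulmx_sqrE sumr_ge0// => i _; rewrite sqr_ge0. Qed.

Lemma mulmx_sqr_eq0 (n : nat) (x : 'cV[R]_n) : (x^T *m x) ord0 ord0 = 0 -> x = 0.
Proof.
rewrite mulmx_sqrE => /eqP; rewrite psumr_eq0; last by move=> i _; rewrite sqr_ge0.
move=> /allP h; apply/colP => i; rewrite mxE; apply/eqP.
by have := h i; rewrite mem_index_enum sqrf_eq0 => /(_ isT).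
Qed.

Lemma posdef_congr (m n : nat) (A : 'M[R]_n) (E : 'M[R]_(m, n)) :
  posdef A -> row_free E -> posdef (E *m A *m E^T).
Proof.
move=> [sA pA] fE; split; first by rewrite !trmx_mul trmxK sA mulmxA.
move=> x x0; have -> : x^T *m (E *m A *m E^T) *m x = (E^T *m x)^T *m A *m (E^T *m x).
  by rewrite trmx_mul trmxK !mulmxA.
apply: pA; apply: contra x0 => /eqP Ex.
have /(congr1 trmx) : (E^T *m x)^T = 0 by rewrite Ex trmx0.
rewrite trmxK => Ex'; apply/eqP/trmx_inj; apply: (row_free_inj fE).
by rewrite trmx0 mul0mx -[RHS]trmx0 -Ex trmx_mul trmxK.
Qed.

Lemma posdef_unitmx (n : nat) (A : 'M[R]_n) : posdef A -> A \in unitmx.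
Proof.
move=> [sA pA]; rewrite -row_free_unit -kermx_eq0; apply/eqP/row_matrixP => i.
rewrite row0; apply/eqP/negPn/negP => k0.
have := pA (row i (kermx A))^T; rewrite trmx_eq0 => /(_ k0).
by rewrite trmxK -row_mul mulmx_ker row0 mul0mx mxE ltxx.
Qed.

Lemma posdef_inv (n : nat) (A : 'M[R]_n) : posdef A -> posdef (invmx A).
Proof.
move=> pA; have uA := posdef_unitmx pA; have [sA _] := pA.
have sV : (invmx A)^T = invmx A by rewrite trmx_inv sA.
have := posdef_congr pA (E := invmx A); rewrite sV mulVmx// mul1mx; apply.
by rewrite row_free_unit unitmx_inv.
Qed.

(* Cholesky elimination: the Schur complement of the pivot is again positive
   definite. *)
Lemma posdef_orthonormalize (n : nat) (A : 'M[R]_n) : posdef A ->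
  exists C : 'M[R]_n, C *m A *m C^T = 1%:M.
Proof.
elim: n A => [|n IH] A pA; first by exists 0; apply/matrixP => -[].
have [sA hA] := pA.
pose a := A ord0 ord0.
have a0 : 0 < a.
  have := hA (delta_mx ord0 ord0); rewrite trmx_delta -rowE -colE !mxE; apply.
  by apply/eqP => /matrixP/(_ ord0 ord0); rewrite !mxE !eqxx => /eqP; rewrite oner_eq0.
pose A' : 'M[R]_(1 + n) := A.
pose b : 'cV[R]_n := dlsubmx A'.
have A'E : A' = block_mx a%:M b^T b (drsubmx A').
  rewrite -[LHS]submxK; congr block_mx.
    by apply/matrixP => i j; rewrite !ord1 !mxE eqxx mulr1n; congr (A _ _); exact: val_inj.
  by rewrite /b trmx_dlsub (sA : A'^T = A').
(* These rows eliminate the pivot: the first column of [E0 *m A'] vanishes, and [E0 *m A' *m E0^T]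
   is the Schur complement. *)
pose E0 : 'M[R]_(n, 1 + n) := row_mx (- a^-1 *: b) 1%:M.
have fE0 : row_free E0.
  apply/row_freeP; exists (col_mx 0 1%:M).
  by rewrite mul_row_col mulmx0 add0r mulmx1.
pose S := E0 *m A' *m E0^T.
have pS : posdef S by exact: (@posdef_congr _ _ A' E0).
have [C' hC'] := IH S pS.
pose e0 : 'rV[R]_(1 + n) := row_mx (Num.sqrt a)^-1%:M 0.
exists (col_mx e0 (C' *m E0)).
have E0A : E0 *m A' = row_mx 0 (E0 *m A' *m (col_mx 0 1%:M)).
  rewrite A'E /E0 mul_row_block !mul_row_col !mulmx0 !add0r !mul1mx mulmx1.
  congr row_mx; rewrite -scalemxAl mul_mx_scalar scalerA mulNr mulVf ?gt_eqF//.
  by rewrite scaleN1r addNr.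
have E0e : E0 *m A' *m e0^T = 0.
  by rewrite E0A tr_row_mx mul_row_col mul0mx trmx0 mulmx0 addr0.
have eE0 : e0 *m A' *m E0^T = 0.
  apply: trmx_inj; rewrite !trmx_mul trmxK trmx0 mulmxA.
  by rewrite (sA : A'^T = A').
have ee : e0 *m A' *m e0^T = 1%:M.
  rewrite A'E /e0 mul_row_block tr_row_mx mul_row_col !mul0mx !addr0 trmx0 mulmx0 addr0.
  rewrite tr_scalar_mx -!scalar_mxM; congr (_%:M).
  have q0 : 0 < Num.sqrt a by rewrite sqrtr_gt0.
  by rewrite -{2}(sqr_sqrtr (ltW a0)); field; rewrite gt_eqF.
suff : col_mx e0 (C' *m E0) *m A' *m (col_mx e0 (C' *m E0))^T = 1%:M by [].
have hS : C' *m (E0 *m A' *m E0^T) *m C'^T = 1%:M by exact: hC'.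
move: E0e eE0 ee hS; clear; move: e0 E0 => e0 E0 E0e eE0 ee hS.
rewrite mul_col_mx tr_col_mx mul_col_mx !mul_mx_row trmx_mul.
rewrite ee [e0 *m A' *m (_ *m _)]mulmxA eE0 mul0mx.
rewrite -!(mulmxA C') E0e mulmx0 [E0 *m A' *m _]mulmxA mulmxA hS.
exact/esym/scalar_mx_block.
Qed.

(** The rows of [M] are a $W$-orthonormal basis of the left kernel of [D]. Now [M] annihilates the
    columns of $1-WM^\top M$, and by a dimension count the kernel of [M] is the column space of [D];
    [B] gives the generalized least squares coefficients. *)
Lemma posdef_complement (N q : nat) (W : 'M[R]_N) (D : 'M[R]_(N, q)) :
  posdef W -> \rank D = q ->
  exists (M : 'M[R]_(N - q, N)) (B : 'M[R]_(q, N)),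
    [/\ M *m D = 0, M *m W *m M^T = 1%:M & 1%:M - W *m M^T *m M = D *m B].
Proof.
move=> pW rD; have [sW _] := pW.
have qN : (q <= N)%N by rewrite -rD rank_leq_row.
have rK : \rank (kermx D) = (N - q)%N by rewrite mxrank_ker rD.
have [K [KD fK]] : exists K : 'M[R]_(N - q, N), K *m D = 0 /\ row_free K.
  rewrite -rK; exists (row_base (kermx D)); split; last exact: row_base_free.
  by apply/sub_kermxP; rewrite eq_row_base.
have [C hC] := posdef_orthonormalize (posdef_congr pW fK).
pose M := C *m K.
have MD : M *m D = 0 by rewrite /M -mulmxA KD mulmx0.
have MW : M *m W *m M^T = 1%:M by rewrite -hC /M trmx_mul !mulmxA.
have fM : row_free M.
  by apply/row_freeP; exists (W *m M^T); rewrite mulmxA.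
move: {K KD fK C hC} M MD MW fM => M MD MW fM.
have DM : (D^T :=: kermx M^T)%MS.
  apply/eqmxP; have sub : (D^T <= kermx M^T)%MS.
    by apply/sub_kermxP; rewrite -trmx_mul MD trmx0.
  rewrite -(geq_leqif (mxrank_leqif_eq sub)) mxrank_ker !mxrank_tr rD.
  by move: fM; rewrite /row_free => /eqP ->; rewrite subKn.
have : ((1%:M - W *m M^T *m M)^T <= D^T)%MS.
  rewrite DM; apply/sub_kermxP.
  rewrite linearB/= trmx1 !trmx_mul trmxK sW mulmxBl mul1mx -!mulmxA.
  by rewrite [M *m (W *m _)]mulmxA MW mulmx1 subrr.
move=> /submxP[B hB]; exists M, B^T; split=> //.
by apply: trmx_inj; rewrite hB trmx_mul trmxK.
Qed.

(** Pythagoras for the inner product $W^{-1}$: $WM^\top My$ is an orthogonal projection of $y$ and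
    has squared length $|My|^2$. *)
Lemma posdef_complement_form (N m : nat) (W : 'M[R]_N) (M : 'M[R]_(m, N)) (y : 'cV[R]_N) :
  posdef W -> M *m W *m M^T = 1%:M ->
  (y^T *m invmx W *m y) ord0 ord0 = ((M *m y)^T *m (M *m y)) ord0 ord0 +
  ((y - W *m M^T *m M *m y)^T *m invmx W *m (y - W *m M^T *m M *m y)) ord0 ord0.
Proof.
move=> pW MW; have uW := posdef_unitmx pW; have [sW _] := pW.
pose z := W *m M^T *m M *m y.
have Vz : invmx W *m z = M^T *m (M *m y) by rewrite /z !mulmxA mulVmx// mul1mx.
have zV : z^T *m invmx W = (M *m y)^T *m M.
  by apply: trmx_inj; rewrite trmx_mul trmxK trmx_inv sW Vz trmx_mul trmxK.
have e1 : y^T *m invmx W *m z = (M *m y)^T *m (M *m y).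
  by rewrite -mulmxA Vz trmx_mul !mulmxA.
have e2 : z^T *m invmx W *m y = (M *m y)^T *m (M *m y) by rewrite zV -mulmxA.
have e3 : z^T *m invmx W *m z = (M *m y)^T *m (M *m y).
  rewrite zV -mulmxA; congr (_ *m _).
  by rewrite /z !mulmxA MW mul1mx.
rewrite -/z; have -> : (y - z)^T *m invmx W *m (y - z) =
    y^T *m invmx W *m y - (M *m y)^T *m (M *m y).
  have -> : (y - z)^T = y^T - z^T by apply/matrixP => i j; rewrite !mxE.
  by rewrite mulmxBr !mulmxBl e1 e2 e3 subrr subr0.
have mB (A B : 'M[R]_1) : (A - B) ord0 ord0 = A ord0 ord0 - B ord0 ord0 by rewrite !mxE.
by rewrite mB addrCA subrr addr0.
Qed.

End positive_definite.

(** * The duplication matrix and the duality between half-vectors and symmetric matrices *)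

Section duplication.
Context {R : rcfType}.

Lemma dup_mx_sym (p : nat) (m : 'I_(pbar p)) (i j : 'I_p) :
  dup_mx R p (mxtens_index (j, i)) m = dup_mx R p (mxtens_index (i, j)) m.
Proof. by rewrite !mxE !mxtens_indexK /= orbC. Qed.

(** If the [m]-th entry sits at $(i,j)$, then row [mxtens_index (j, i)] of [dup_mx] has its only
    nonzero entry in column [m]. *)
Lemma dup_mx_inj (p : nat) (v : 'cV[R]_(pbar p)) : dup_mx R p *m v = 0 -> v = 0.
Proof.
move=> Dv; apply/colP => m.
case E : (vech_pos m) => [i j].
have := congr1 (fun A : 'cV[R]_(p * p) => A (mxtens_index (j, i)) ord0) Dv.
rewrite !mxE (bigD1 m)//= big1 ?addr0; last first.
  move=> m' m'm; rewrite mxE mxtens_indexK/=.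
  case: eqP => [E'|_]; first by case/eqP: m'm; apply: vech_pos_inj; rewrite E E'.
  case: eqP => [E'|_]; last by rewrite mul0r.
  have := vech_pos_le m; have := vech_pos_le m'; rewrite E E' /= => ij ji.
  have e : i = j by apply: val_inj; apply/eqP; rewrite eqn_leq ij ji.
  by case/eqP: m'm; apply: vech_pos_inj; rewrite E E' e.
by rewrite mxE mxtens_indexK/= E eqxx mul1r.
Qed.

Lemma dup_gram_unitmx (p : nat) : (dup_mx R p)^T *m dup_mx R p \in unitmx.
Proof.
apply: posdef_unitmx; split; first by rewrite trmx_mul trmxK.
move=> x x0; have -> : x^T *m ((dup_mx R p)^T *m dup_mx R p) *m x =
    (dup_mx R p *m x)^T *m (dup_mx R p *m x) by rewrite trmx_mul !mulmxA.
rewrite lt_neqAle mulmx_sqr_ge0 andbT eq_sym; apply: contra x0 => /eqP h.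
exact/eqP/dup_mx_inj/mulmx_sqr_eq0.
Qed.

Lemma dup_pinvK (p : nat) : dup_pinv R p *m dup_mx R p = 1%:M.
Proof. by rewrite /dup_pinv -mulmxA mulVmx// dup_gram_unitmx. Qed.

Lemma vech_dup_pinv (p : nat) (A : 'M[R]_p) : A^T = A -> vech A = dup_pinv R p *m vec A.
Proof. by move=> sA; rewrite (dup_mxP sA) mulmxA dup_pinvK mul1mx. Qed.

(* The symmetric matrix whose trace product with [A] is [c^T vech A]. *)
Definition vech_dual (p : nat) (c : 'cV[R]_(pbar p)) : 'M[R]_p :=
  unvec ((dup_pinv R p)^T *m c).

Lemma vec_vech_dual (p : nat) (c : 'cV[R]_(pbar p)) :
  vec (vech_dual c) = (dup_pinv R p)^T *m c.
Proof.
apply/colP => l; rewrite [LHS]mxE /vech_dual [LHS]mxE.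
by rewrite -surjective_pairing mxtens_unindexK.
Qed.

(** The transposed pseudoinverse is [dup_mx] times a matrix, and [dup_mx] has equal rows at $(i,j)$
    and $(j,i)$. *)
Lemma vech_dual_sym (p : nat) (c : 'cV[R]_(pbar p)) : (vech_dual c)^T = vech_dual c.
Proof.
rewrite /vech_dual /dup_pinv trmx_mul trmxK -mulmxA.
apply/matrixP => i j; rewrite 3!mxE [RHS]mxE [RHS]mxE; apply: eq_bigr => m _.
by rewrite dup_mx_sym.
Qed.

Lemma vech_dual_eq0 (p : nat) (c : 'cV[R]_(pbar p)) : vech_dual c = 0 -> c = 0.
Proof.
move=> c0; have : (dup_mx R p)^T *m vec (vech_dual c) = c.
  by rewrite vec_vech_dual mulmxA -trmx_mul dup_pinvK trmx1 mul1mx.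
by move=> <-; rewrite c0 (_ : vec 0 = 0) ?mulmx0//; apply/colP => l; rewrite !mxE.
Qed.

Lemma sum_mxtens (m n : nat) (F : 'I_(m * n) -> R) :
  \sum_l F l = \sum_(j < m) \sum_(i < n) F (mxtens_index (j, i)).
Proof.
rewrite pair_bigA/= (reindex (@mxtens_index m n))/=; last first.
  by exists (@mxtens_unindex m n) => l _; [exact: mxtens_indexK|exact: mxtens_unindexK].
by apply: eq_bigr => -[].
Qed.

Lemma vech_dualP (p : nat) (c : 'cV[R]_(pbar p)) (A : 'M[R]_p) : A^T = A ->
  (c^T *m vech A) ord0 ord0 = \sum_i \sum_j vech_dual c i j * A i j.
Proof.
move=> sA; rewrite (vech_dup_pinv sA) mulmxA -[c^T *m _]trmxK trmx_mul trmxK.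
rewrite -vec_vech_dual mxE sum_mxtens exchange_big/=.
by apply: eq_bigr => i _; apply: eq_bigr => j _; rewrite !mxE !mxtens_indexK.
Qed.

Lemma tens_vec (p r : nat) (L : 'M[R]_(p, r)) (N : 'M[R]_p) :
  (L^T *t L^T) *m vec N = vec (L^T *m N *m L).
Proof.
apply/colP => l; case: (mxtens_indexP l) => b a.
rewrite mxE sum_mxtens mxE mxtens_indexK/= mxE.
apply: eq_bigr => j _; rewrite mxE mulr_suml; apply: eq_bigr => i _.
by rewrite tensmxE !mxE mxtens_indexK/=; ring.
Qed.

(** With $\Sigma=LL^\top$, half of $W$ becomes the Frobenius inner product of the matrices $L^\top
    CL$, where $C$ is dual to a half-vector. This links $W$ to the variance of quadratic forms in
    the noise. *)
Lemma vech_dual_form (p r : nat) (L : 'M[R]_(p, r)) (x y : 'cV[R]_(pbar p)) :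
  (x^T *m (dup_pinv R p *m ((L *m L^T) *t (L *m L^T)) *m (dup_pinv R p)^T) *m y) ord0 ord0 =
  \sum_(ab : 'I_r * 'I_r)
    (L^T *m vech_dual x *m L) ab.1 ab.2 * (L^T *m vech_dual y *m L) ab.1 ab.2.
Proof.
rewrite -tensmx_mul.
have -> : L *t L = (L^T *t L^T)^T by rewrite trmx_tens !trmxK.
have -> : x^T *m (dup_pinv R p *m ((L^T *t L^T)^T *m (L^T *t L^T)) *m (dup_pinv R p)^T) *m y =
  ((L^T *t L^T) *m ((dup_pinv R p)^T *m x))^T *m ((L^T *t L^T) *m ((dup_pinv R p)^T *m y)).
  by rewrite !trmx_mul !trmxK !mulmxA.
rewrite -!vec_vech_dual !tens_vec mxE sum_mxtens exchange_big/= pair_bigA/=.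
apply: eq_bigr => -[a b] _ /=; rewrite [(vec _)^T _ _]mxE.
by rewrite ![vec _ _ _]mxE !mxtens_indexK.
Qed.

End duplication.

(** * Expansion of a minimum contrast *)

Section matrix_bounds.
Context {R : realType}.

Lemma mx_entry_le (m n : nat) (A : 'M[R]_(m, n)) i j : `|A i j| <= `|A|.
Proof.
rewrite [leRHS]/Num.Def.normr/= mx_normrE.
by apply/bigmax_geP; right; exists (i, j).
Qed.

Lemma mx_norm_le (m n : nat) (A : 'M[R]_(m, n)) (c : R) : 0 <= c ->
  (forall i j, `|A i j| <= c) -> `|A| <= c.
Proof.
move=> c0 h; rewrite [leLHS]/Num.Def.normr/= mx_normrE.
by apply/bigmax_leP; split=> // -[i j] _ /=.
Qed.

(** The entrywise $\ell^1$ norm, which controls products and bilinear forms in terms of the sup norm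
    carried by matrices. *)
Definition mx_sum (m n : nat) (A : 'M[R]_(m, n)) : R := \sum_i \sum_j `|A i j|.

Lemma mx_sum_ge0 (m n : nat) (A : 'M[R]_(m, n)) : 0 <= mx_sum A.
Proof. by apply: sumr_ge0 => i _; apply: sumr_ge0. Qed.

Lemma norm_mulmx_le (m n k : nat) (A : 'M[R]_(m, n)) (B : 'M[R]_(n, k)) :
  `|A *m B| <= mx_sum A * `|B|.
Proof.
apply: mx_norm_le => [|i j]; first by rewrite mulr_ge0// mx_sum_ge0.
rewrite mxE (le_trans (ler_norm_sum _ _ _))// /mx_sum mulr_suml.
rewrite (bigD1 i)//= -[leLHS]addr0 lerD//; last first.
  by apply: sumr_ge0 => l _; rewrite mulr_ge0// sumr_ge0.
rewrite mulr_suml; apply: ler_sum => l _.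
by rewrite normrM ler_wpM2l// mx_entry_le.
Qed.

Lemma norm_form_le (n : nat) (A : 'M[R]_n) (x y : 'cV[R]_n) :
  `|(x^T *m A *m y) ord0 ord0| <= mx_sum A * (`|x| * `|y|).
Proof.
rewrite mxE (le_trans (ler_norm_sum _ _ _))// /mx_sum exchange_big/= mulr_suml.
apply: ler_sum => j _; rewrite normrM mxE mulr_suml.
rewrite (@le_trans _ _ ((\sum_i `|x^T ord0 i * A i j|) * `|y|))//.
  by rewrite ler_pM ?ler_norm_sum ?mx_entry_le.
rewrite mulr_suml ler_sum// => i _; rewrite mxE normrM [`|x i _| * _]mulrC -mulrA.
by rewrite ler_wpM2l// ler_wpM2r// mx_entry_le.
Qed.

Lemma norm_sqr_le (n : nat) (x : 'cV[R]_n) : `|x| ^+ 2 <= (x^T *m x) ord0 ord0.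
Proof.
have s0 := mulmx_sqr_ge0 x; set S := (_ *m _) _ _ in s0 *.
rewrite -[leRHS]sqr_sqrtr// lerXn2r ?nnegrE ?sqrtr_ge0//.
apply: mx_norm_le => [|i j]; first exact: sqrtr_ge0.
rewrite -sqrtr_sqr ler_wsqrtr// /S mulmx_sqrE (bigD1 i)//= ord1 lerDl.
by apply: sumr_ge0 => l _; exact: sqr_ge0.
Qed.

Lemma form_sub_expand (n : nat) (A : 'M[R]_n) (y e : 'cV[R]_n) :
  ((y - e)^T *m A *m (y - e)) ord0 ord0 - (y^T *m A *m y) ord0 ord0 =
  (e^T *m A *m e) ord0 ord0 - (y^T *m A *m e) ord0 ord0 - (e^T *m A *m y) ord0 ord0.
Proof.
have -> : (y - e)^T = y^T - e^T by apply/matrixP => i j; rewrite !mxE.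
have mB (B C : 'M[R]_1) : (B - C) ord0 ord0 = B ord0 ord0 - C ord0 ord0 by rewrite !mxE.
by rewrite mulmxBr !mulmxBl !mB; ring.
Qed.

End matrix_bounds.

Section min_contrast.
Context {R : realType}.
Variables (q N m : nat) (Theta : set 'cV[R]_q) (theta0 : 'cV[R]_q).
Variables (s : 'cV[R]_q -> 'cV[R]_N) (V : 'cV[R]_q -> 'M[R]_N).
Variables (D : 'M[R]_(N, q)) (G : 'M[R]_(q, N)) (M : 'M[R]_(m, N)) (B : 'M[R]_(q, N)).
Hypothesis Theta_compact : compact Theta.
Hypothesis theta0_int : Theta° theta0.
Hypothesis s_continuous : forall theta i, {for theta, continuous (fun t => s t i ord0)}.
Hypothesis V_continuous : forall i j, {for theta0, continuous (fun t => V t i j)}.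
Hypothesis s_derivable : forall e, 0 < e -> \forall u \near (0 : 'cV[R]_q),
  `|s (theta0 + u) - s theta0 - D *m u| <= e * `|u|.
Hypothesis V_coercive : exists2 c, 0 < c & forall theta, Theta theta ->
  forall x : 'cV[R]_N, c * `|x| ^+ 2 <= (x^T *m V theta *m x) ord0 ord0.
Hypothesis ident : forall theta, Theta theta -> s theta = s theta0 -> theta = theta0.
Hypothesis GD : G *m D = 1%:M.
(** Together with [attained]: $|Mx|^2$ is the minimum over [u] of the linearized contrast, reached
    at $u=Bx$. *)
Hypothesis lower : forall (x : 'cV[R]_N) (u : 'cV[R]_q), ((M *m x)^T *m (M *m x)) ord0 ord0 <=
  ((x - D *m u)^T *m V theta0 *m (x - D *m u)) ord0 ord0.
Hypothesis attained : forall x : 'cV[R]_N, ((M *m x)^T *m (M *m x)) ord0 ord0 =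
  ((x - D *m (B *m x))^T *m V theta0 *m (x - D *m (B *m x))) ord0 ord0.

Definition contrast_form (v : 'cV[R]_N) (theta : 'cV[R]_q) : R :=
  ((v - s theta)^T *m V theta *m (v - s theta)) ord0 ord0.

(** Compactness turns identifiability into a modulus: near a point other than [theta0], some
    coordinate of [s] stays away from its value at [theta0]. *)
Lemma contrast_consistent (rho : R) : 0 < rho -> exists2 gam, 0 < gam &
  forall theta, Theta theta -> `|s theta - s theta0| < gam -> `|theta - theta0| < rho.
Proof.
move=> rho0.
have : near_covering Theta by rewrite -compact_near_coveringP.
move=> /(_ R (0^'+) (fun gam t => `|s t - s theta0| < gam -> `|t - theta0| < rho) _).
case.
  move=> t Tt; have [->|tt0] := eqVneq t theta0.
    exists (ball theta0 rho, setT) => /=; first by split; [exact: nbhsx_ballx|exact: filterT].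
    by move=> [t' gam] /= [+ _] _; rewrite -ball_normE /ball_/= distrC.
  have [i si] : exists i, s t i ord0 != s theta0 i ord0.
    apply: contrapT => /forallNP h; case/eqP: tt0; apply: ident => //.
    by apply/colP => i; apply/eqP/negPn/negP; exact: h.
  pose g := `|s t i ord0 - s theta0 i ord0| / 2.
  have g0 : 0 < g by rewrite divr_gt0// normr_gt0 subr_eq0.
  have /cvgrPdist_lt /(_ g g0) hs := @s_continuous t i.
  exists ([set t' | `|s t i ord0 - s t' i ord0| < g], [set gam | gam < g]) => /=.
    by split; [exact: hs|exact: nbhs_right_lt].
  move=> [t' gam] /= [h1 h2] h3; exfalso.
  have := mx_entry_le (s t' - s theta0) i ord0; rewrite !mxE.
  move=> /le_lt_trans /(_ h3) /lt_trans /(_ h2) h4.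
  have : `|s t i ord0 - s theta0 i ord0| < g + g.
    have -> : s t i ord0 - s theta0 i ord0 = (s t i ord0 - s t' i ord0) + (s t' i ord0 - s theta0 i ord0) by ring.
    by rewrite (le_lt_trans (ler_normD _ _))// ltrD.
  by rewrite /g -splitr ltxx.
move=> gam /= gam0 h; exists (gam / 2); first by rewrite divr_gt0.
move=> t Tt st; apply: (h (gam / 2)) => //=.
- by rewrite sub0r normrN gtr0_norm ?divr_gt0// ltr_pdivrMr// ltr_pMr// ltr1n.
- by rewrite divr_gt0.
Qed.

Let Q0 (y : 'cV[R]_N) := (y^T *m V theta0 *m y) ord0 ord0.

Lemma V_near (e : R) : 0 < e -> \forall u \near (0 : 'cV[R]_q),
  forall y : 'cV[R]_N, `|(y^T *m (V (theta0 + u) - V theta0) *m y) ord0 ord0| <= e * `|y| ^+ 2.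
Proof.
move=> e0; pose k : R := (N * N)%:R + 1.
have k0 : 0 < k by rewrite ltr_wpDl.
have ek : 0 < e / k by rewrite divr_gt0.
have hh (ij : 'I_N * 'I_N) : \forall t \near theta0, `|V theta0 ij.1 ij.2 - V t ij.1 ij.2| < e / k.
  by case: ij => i j; have /cvgrPdist_lt /(_ _ ek) := @V_continuous i j.
have h0 := filter_forall (nbhs_filter theta0) hh.
have h1 : \forall u \near (0 : 'cV[R]_q), forall ij : 'I_N * 'I_N,
    `|V theta0 ij.1 ij.2 - V (theta0 + u) ij.1 ij.2| < e / k.
  have sh : (fun u => theta0 + u) @ (0 : 'cV[R]_q) --> theta0.
    have := @cvgD _ _ _ _ (nbhs_filter (0 : 'cV[R]_q)) (fun=> theta0) id _ _ (cvg_cst theta0) cvg_id.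
    by rewrite addr0; apply.
  exact: (sh _ h0).
apply: filterS h1 => u hu y.
rewrite (le_trans (norm_form_le _ _ _))// -expr2 ler_wpM2r ?sqr_ge0//.
rewrite /mx_sum pair_bigA/= (@le_trans _ _ (\sum_(ij : 'I_N * 'I_N) e / k))//.
  by apply: ler_sum => ij _; rewrite !mxE distrC ltW.
rewrite sumr_const card_prod !card_ord -[_ *+ _]mulr_natr mulrAC ler_pdivrMr//.
by rewrite ler_wpM2l ?ltW// /k ltrDl.
Qed.

(** For displacements [u] of order $|x|$, replacing [s] by its linearization and [V] by its value at
    [theta0] costs $o(|x|^2)$. *)
Lemma contrast_local_expansion (K e : R) : 0 <= K -> 0 < e -> exists2 dl, 0 < dl &
  forall (x : 'cV[R]_N) (u : 'cV[R]_q), `|u| <= K * `|x| -> `|x| < dl ->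
    `|contrast_form (s theta0 + x) (theta0 + u) - Q0 (x - D *m u)| <= e * `|x| ^+ 2.
Proof.
move=> K0 e0; pose KV := mx_sum (V theta0); pose KD := mx_sum D.
have KV0 : 0 <= KV by exact: mx_sum_ge0.
have KD0 : 0 <= KD by exact: mx_sum_ge0.
pose L := 1 + KD * K + K.
have L1 : 1 <= L by rewrite /L -addrA lerDl addr_ge0// mulr_ge0.
have L0 : 0 < L by rewrite (lt_le_trans _ L1).
(* Error budget in units of $\eta|x|^2$: three bilinear terms containing the linearization error,
   the variation of [V] on a vector of size $L|x|$, and one unit of slack. *)
pose c := 3 * KV * L * K + L ^+ 2 + 1.
have c0 : 0 < c by rewrite /c ltr_wpDl// addr_ge0 ?sqr_ge0// !mulr_ge0// ltW.
pose eta := Num.min 1 (e / c).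
have eta0 : 0 < eta by rewrite /eta lt_min ltr01 divr_gt0.
have eta1 : eta <= 1 by rewrite /eta ge_min lexx.
have etae : eta * c <= e by rewrite -ler_pdivlMr// /eta ge_min lexx orbT.
have /nbhs_ballP[r1 /= r10 h1] := s_derivable eta0.
have /nbhs_ballP[r2 /= r20 h2] := V_near eta0.
pose r := Num.min r1 r2.
have r0 : 0 < r by rewrite lt_min r10.
exists (r / (K + 1)) => [|x u uK xr]; first by rewrite divr_gt0// ltr_wpDl.
have ur : `|u| < r.
  rewrite (le_lt_trans uK)// (le_lt_trans (_ : _ <= (K + 1) * `|x|))//.
    by rewrite ler_wpM2r// lerDl.
  by rewrite mulrC -ltr_pdivlMr// ltr_wpDl.
have bu rr : r <= rr -> ball (0 : 'cV[R]_q) rr u.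
  by move=> rrr; rewrite -ball_normE /ball_/= sub0r normrN (lt_le_trans ur).
have g1 := h1 u (bu r1 _); rewrite {}ge_min lexx /= in g1; move/(_ isT): g1 => g1.
have g2 := h2 u (bu r2 _); rewrite {}ge_min lexx orbT /= in g2; move/(_ isT): g2 => g2.
move: g1; set err := _ - D *m u => g1.
pose y := x - D *m u.
have x0 : 0 <= `|x| by [].
have errx : `|err| <= eta * (K * `|x|) by rewrite (le_trans g1)// ler_wpM2l// ltW.
have KxL : K * `|x| <= L * `|x|.
  by rewrite ler_wpM2r// /L lerDr addr_ge0// mulr_ge0.
have errL : `|err| <= K * `|x|.
  by rewrite (le_trans errx)// ler_piMl// mulr_ge0.
have yx : `|y| <= (1 + KD * K) * `|x|.
  rewrite (le_trans (ler_normB _ _))// mulrDl mul1r lerD2l -mulrA.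
  by rewrite (le_trans (norm_mulmx_le _ _))// ler_wpM2l.
have yL : `|y| <= L * `|x|.
  by rewrite (le_trans yx)// ler_wpM2r// /L lerDl.
have yeL : `|y - err| <= L * `|x|.
  by rewrite (le_trans (ler_normB _ _))// (le_trans (lerD yx errL))// -mulrDl.
have vE : s theta0 + x - s (theta0 + u) = y - err.
  by rewrite /y /err; apply/colP => i; rewrite !mxE; ring.
rewrite /contrast_form vE -/y.
have -> : ((y - err)^T *m V (theta0 + u) *m (y - err)) ord0 ord0 - Q0 y =
    ((y - err)^T *m (V (theta0 + u) - V theta0) *m (y - err)) ord0 ord0 +
    (((y - err)^T *m V theta0 *m (y - err)) ord0 ord0 - Q0 y).
  have mB (A1 A2 : 'M[R]_1) : (A1 - A2) ord0 ord0 = A1 ord0 ord0 - A2 ord0 ord0 by rewrite !mxE.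
  by move: (y - err) (Q0 y) => z Qy; rewrite mulmxBr mulmxBl mB; ring.
rewrite (le_trans (ler_normD _ _))// /Q0 form_sub_expand.
set F1 := (err^T *m _ *m err) _ _; set F2 := (y^T *m _ *m err) _ _; set F3 := (err^T *m _ *m y) _ _.
have fb (a b : 'cV[R]_N) (ca cb : R) : `|a| <= ca -> `|b| <= cb ->
    `|(a^T *m V theta0 *m b) ord0 ord0| <= KV * (ca * cb).
  move=> ha hb; rewrite (le_trans (norm_form_le _ _ _))// ler_wpM2l//.
  by rewrite ler_pM.
have f1 : `|F1| <= KV * ((L * `|x|) * (eta * (K * `|x|))) by apply: fb => //; exact: le_trans KxL.
have f2 : `|F2| <= KV * ((L * `|x|) * (eta * (K * `|x|))) by apply: fb.
have f3 : `|F3| <= KV * ((L * `|x|) * (eta * (K * `|x|))).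
  by rewrite [X in KV * X]mulrC; apply: fb.
have f4 : `|F1 - F2 - F3| <= `|F1| + `|F2| + `|F3|.
  by rewrite (le_trans (ler_normB _ _))// lerD2r ler_normB.
have f5 := g2 (y - err).
have f6 : eta * `|y - err| ^+ 2 <= eta * (L * `|x|) ^+ 2.
  by apply: ler_wpM2l; [exact: ltW|rewrite lerXn2r ?nnegrE// mulr_ge0// ltW].
have f7 : eta * c * `|x| ^+ 2 <= e * `|x| ^+ 2 by rewrite ler_wpM2r// sqr_ge0.
have f8 : eta * `|x| ^+ 2 >= 0 by rewrite mulr_ge0 ?sqr_ge0// ltW.
have : eta * c * `|x| ^+ 2 = 3 * (KV * ((L * `|x|) * (eta * (K * `|x|)))) +
  eta * (L * `|x|) ^+ 2 + eta * `|x| ^+ 2 by rewrite /c; ring.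
lra.
Qed.

(** The upper bound tests the minimizer against [theta0 + B *m x]. For the lower one, coercivity and
    comparison with [theta0] give $|s(\theta)-s(\theta_0)|=O(|x|)$; consistency and the left inverse
    [G] of the derivative improve this to $|\theta-\theta_0|=O(|x|)$, so that the local expansion
    applies. *)
Lemma min_contrast_expansion (e : R) : 0 < e -> exists2 dl, 0 < dl &
  forall (x : 'cV[R]_N) (theta : 'cV[R]_q), `|x| < dl -> is_minimizer Theta (contrast_form (s theta0 + x)) theta ->
    `|contrast_form (s theta0 + x) theta - ((M *m x)^T *m (M *m x)) ord0 ord0| <=
      e * `|x| ^+ 2.
Proof.
move=> e0; have [c c0 coe] := V_coercive.
have KV0 := mx_sum_ge0 (V theta0); have KG0 := mx_sum_ge0 G; have KB0 := mx_sum_ge0 B.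
set KV := mx_sum _ in KV0; set KG := mx_sum _ in KG0; set KB := mx_sum _ in KB0.
pose K1 := Num.sqrt (KV / c); pose K2 := 1 + K1.
have K10 : 0 <= K1 by exact: sqrtr_ge0.
have K20 : 0 < K2 by rewrite ltr_pwDl.
(* Chosen so that [KG * eta] is at most $1/2$: the linearization error $\eta|u|$ can then be
   absorbed when [u] is bounded through [G]. *)
pose eta := (2 * (KG + 1))^-1.
have eta0 : 0 < eta by rewrite invr_gt0 mulr_gt0// ltr_wpDl.
have KGeta : KG * eta <= 1 / 2.
  rewrite /eta invfM mulrCA mul1r ler_piMr// ler_pdivrMr ?ltr_wpDl// mul1r lerDl//.
have /nbhs_ballP[r1 /= r10 h1] := s_derivable eta0.
have [gam gam0 hg] := contrast_consistent r10.
have /nbhs_ballP[r0 /= r00 h0] := theta0_int.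
pose K := 2 * KG * K2 + KB.
have K0 : 0 <= K by rewrite addr_ge0// !mulr_ge0// ltW.
have [d1 d10 hd] := contrast_local_expansion K0 e0.
have d0 : 0 < Num.min d1 (Num.min (gam / K2) (r0 / (KB + 1))).
  by rewrite !lt_min d10 !divr_gt0// ltr_wpDl.
exists (Num.min d1 (Num.min (gam / K2) (r0 / (KB + 1)))) => // x th.
rewrite !lt_min ltr_pdivlMr// ltr_pdivlMr ?ltr_wpDl// => /and3P[xd xg xr] [Tth min].
have x0 : 0 <= `|x| by [].
have Tth0 : Theta theta0 by exact: interior_subset theta0_int.
have Bx : `|B *m x| <= KB * `|x| by exact: norm_mulmx_le.
have up : contrast_form (s theta0 + x) th <= ((M *m x)^T *m (M *m x)) ord0 ord0 + e * `|x| ^+ 2.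
  have TB : Theta (theta0 + B *m x).
    apply: h0; rewrite -ball_normE /ball_/= opprD addNKr normrN (le_lt_trans Bx)//.
    by rewrite (le_lt_trans _ xr)// mulrC ler_wpM2l// lerDl.
  rewrite (le_trans (min _ TB))//.
  have BK : `|B *m x| <= K * `|x|.
    by rewrite (le_trans Bx)// ler_wpM2r// lerDr !mulr_ge0// ltW.
  have := hd x (B *m x) BK xd; rewrite /Q0 -attained ler_distl => /andP[_ ?]; lra.
have low : c * `|s theta0 + x - s th| ^+ 2 <= KV * `|x| ^+ 2.
  apply: le_trans (coe th Tth (s theta0 + x - s th)) _; apply: le_trans (min _ Tth0) _.
  rewrite /contrast_form [s theta0 + x]addrC addrK (le_trans (ler_norm _))//.
  by rewrite (le_trans (norm_form_le _ _ _))// expr2.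
have l1 : `|s theta0 + x - s th| <= K1 * `|x|.
  rewrite -(@ler_pXn2r _ 2)// ?nnegrE ?mulr_ge0//.
  have -> : (K1 * `|x|) ^+ 2 = KV * `|x| ^+ 2 / c.
    by rewrite exprMn /K1 sqr_sqrtr ?divr_ge0 ?(ltW c0)// mulrAC.
  by rewrite ler_pdivlMr// mulrC.
have l2 : `|s th - s theta0| <= K2 * `|x|.
  have -> : s th - s theta0 = x - (s theta0 + x - s th).
    by apply/colP => i; rewrite !mxE; ring.
  by rewrite (le_trans (ler_normB _ _))// mulrDl mul1r lerD2l.
pose u := th - theta0.
have ur : `|u| < r1.
  by apply: hg => //; rewrite (le_lt_trans l2)// mulrC.
have thE : th = theta0 + u by rewrite /u addrC subrK.
have ub : `|s th - s theta0 - D *m u| <= eta * `|u|.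
  by rewrite thE; apply: h1; rewrite -ball_normE /ball_/= sub0r normrN.
have uK : `|u| <= 2 * KG * K2 * `|x|.
  have : `|u| <= KG * (K2 * `|x| + eta * `|u|).
    rewrite -{1}[u]mul1mx -GD -mulmxA (le_trans (norm_mulmx_le _ _))// ler_wpM2l//.
    have -> : D *m u = (s th - s theta0) - (s th - s theta0 - D *m u).
      by apply/colP => i; rewrite !mxE; ring.
    by rewrite (le_trans (ler_normB _ _))// lerD.
  have : KG * eta * `|u| <= 1 / 2 * `|u| by rewrite ler_wpM2r.
  lra.
have := hd x u _ xd.
rewrite -thE => /(_ _) hdu.
have {}hdu : `|contrast_form (s theta0 + x) th - Q0 (x - D *m u)| <= e * `|x| ^+ 2.
  by apply: hdu; rewrite (le_trans uK)// ler_wpM2r// lerDl.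
move: hdu; rewrite !ler_distl => /andP[h2 _]; have := lower x u; rewrite -/(Q0 _) => h3.
by apply/andP; split; lra.
Qed.

End min_contrast.

(** * Cross variation of a continuous path and an absolutely continuous one *)

Section paths.
Context {R : realType}.

Lemma cvg_mx_entries (U : Type) (F : set_system U) (FF : Filter F) (m n : nat)
    (g : U -> 'M[R]_(m, n)) (l : 'M[R]_(m, n)) :
  (forall i j, (fun x => g x i j) @ F --> (l i j : R)) -> g @ F --> l.
Proof.
move=> h; apply/cvgrPdist_le => e e0.
have hh (ij : 'I_m * 'I_n) : \forall x \near F, `|l ij.1 ij.2 - g x ij.1 ij.2| <= e.
  by case: ij => i j; have /cvgrPdist_le /(_ _ e0) := h i j.
apply: filterS (filter_forall FF hh) => x hx.
by apply: mx_norm_le => [|i j]; [exact: ltW|rewrite !mxE; exact: (hx (i, j))].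
Qed.

Definition primitive (phi : R -> R) (t : R) : R :=
  \int[lebesgue_measure]_(s in `[0, t]) phi s.

Lemma primitive_sub (T : R) (phi : R -> R) (c eta s t : R) :
  {within `[0, T], continuous phi} -> 0 <= s -> s <= t -> t <= T ->
  (forall u, s <= u <= t -> `|phi u - c| <= eta) ->
  `|primitive phi t - primitive phi s - (t - s) * c| <= eta * (t - s).
Proof.
move=> cphi s0; rewrite le_eqVlt => /predU1P[<- _ _|st tT h].
  by rewrite !subrr mul0r subr0 normr0 mulr0.
have sub a b : 0 <= a -> b <= T -> {within `[a, b], continuous phi}.
  move=> a0 bT; apply: continuous_subspaceW cphi.
  by apply: subset_itvScc; rewrite bnd_simp.
have int0 : lebesgue_measure.-integrable `[0, t]%classic (EFin \o phi).
  by apply: continuous_compact_integrable; [exact: segment_compact|exact: sub].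
have mI : measurable (`]s, t]%classic : set (measurableTypeR R)) by exact: measurable_itv.
have int1 : lebesgue_measure.-integrable `]s, t]%classic (EFin \o phi).
  by apply: integrableS int0 => //; apply: subset_itvr; rewrite bnd_simp.
have intc (r : R) : lebesgue_measure.-integrable `]s, t]%classic (EFin \o (cst r)).
  have ic : lebesgue_measure.-integrable `[s, t]%classic (EFin \o (cst r)).
    apply: continuous_compact_integrable; first exact: segment_compact.
    by apply: continuous_subspaceT => x; exact: cvg_cst.
  by apply: integrableS ic => //; apply: subset_itvr; rewrite bnd_simp.
have mst : fine (lebesgue_measure (`]s, t]%classic : set R)) = t - s.
  by rewrite lebesgue_measure_itv/= lte_fin st.
rewrite /primitive Rintegral_itvB ?bnd_simp//; last exact: ltW.
rewrite [(t - s) * c]mulrC -mst -(Rintegral_cst _ mI) -RintegralB//; last exact: intc.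
have intd : lebesgue_measure.-integrable `]s, t]%classic (EFin \o (fun x => phi x - c)).
  by apply: eq_integrable (integrableB mI int1 (intc c)).
rewrite (le_trans (le_normr_Rintegral mI intd))//.
rewrite -(Rintegral_cst _ mI); apply: le_Rintegral => //.
    by apply: eq_integrable (integrable_norm intd).
  exact: intc.
move=> x /=; rewrite in_itv/= => /andP[sx xt]; apply: h; by rewrite ltW.
Qed.

(** The reference point [x] may lie outside $[s,t]$: it will be a node of a coarser grid. *)
Lemma primitive_expansion (T : R) (phi : R -> R) (eta : R) :
  {within `[0, T], continuous phi} -> 0 < eta ->
  exists2 dl, 0 < dl & forall s t x, 0 <= s -> s <= t -> t <= T ->
    0 <= x <= T -> `|s - x| < dl -> `|t - x| < dl ->
    `|primitive phi t - primitive phi s - (t - s) * phi x| <= eta * (t - s).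
Proof.
move=> cphi eta0; have [dl dl0 hdl] := within_uniform_continuity cphi eta0.
exists dl => // s t x s0 st tT xT sx tx; apply: (@primitive_sub T) => // u /andP[su ut].
apply: hdl => //; first by rewrite (le_trans s0)//= (le_trans ut).
move: sx tx; rewrite !ltr_norml => /andP[? ?] /andP[? ?]; apply/andP; split; lra.
Qed.

Definition path_increment (T : R) (n : nat) (y : R -> R) (i : nat) : R :=
  y (i.+1%:R * (T / n%:R)) - y (i%:R * (T / n%:R)).

Lemma abel_bound (n : nat) (w psi : nat -> R) (B : R) :
  0 <= B -> (forall i, (i <= n)%N -> `|w i| <= B) ->
  `|\sum_(i < n) (w i.+1 - w i) * psi i| <=
    B * (`|psi 0%N| + `|psi n| + \sum_(i < n) `|psi i.+1 - psi i|).
Proof.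
move=> B0 hw.
have -> : \sum_(i < n) (w i.+1 - w i) * psi i =
    w n * psi n - w 0%N * psi 0%N - \sum_(i < n) w i.+1 * (psi i.+1 - psi i).
  elim: n {hw} => [|n IH]; first by rewrite !big_ord0 subrr subr0.
  by rewrite !big_ord_recr/= IH; ring.
rewrite (le_trans (ler_normB _ _))// mulrDr lerD//.
  rewrite (le_trans (ler_normB _ _))// !normrM mulrDr [leRHS]addrC.
  by rewrite lerD// ler_wpM2r// hw.
rewrite (le_trans (ler_norm_sum _ _ _))// mulr_sumr ler_sum// => i _.
by rewrite normrM ler_wpM2r// hw.
Qed.

(** The index $\lfloor im/n\rfloor$ climbs from $0$ to $m$, so there are at most $m$ jumps, each of
    size at most $2M$; the bound is free of [n]. *)
Lemma block_variation (m n : nat) (phi : nat -> R) (M : R) :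
  (forall j, (j <= m)%N -> `|phi j| <= M) -> (0 < n)%N ->
  \sum_(i < n) `|phi (i.+1 * m %/ n)%N - phi (i * m %/ n)%N| <= 2 * M * m%:R.
Proof.
move=> h n0; have M0 : 0 <= M by exact: le_trans (h 0%N _).
have le_m i : (i <= n)%N -> (i * m %/ n <= m)%N.
  by move=> le_in; rewrite -{2}(mulKn m n0) leq_div2r// leq_mul2r le_in orbT.
apply: (@le_trans _ _ (\sum_(i < n) 2 * M * ((i.+1 * m %/ n)%:R - (i * m %/ n)%:R))).
  apply: ler_sum => i _; have : (i * m %/ n <= i.+1 * m %/ n)%N.
    by rewrite leq_div2r// leq_mul2r leqnSn orbT.
  rewrite leq_eqVlt => /predU1P[->|lt1]; first by rewrite !subrr normr0 mulr0.
  rewrite (@le_trans _ _ (M + M))//; first by rewrite (le_trans (ler_normB _ _))// lerD ?h ?le_m// ltnW.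
  have : (1 : R) <= (i.+1 * m %/ n)%:R - (i * m %/ n)%:R.
    by rewrite lerBrDl natr1 ler_nat.
  move=> g; have : M * 1 <= M * ((i.+1 * m %/ n)%:R - (i * m %/ n)%:R) by rewrite ler_wpM2l.
  lra.
rewrite -mulr_sumr -(big_mkord xpredT (fun i => (i.+1 * m %/ n)%:R - (i * m %/ n)%:R)).
by rewrite telescope_sumr// mulKn// mul0n div0n subr0.
Qed.

(** Increments of [D] are replaced by $h$ times [phi] at the nodes of a fixed coarse grid. Summation
    by parts makes the main part $O(h)$, since the coarse values have variation bounded in [n]; the
    remainder is at most $\eta h\sum|\Delta w|$ and is absorbed by the quadratic variation of
    [w]. *)
Lemma cross_variation (T : R) (w phi D : R -> R) (e : R) :
  0 < T -> {within `[0, T], continuous w} -> {within `[0, T], continuous phi} ->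
  (forall t, 0 <= t <= T -> D t = D 0 + primitive phi t) -> 0 < e ->
  \forall n \near \oo, Num.sqrt n%:R *
    `|\sum_(i < n) path_increment T n w i * path_increment T n D i| <=
    e * (1 + \sum_(i < n) path_increment T n w i ^+ 2).
Proof.
move=> T0 cw cphi hD e0.
have [B B0 hB] := within_bounded cw.
have [M M0 hM] := within_bounded cphi.
pose eta := e / T.
have eta0 : 0 < eta by rewrite divr_gt0.
have [dl dl0 hdl] := primitive_expansion cphi eta0.
(* Coarse cells are shorter than $dl/2$ and fine cells no longer than coarse ones, so both ends of a
   fine cell lie within $dl$ of its coarse node. *)
pose m := (Num.truncn (2 * T / dl)).+1.
have m0 : 0 < m%:R :> R by rewrite ltr0n.
have Tm : T / m%:R < dl / 2.
  rewrite ltr_pdivrMr//; have : 2 * T / dl < m%:R by exact: truncnS_gt.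
  by rewrite ltr_pdivrMr//; lra.
pose C := B * (M + M + 2 * M * m%:R) * T.
near=> n.
have n0 : (0 < n)%N by near: n; exact: nbhs_infty_gt.
have nR : 0 < n%:R :> R by rewrite ltr0n.
have Cn : C / Num.sqrt n%:R <= e / 2.
  by near: n; apply: near_div_sqrt; rewrite divr_gt0.
have nm : (m <= n)%N by near: n; exact: nbhs_infty_ge.
have s0 : 0 < Num.sqrt n%:R :> R by rewrite sqrtr_gt0.
have ss : Num.sqrt n%:R * Num.sqrt n%:R = n%:R :> R by rewrite -expr2 sqr_sqrtr// ler0n.
have sqE : (Num.sqrt n%:R)^-1 = Num.sqrt n%:R * n%:R^-1 :> R.
  by apply: (mulfI (lt0r_neq0 s0)); rewrite divff ?lt0r_neq0// mulrA ss divff// lt0r_neq0.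
pose h := T / n%:R.
have h0 : 0 < h by rewrite divr_gt0.
have hn : h * n%:R = T by rewrite /h divfK// gt_eqF.
have tin i : (i <= n)%N -> 0 <= i%:R * h <= T.
  by move=> le_in; rewrite mulr_ge0 ?ler0n ?(ltW h0)//= -hn mulrC ler_wpM2l ?(ltW h0)// ler_nat.
(* Index of the last coarse node not after the time $ih$. *)
pose j (i : nat) := (i * m %/ n)%N.
pose x (i : nat) : R := (j i)%:R * (T / m%:R).
have jm i : (i <= n)%N -> (j i <= m)%N.
  by move=> le_in; rewrite /j -{2}(mulKn m n0) leq_div2r// leq_mul2r le_in orbT.
have Tm0 : 0 < T / m%:R by rewrite divr_gt0.
have Tmm : T / m%:R * m%:R = T by rewrite divfK// gt_eqF.
have xin i : (i <= m)%N -> 0 <= i%:R * (T / m%:R) <= T.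
  by move=> le_im; rewrite mulr_ge0 ?ler0n ?(ltW Tm0)//= -{2}Tmm mulrC ler_wpM2l ?(ltW Tm0)// ler_nat.
have hm : h <= T / m%:R by rewrite ler_wpM2l ?(ltW T0)// lef_pV2 ?posrE// ler_nat.
have xle i : x i <= i%:R * h < x i + T / m%:R.
  have k0 : 0 < T / (m%:R * n%:R) by rewrite divr_gt0// mulr_gt0.
  have xE : x i = (j i * n)%:R * (T / (m%:R * n%:R)).
    by rewrite /x natrM; field; rewrite !gt_eqF.
  have iE : i%:R * h = (i * m)%:R * (T / (m%:R * n%:R)).
    by rewrite /h natrM; field; rewrite !gt_eqF.
  have -> : x i + T / m%:R = ((j i).+1 * n)%:R * (T / (m%:R * n%:R)).
    by rewrite /x natrM -natr1; field; rewrite !gt_eqF.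
  rewrite xE iE ler_pM2r// ltr_pM2r// ler_nat ltr_nat.
  by rewrite leq_trunc_div ltn_ceil.
pose psi (i : nat) := phi (x i).
pose rr (i : nat) := path_increment T n D i - h * psi i.
have rb (i : 'I_n) : `|rr i| <= eta * h.
  have -> : rr i = primitive phi (i.+1%:R * h) - primitive phi (i%:R * h) - (i.+1%:R * h - i%:R * h) * phi (x i).
    rewrite /rr /path_increment -/h (hD _ (tin _ (ltn_ord i))) (hD _ (tin _ (ltnW (ltn_ord i)))).
    by rewrite -natr1 /psi; ring.
  have -> : eta * h = eta * (i.+1%:R * h - i%:R * h) by rewrite -natr1; ring.
  have /andP[x1 x2] := xle i.
  have [t0 t1] := (tin i (ltnW (ltn_ord i)), tin i.+1 (ltn_ord i)).
  move/andP: t0 => [t00 t01]; move/andP: t1 => [t10 t11].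
  have Si : i.+1%:R * h = i%:R * h + h by rewrite -natr1; ring.
  apply: hdl => //.
  - by rewrite Si lerDl ltW.
  - by apply: xin; apply: jm; exact: ltnW.
  - by rewrite ger0_norm ?subr_ge0//; lra.
  - by rewrite Si ger0_norm; lra.
have -> : \sum_(i < n) path_increment T n w i * path_increment T n D i =
    h * (\sum_(i < n) path_increment T n w i * psi i) + \sum_(i < n) path_increment T n w i * rr i.
  by rewrite mulr_sumr -big_split/=; apply: eq_bigr => i _; rewrite /rr; ring.
have a1 : `|\sum_(i < n) path_increment T n w i * psi i| <= B * (M + M + 2 * M * m%:R).
  have := @abel_bound n (fun i => w (i%:R * h)) psi B B0.
  move=> /(_ (fun i hi => hB _ (tin i hi))) => hab.
  apply: (le_trans hab); apply: ler_wpM2l => //; apply: lerD.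
    by apply: lerD; rewrite /psi; apply: hM; apply: xin; apply: jm.
  have hb i : (i <= m)%N -> `|phi (i%:R * (T / m%:R))| <= M by move=> im; apply: hM; exact: xin.
  exact: (@block_variation m n (fun i => phi (i%:R * (T / m%:R))) M hb n0).
(* The inequality $\sqrt n|y|\le(1+ny^2)/2$ turns the sum of absolute increments into the quadratic
   variation. *)
have a2 : Num.sqrt n%:R * `|\sum_(i < n) path_increment T n w i * rr i| <=
    e / 2 * (1 + \sum_(i < n) path_increment T n w i ^+ 2).
  apply: (@le_trans _ _ (\sum_(i < n) (eta * h) * ((1 + n%:R * path_increment T n w i ^+ 2) / 2))).
    rewrite (le_trans (ler_wpM2l (ltW s0) (ler_norm_sum _ _ _)))// mulr_sumr.
    apply: ler_sum => i _; rewrite normrM mulrA mulrC ler_pM ?mulr_ge0 ?(ltW s0)//.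
    move: (path_increment T n w i) => y; rewrite -[y ^+ 2]real_normK ?num_real//.
    have -> : n%:R * `|y| ^+ 2 = (Num.sqrt n%:R * `|y|) ^+ 2 by rewrite exprMn [_ ^+ 2 in RHS]expr2 ss.
    by have := sqr_ge0 (Num.sqrt n%:R * `|y| - 1); move: (_ * `|y|) => a; lra.
  have -> : \sum_(i < n) eta * h * ((1 + n%:R * path_increment T n w i ^+ 2) / 2) =
     e / 2 * (1 + \sum_(i < n) path_increment T n w i ^+ 2).
    rewrite -mulr_sumr -mulr_suml big_split/= sumr_const card_ord -mulr_sumr.
    by rewrite /eta /h; field; rewrite !gt_eqF.
  by [].
rewrite (le_trans (ler_wpM2l (ltW s0) (ler_normD _ _)))// mulrDr.
have -> : e * (1 + \sum_(i < n) path_increment T n w i ^+ 2) =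
   e / 2 * (1 + \sum_(i < n) path_increment T n w i ^+ 2) + e / 2 * (1 + \sum_(i < n) path_increment T n w i ^+ 2).
  by rewrite -mulrDl -splitr.
apply: lerD => //; rewrite normrM gtr0_norm//.
apply: (@le_trans _ _ (e / 2)); last first.
  by rewrite ler_peMr ?divr_ge0 ?(ltW e0)// lerDl sumr_ge0// => i _; exact: sqr_ge0.
apply: le_trans Cn.
have -> : C / Num.sqrt n%:R = Num.sqrt n%:R * (h * (B * (M + M + 2 * M * m%:R))).
  by rewrite sqE /C /h; ring.
by rewrite !ler_wpM2l// ltW.
Unshelve. all: by end_near. Qed.

(** Each product is $O(h^2)$, so the sum is $O(1/n)$ and beats the factor $\sqrt n$. *)
Lemma drift_variation (T : R) (phi phi' D D' : R -> R) (e : R) :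
  0 < T -> {within `[0, T], continuous phi} -> {within `[0, T], continuous phi'} ->
  (forall t, 0 <= t <= T -> D t = D 0 + primitive phi t) ->
  (forall t, 0 <= t <= T -> D' t = D' 0 + primitive phi' t) -> 0 < e ->
  \forall n \near \oo, Num.sqrt n%:R *
    `|\sum_(i < n) path_increment T n D i * path_increment T n D' i| <= e.
Proof.
move=> T0 cphi cphi' hD hD' e0.
have [M M0 hM] := within_bounded cphi.
have [M' M'0 hM'] := within_bounded cphi'.
near=> n.
have n0 : (0 < n)%N by near: n; exact: nbhs_infty_gt.
have nR : 0 < n%:R :> R by rewrite ltr0n.
have Cn : M * M' * T ^+ 2 / Num.sqrt n%:R <= e.
  by near: n; apply: near_div_sqrt.
have s0 : 0 < Num.sqrt n%:R :> R by rewrite sqrtr_gt0.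
have ss : Num.sqrt n%:R * Num.sqrt n%:R = n%:R :> R by rewrite -expr2 sqr_sqrtr// ler0n.
have sqE : (Num.sqrt n%:R)^-1 = Num.sqrt n%:R * n%:R^-1 :> R.
  by apply: (mulfI (lt0r_neq0 s0)); rewrite divff ?lt0r_neq0// mulrA ss divff// lt0r_neq0.
pose h := T / n%:R.
have h0 : 0 < h by rewrite divr_gt0.
have hn : h * n%:R = T by rewrite /h divfK// gt_eqF.
have tin i : (i <= n)%N -> 0 <= i%:R * h <= T.
  by move=> le_in; rewrite mulr_ge0 ?ler0n ?(ltW h0)//= -hn mulrC ler_wpM2l ?(ltW h0)// ler_nat.
have db (f F : R -> R) (K : R) : {within `[0, T], continuous f} ->
    (forall x, 0 <= x <= T -> `|f x| <= K) -> (forall t, 0 <= t <= T -> F t = F 0 + primitive f t) ->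
    forall i : 'I_n, `|path_increment T n F i| <= K * h.
  move=> cf hK hF i; rewrite /path_increment -/h (hF _ (tin _ (ltn_ord i))) (hF _ (tin _ (ltnW (ltn_ord i)))).
  have /andP[t00 t01] := tin i (ltnW (ltn_ord i)).
  have /andP[t10 t11] := tin i.+1 (ltn_ord i).
  have Si : i.+1%:R * h = i%:R * h + h by rewrite -natr1; ring.
  have := @primitive_sub T f 0 K _ _ cf t00 _ t11.
  rewrite mulr0 subr0 Si [X in K * X](_ : _ = h); last by ring.
  have -> : F 0 + primitive f (i%:R * h + h) - (F 0 + primitive f (i%:R * h)) =
    primitive f (i%:R * h + h) - primitive f (i%:R * h) by ring.
  apply; first by rewrite lerDl ltW.
  by move=> u /andP[u1 u2]; rewrite subr0; apply: hK; apply/andP; split; lra.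
apply: le_trans Cn.
apply: (@le_trans _ _ (Num.sqrt n%:R * (\sum_(i < n) (M * h) * (M' * h)))).
  rewrite ler_wpM2l ?(ltW s0)// (le_trans (ler_norm_sum _ _ _))// ler_sum// => i _.
  by rewrite normrM ler_pM ?(db phi D M cphi hM hD) ?(db phi' D' M' cphi' hM' hD').
rewrite sumr_const card_ord -[(M * h * (M' * h)) *+ n]mulr_natr.
have -> // : Num.sqrt n%:R * (M * h * (M' * h) * n%:R) = M * M' * T ^+ 2 / Num.sqrt n%:R.
by rewrite sqE /h; field; rewrite gt_eqF.
Unshelve. all: by end_near. Qed.

End paths.

(** * Regularity of the factor model *)

Section inverse_continuity.
Context {R : realType} {U : Type} {F : set_system U} {FF : ProperFilter F}.

Lemma cvg_det (n : nat) (A : U -> 'M[R]_n) (B : 'M[R]_n) :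
  (forall i j, (fun x => A x i j) @ F --> (B i j : R)) ->
  (fun x => \det (A x)) @ F --> (\det B : R).
Proof.
move=> AB; apply: cvg_sum_fun => s; apply: cvgM; first exact: cvg_cst.
by apply: cvg_prod_fun => i; exact: AB.
Qed.

(** Near the limit the determinant is nonzero, and the inverse is the adjugate over the determinant,
    both polynomial in the entries. *)
Lemma cvg_invmx (n : nat) (A : U -> 'M[R]_n) (B : 'M[R]_n) :
  (forall i j, (fun x => A x i j) @ F --> (B i j : R)) -> B \in unitmx ->
  forall i j, (fun x => invmx (A x) i j) @ F --> (invmx B i j : R).
Proof.
move=> AB uB i j; have dB : \det B != 0 by rewrite -unitfE -unitmxE.
have dA := cvg_det AB.
have nA : \forall x \near F, \det (A x) != 0 by exact: (cvgr_neq0 _ dA dB).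
have E : \forall x \near F, (\det (A x))^-1 * \adj (A x) i j = invmx (A x) i j.
  by apply: filterS nA => x dx; rewrite /invmx unitmxE unitfE dx [RHS]mxE.
apply: cvg_trans (near_eq_cvg E) _.
have -> : invmx B i j = (\det B)^-1 * \adj B i j by rewrite /invmx uB [LHS]mxE.
apply: cvgM.
  by apply: (cvgV dB).
under eq_fun do rewrite mxE; rewrite mxE.
apply: cvgM; first exact: cvg_cst.
by apply: (cvg_det (A := fun x => row' j (col' i (A x)))) => a b; under eq_fun do rewrite !mxE; rewrite !mxE; exact: AB.
Qed.

End inverse_continuity.

Section differentiable_matrices.
Context {R : realType} {V : normedModType R}.

Definition differentiable_mx (m n : nat) (A : V -> 'M[R]_(m, n)) (x : V) :=
  forall i j, differentiable (fun y => A y i j : R) x.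

Lemma differentiable_mx_cst (m n : nat) (B : 'M[R]_(m, n)) (x : V) :
  differentiable_mx (fun=> B) x.
Proof. by move=> i j; exact: differentiable_cst. Qed.

Lemma differentiable_mxD (m n : nat) (A B : V -> 'M[R]_(m, n)) (x : V) :
  differentiable_mx A x -> differentiable_mx B x ->
  differentiable_mx (fun y => A y + B y) x.
Proof.
move=> dA dB i j; under eq_fun do rewrite mxE.
exact: (differentiableD (dA i j) (dB i j)).
Qed.

Lemma differentiable_mxM (m n q : nat) (A : V -> 'M[R]_(m, n)) (B : V -> 'M[R]_(n, q)) (x : V) :
  differentiable_mx A x -> differentiable_mx B x ->
  differentiable_mx (fun y => A y *m B y) x.
Proof.
move=> dA dB i j; under eq_fun do rewrite mxE.
have := @differentiable_sum _ _ _ n (fun l y => A y i l * B y l j : R) x.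
rewrite (_ : \sum_(l < n) _ = fun y => \sum_l A y i l * B y l j); last first.
  by apply/funext => y; rewrite fct_sumE.
apply=> l; exact: (differentiableM (dA i l) (dB l j)).
Qed.

Lemma differentiable_mxZ (m n : nat) (c : R) (A : V -> 'M[R]_(m, n)) (x : V) :
  differentiable_mx A x -> differentiable_mx (fun y => c *: A y) x.
Proof.
move=> dA i j; under eq_fun do rewrite mxE.
exact: (differentiableZ c (dA i j)).
Qed.

Lemma differentiable_mx_tens (m n q r : nat) (A : V -> 'M[R]_(m, n)) (B : V -> 'M[R]_(q, r)) (x : V) :
  differentiable_mx A x -> differentiable_mx B x ->
  differentiable_mx (fun y => A y *t B y) x.
Proof.
move=> dA dB i j; under eq_fun do rewrite mxE.
exact: (differentiableM (dA _ _) (dB _ _)).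
Qed.

Lemma differentiable_rV (n : nat) (g : V -> 'rV[R]_n) (x : V) :
  differentiable_mx g x -> differentiable g x.
Proof.
move=> dg.
have -> : g = \sum_(l < n) (fun y => g y ord0 l *: (delta_mx ord0 l : 'rV[R]_n)).
  apply/funext => y; rewrite fct_sumE [LHS]matrix_sum_delta big_ord1.
  by apply: eq_bigr => l _.
by apply: differentiable_sum => l; apply: differentiableZl; exact: dg.
Qed.

End differentiable_matrices.

Section model_regularity.
Context {R : realType} {p k : nat} (kp : (k <= p)%N).
Implicit Types (x : 'rV[R]_(qdim p k)) (theta : 'cV[R]_(qdim p k)).

Lemma differentiable_Lambda x : differentiable_mx (fun y => Lambda kp y^T) x.
Proof.
move=> i j; rewrite /Lambda; under eq_fun do rewrite castmxE/= mxE.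
case: (fintype.split _) => a; first exact: differentiable_cst.
by under eq_fun do rewrite !mxE; exact: differentiable_coord.
Qed.

Lemma differentiable_Sigma x : differentiable_mx (fun y => Sigma kp y^T) x.
Proof.
have dL := differentiable_Lambda x.
apply: differentiable_mxD.
  apply: differentiable_mxM; last by move=> i j; under eq_fun do rewrite mxE; exact: dL.
  apply: differentiable_mxM => // i j; rewrite /Sigma_ff /unvech.
  under eq_fun do rewrite mxE.
  apply: differentiable_mxM; first exact: differentiable_mx_cst.
  by move=> a b; under eq_fun do rewrite !mxE; exact: differentiable_coord.
move=> i j; under eq_fun do rewrite mxE.
have [_|_] := eqVneq i j; last by under eq_fun do rewrite mulr0n; exact: differentiable_cst.
by under eq_fun do rewrite mulr1n !mxE; exact: differentiable_coord.
Qed.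

Lemma differentiable_Wmx x : differentiable_mx (fun y => Wmx kp y^T) x.
Proof.
apply: differentiable_mxZ; apply: differentiable_mxM; last exact: differentiable_mx_cst.
apply: differentiable_mxM; first exact: differentiable_mx_cst.
by apply: differentiable_mx_tens; exact: differentiable_Sigma.
Qed.

Lemma differentiable_mx_continuous (m n : nat) (A : 'cV[R]_(qdim p k) -> 'M[R]_(m, n)) theta i j :
  differentiable_mx (fun y : 'rV_(qdim p k) => A y^T) theta^T ->
  {for theta, continuous (fun t => A t i j)}.
Proof.
move=> /(_ i j) /differentiable_continuous cA.
have ct : {for theta, continuous (fun t : 'cV[R]_(qdim p k) => t^T)}.
  apply: (cvg_mx_entries (nbhs_filter theta)) => a b; rewrite mxE; under eq_fun do rewrite mxE.
  exact: coord_continuous.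
have -> : (fun t => A t i j) = (fun y : 'rV[R]_(qdim p k) => A y^T i j) \o trmx.
  by apply/funext => t /=; rewrite trmxK.
exact: continuous_comp ct cA.
Qed.

Lemma Sigma_continuous theta i j : {for theta, continuous (fun t : 'cV[R]_(qdim p k) => Sigma kp t i j)}.
Proof. apply: differentiable_mx_continuous; exact: differentiable_Sigma. Qed.

Lemma Wmx_continuous theta i j : {for theta, continuous (fun t : 'cV[R]_(qdim p k) => Wmx kp t i j)}.
Proof. apply: differentiable_mx_continuous; exact: differentiable_Wmx. Qed.

(** The Jacobian acts on row vectors: the expansion is obtained for the transposed map and carried
    back, transposition not increasing the sup norm. *)
Lemma vech_Sigma_derivable theta (e : R) : 0 < e ->
  \forall u \near (0 : 'cV[R]_(qdim p k)),
    `|vech (Sigma kp (theta + u)) - vech (Sigma kp theta) - Delta kp theta *m u| <= e * `|u|.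
Proof.
move=> e0; pose f := fun x => (vech (Sigma kp x^T))^T.
have norm_tr (m n : nat) (A : 'M[R]_(m, n)) : `|A^T| <= `|A|.
  by apply: mx_norm_le => // i j; rewrite mxE mx_entry_le.
have df : differentiable f theta^T.
  apply: differentiable_rV => i l; rewrite /f; under eq_fun do rewrite 2!mxE.
  exact: differentiable_Sigma.
have := diff_locally df => /eqaddoP /(_ e e0) h.
have tr0 : (fun u : 'cV[R]_(qdim p k) => u^T) @ (0 : 'cV[R]_(qdim p k)) --> (0 : 'rV[R]_(qdim p k)).
  apply: (cvg_mx_entries (nbhs_filter _)) => a b; rewrite mxE; under eq_fun do rewrite mxE.
  have := @coord_continuous R _ _ b a (0 : 'cV[R]_(qdim p k)).
  by rewrite /continuous_at mxE.
have hu0 : \forall u \near (0 : 'cV[R]_(qdim p k)), `|f (u^T + theta^T) - (f theta^T + 'd f (theta^T) (u^T))| <= e * `|u^T|.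
  exact: (tr0 _ h).
apply: filterS hu0 => u hu.
rewrite -[u]trmxK; move: hu; set v := u^T => hu.
apply: (@le_trans _ _ (e * `|v|)); last by rewrite ler_wpM2l ?(ltW e0)// -{1}[v]trmxK norm_tr.
apply: le_trans hu; rewrite -[X in `|X| <= _]trmxK (le_trans (norm_tr _ _ _))//.
have -> // : (vech (Sigma kp (theta + v^T)) - vech (Sigma kp theta) - Delta kp theta *m v^T)^T
  = f (v + theta^T) - (f theta^T + 'd f (theta^T) v).
rewrite /Delta !linearB/= trmx_mul !trmxK -/f /jacobian mul_rV_lin1 /f.
by rewrite [(v + _)^T]linearD/= !trmxK [u + theta]addrC opprD addrA.
Qed.

End model_regularity.

Lemma form_sub_dual (R : realType) (n : nat) (W : 'M[R]_n) (x v : 'cV[R]_n) (K : R) :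
  W^T = W -> W *m v = x ->
  ((x - K *: v)^T *m W *m (x - K *: v)) ord0 ord0 =
  (x^T *m W *m x) ord0 ord0 - 2 * K * (x^T *m x) ord0 ord0 + K ^+ 2 * (x^T *m v) ord0 ord0.
Proof.
move=> sW Wv.
have mB (A B : 'M[R]_1) : (A - B) ord0 ord0 = A ord0 ord0 - B ord0 ord0 by rewrite !mxE.
have mZ (c : R) (A : 'M[R]_1) : (c *: A) ord0 ord0 = c * A ord0 ord0 by rewrite !mxE.
have -> : (x - K *: v)^T = x^T - K *: v^T by apply/matrixP => a b; rewrite !mxE.
rewrite mulmxBl -scalemxAl (_ : v^T *m W = x^T); last first.
  by apply: trmx_inj; rewrite trmx_mul !trmxK sW Wv.
rewrite mulmxBl !mulmxBr -!scalemxAl -!scalemxAr !mB !mZ.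
rewrite -[x^T *m W *m v]mulmxA Wv; ring.
Qed.

(** * Covariance of the factor model and expansion of its contrast *)

Section model_covariance.
Context {R : realType} {p k r : nat} (kp : (k <= p)%N).
Implicit Types (theta : 'cV[R]_(qdim p k)) (S : 'M[R]_(k, r)).

(** A factor $N$ with $\Sigma=NN^\top$, its columns ordered like the driving processes: the [r]
    factor noises, then the [p] idiosyncratic ones. *)
Definition noise_mx theta S : 'M[R]_(p, r + p) :=
  row_mx (Lambda kp theta *m S) (diag_mx (\row_i sigma theta i)).

Lemma noise_mx_factor theta S :
  Sigma_ff theta = S *m S^T -> (forall i, 0 < sigma theta i) ->
  Sigma kp theta = noise_mx theta S *m (noise_mx theta S)^T.
Proof.
move=> SS s0; rewrite /noise_mx tr_row_mx mul_row_col trmx_mul tr_diag_mx mulmx_diag.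
rewrite /Sigma SS !mulmxA; congr (_ + diag_mx _); apply/rowP => i; rewrite !mxE.
rewrite -expr2 [RHS]sqr_sqrtr; first by rewrite mxE.
by have := s0 i; rewrite /sigma sqrtr_gt0 => /ltW.
Qed.

Lemma noise_mx_rinv theta S : (forall i, 0 < sigma theta i) ->
  exists E, noise_mx theta S *m E = 1%:M.
Proof.
move=> s0; exists (col_mx 0 (diag_mx (\row_i (sigma theta i)^-1))).
rewrite /noise_mx mul_row_col mulmx0 add0r mulmx_diag; apply/matrixP => i j.
by rewrite !mxE divff// lt0r_neq0.
Qed.

Lemma Sigma_sym theta : (Sigma kp theta)^T = Sigma kp theta.
Proof.
rewrite /Sigma linearD/= !trmx_mul trmxK tr_diag_mx mulmxA; congr (_ *m _ *m _ + _).
apply/matrixP => i j; rewrite /Sigma_ff /unvech mxE mxE [RHS]mxE mxE [RHS]mxE.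
by apply: eq_bigr => m _; rewrite dup_mx_sym.
Qed.

(** By [vech_dual_form] the form equals $2\|N^\top CN\|_F^2$ with $C$ dual to $x$; a right inverse
    of $N$ recovers $C$, so the form vanishes only at $x=0$. *)
Lemma posdef_Wmx theta S :
  Sigma_ff theta = S *m S^T -> (forall i, 0 < sigma theta i) -> posdef (Wmx kp theta).
Proof.
move=> SS s0; split.
  rewrite /Wmx linearZ/=; move: (dup_pinv R p) => D.
  by rewrite !trmx_mul trmxK trmx_tens Sigma_sym mulmxA.
move=> x x0; rewrite /Wmx -scalemxAr -scalemxAl mxE (noise_mx_factor SS s0) vech_dual_form.
rewrite pmulr_rgt0//; set G := _ *m _ *m _.
have Gs : 0 <= \sum_(ab : 'I_(r + p) * 'I_(r + p)) G ab.1 ab.2 * G ab.1 ab.2.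
  by apply: sumr_ge0 => ab _; rewrite -expr2 sqr_ge0.
rewrite lt_neqAle Gs andbT eq_sym; apply: contra x0 => G0.
have G0' : G = 0.
  apply/matrixP => a b; rewrite [RHS]mxE; move: G0.
  rewrite psumr_eq0 => [|ab _]; last by rewrite -expr2 sqr_ge0.
  by move=> /allP /(_ (a, b)); rewrite mem_index_enum => /(_ isT) /=; rewrite mulf_eq0 orbb => /eqP.
have [E nE] := noise_mx_rinv S s0.
apply/eqP/vech_dual_eq0; move: G0'; rewrite /G => /(congr1 (fun A => E^T *m A *m E)).
rewrite mulmx0 mul0mx !mulmxA -trmx_mul nE trmx1 mul1mx => <-.
by rewrite -mulmxA nE mulmx1.
Qed.

Variables (Theta : set 'cV[R]_(qdim p k)).
Hypothesis Theta_compact : compact Theta.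
Hypothesis Theta_ff : forall theta, Theta theta ->
  exists S : 'M[R]_(k, r), Sigma_ff theta = S *m S^T.
Hypothesis sigma_gt0 : forall theta, Theta theta -> forall i, 0 < sigma theta i.

Lemma posdef_Wmx_in theta : Theta theta -> posdef (Wmx kp theta).
Proof. by move=> Tt; have [S SS] := Theta_ff Tt; apply: posdef_Wmx SS (sigma_gt0 Tt). Qed.

Lemma invmx_Wmx_continuous theta i j : Theta theta ->
  {for theta, continuous (fun t : 'cV[R]_(qdim p k) => invmx (Wmx kp t) i j)}.
Proof.
move=> Tt; have uW := posdef_unitmx (posdef_Wmx_in Tt).
apply: (cvg_invmx (FF := nbhs_pfilter theta)) => // a b.
exact: (@Wmx_continuous R p k kp theta a b).
Qed.

Lemma Wmx_bounded : exists2 K, 0 < K & forall theta, Theta theta -> mx_sum (Wmx kp theta) <= K.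
Proof.
have cW : continuous (fun theta => mx_sum (Wmx kp theta) : R).
  move=> theta; apply: (cvg_sum_fun (FF := nbhs_filter theta)) => i.
  apply: (cvg_sum_fun (FF := nbhs_filter theta)) => j.
  exact: (@cvg_norm _ _ _ _ (nbhs_filter theta) _ _ (@Wmx_continuous R p k kp theta i j)).
have := continuous_compact (continuous_subspaceT cW) Theta_compact.
move=> /compact_bounded[N [_ hN]]; exists (`|N| + 1) => [|theta Tt]; first by rewrite ltr_wpDl.
rewrite (le_trans (ler_norm _))//; apply: (hN (`|N| + 1)); first by rewrite ltr_pwDr// ler_norm.
by exists theta.
Qed.

(** An upper bound $K$ for $W$ bounds $W^{-1}$ from below: expanding $z^\top Wz\ge0$ at
    $z=x-KW^{-1}x$ gives $0\le x^\top Wx-2Kx^\top x+K^2x^\top W^{-1}x$, and $x^\top Wx\le K|x|^2\le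
    Kx^\top x$ leaves the constant $1/K$. *)
Lemma invmx_Wmx_coercive : exists2 c, 0 < c & forall theta, Theta theta ->
  forall x : 'cV[R]_(pbar p), c * `|x| ^+ 2 <= (x^T *m invmx (Wmx kp theta) *m x) ord0 ord0.
Proof.
have [K K0 hK] := Wmx_bounded; exists K^-1 => [|theta Tt x]; first by rewrite invr_gt0.
have pW := posdef_Wmx_in Tt; have uW := posdef_unitmx pW; have [sW pW'] := pW.
set V := invmx _; set W := Wmx kp theta in uW sW pW' V *.
have sV : V^T = V by rewrite /V trmx_inv sW.
rewrite ler_pdivrMl//; set X := `|x| ^+ 2; set F := (_ *m _) _ _.
pose y := V *m x; pose z := x - K *: y.
have Wy : W *m y = x by rewrite /y mulmxA mulmxV// mul1mx.
have zz : 0 <= (z^T *m W *m z) ord0 ord0.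
  have [->|z0] := eqVneq z 0; first by rewrite mulmx0 mxE.
  exact/ltW/pW'.
have XX : X <= (x^T *m x) ord0 ord0 by exact: norm_sqr_le.
have xWx : (x^T *m W *m x) ord0 ord0 <= K * X.
  rewrite (le_trans (ler_norm _))// (le_trans (norm_form_le _ _ _))// /X expr2.
  by rewrite ler_wpM2r ?mulr_ge0// hK.
have Fy : F = (x^T *m y) ord0 ord0 by rewrite /F /y mulmxA.
have F0 : X * K <= K ^+ 2 * F by move: zz; rewrite /z (form_sub_dual _ sW Wy) -Fy; nra.
by rewrite -(ler_pM2l K0) mulrC mulrA -expr2.
Qed.

Variables (theta0 : 'cV[R]_(qdim p k)).
Hypothesis theta0_int : Theta° theta0.
Hypothesis ident : forall theta, Theta theta ->
  Sigma kp theta = Sigma kp theta0 -> theta = theta0.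
Hypothesis rank_Delta : \rank (Delta kp theta0) = qdim p k.

Lemma contrast_expansion : exists2 M : 'M[R]_(pbar p - qdim p k, pbar p),
  M *m Wmx kp theta0 *m M^T = 1%:M & forall e, 0 < e -> exists2 dl, 0 < dl &
  forall Q theta, let x := vech Q - vech (Sigma kp theta0) in
    `|x| < dl -> is_minimizer Theta (contrast kp Q) theta ->
    `|contrast kp Q theta - ((M *m x)^T *m (M *m x)) ord0 ord0| <= e * `|x| ^+ 2.
Proof.
have T0 : Theta theta0 by exact: interior_subset theta0_int.
have pW := posdef_Wmx_in T0; have uW := posdef_unitmx pW.
have [M [B [MD MWM WB]]] := posdef_complement pW rank_Delta.
exists M => // e e0.
have [G GD] : exists G, G *m Delta kp theta0 = 1%:M.
  by apply/row_fullP; rewrite /row_full rank_Delta.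
pose V theta := invmx (Wmx kp theta).
have form (x : 'cV[R]_(pbar p)) : (x^T *m V theta0 *m x) ord0 ord0 = ((M *m x)^T *m (M *m x)) ord0 ord0 +
  ((x - Wmx kp theta0 *m M^T *m M *m x)^T *m V theta0 *m
   (x - Wmx kp theta0 *m M^T *m M *m x)) ord0 ord0 by exact: posdef_complement_form.
have Mu (x : 'cV[R]_(pbar p)) (u : 'cV[R]_(qdim p k)) : M *m (x - Delta kp theta0 *m u) = M *m x.
  by rewrite mulmxBr mulmxA MD mul0mx subr0.
have Vx0 (x : 'cV[R]_(pbar p)) : 0 <= (x^T *m V theta0 *m x) ord0 ord0.
  have [->|x0] := eqVneq x 0; first by rewrite mulmx0 mxE.
  by have [_ pV] := posdef_inv pW; exact/ltW/pV.
have := @min_contrast_expansion R (qdim p k) (pbar p) _ Theta theta0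
  (fun t => vech (Sigma kp t)) V (Delta kp theta0) G M B Theta_compact theta0_int.
case/(_ _ _ _ _ _ _ _ _ e e0).
- move=> theta i; rewrite (_ : (fun t => _) = fun t : 'cV[R]_(qdim p k) => Sigma kp t (vech_pos i).1 (vech_pos i).2).
    exact: Sigma_continuous.
  by apply/funext => t; rewrite mxE.
- by move=> i j; exact: invmx_Wmx_continuous.
- by move=> e' e'0; exact: vech_Sigma_derivable.
- exact: invmx_Wmx_coercive.
- move=> theta Tt /(congr1 (@unvech R p)); rewrite !vechK ?Sigma_sym//; exact: ident.
- exact: GD.
- by move=> x u; rewrite form Mu lerDl.
- move=> x; rewrite form Mu; set z := _ - _ *m M *m _.
  (* Here $x-DBx=WM^\top Mx$ with $D$ the Jacobian [Delta]; this vector is its own projection, so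
     the residual vanishes. *)
  suff -> : z = 0 by rewrite mulmx0 [X in _ + X]mxE addr0.
  rewrite /z -[_ *m M *m _]mulmxA Mu -!mulmxA.
  have := congr1 (mulmx^~ x) WB; rewrite /= mulmxBl mul1mx -!mulmxA => <-.
  by rewrite opprB [x + _]addrC subrK subrr.
move=> dl dl0 h; exists dl => // Q theta x xd min.
have := h x theta xd; rewrite /x addrC subrK; exact.
Qed.

End model_covariance.

(** * Measurability of the minimum *)

Section measurable_minimum.
Context {R : realType}.

(** Rational points may fall outside [Theta]: for each of them and each radius $1/(m+1)$, an element
    of [Theta] within that radius is chosen if there is one, and [theta0] otherwise. *)
Lemma countable_dense (q : nat) (Theta : set 'cV[R]_q) (theta0 : 'cV[R]_q) :
  Theta theta0 -> exists2 pt : nat -> 'cV[R]_q, forall i, Theta (pt i) &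
  forall theta e, Theta theta -> 0 < e -> exists i, `|theta - pt i| < e.
Proof.
move=> T0.
pose c (v : {ffun 'I_q -> rat}) : 'cV[R]_q := \col_j ratr (v j).
pose near_c (vm : {ffun 'I_q -> rat} * nat) : set 'cV[R]_q :=
  Theta `&` [set theta | `|theta - c vm.1| <= vm.2.+1%:R^-1].
pose pt0 vm := if pselect (exists t, near_c vm t) is left _ then xget theta0 (near_c vm) else theta0.
have pt0P vm : Theta (pt0 vm).
  by rewrite /pt0; case: pselect => // ex; have [] := xgetPex theta0 ex.
exists (fun i => if unpickle i is Some vm then pt0 vm else theta0) => [i|theta e Tt e0].
  by case: unpickle.
have [m me] : exists m, 2 * m.+1%:R^-1 < e.
  exists (Num.truncn (2 / e)); rewrite ltr_pdivrMr ?ltr0n// -ltr_pdivrMl// mulrC.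
  exact: truncnS_gt.
have m0 : 0 < m.+1%:R^-1 :> R by rewrite invr_gt0.
have /choice[v hv] : forall j, exists a : rat, `|theta j ord0 - ratr a| <= m.+1%:R^-1.
  move=> j; have lt1 : theta j ord0 - m.+1%:R^-1 < theta j ord0 + m.+1%:R^-1.
    by rewrite ltrD2l (lt_trans _ m0)// oppr_lt0.
  have [a] := rat_in_itvoo lt1.
  move=> h; exists a; move: h; rewrite in_itv/= => /andP[h1 h2].
  by rewrite ler_distlC lerBlDr !ltW// -ltrBlDr.
have ex : near_c ([ffun j => v j], m) theta.
  split=> //=; apply: mx_norm_le => [|j i]; first exact: ltW.
  by rewrite !mxE ffunE ord1.
exists (pickle ([ffun j => v j], m)); rewrite pickleK.
have [_ /= h1] : near_c ([ffun j => v j], m) (pt0 ([ffun j => v j], m)).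
  rewrite /pt0; case: pselect => [ex'|[]]; first exact: xgetPex.
  by exists theta.
have [_ /= h2] := ex.
rewrite (le_lt_trans _ me)// -[theta](subrK (c [ffun j => v j])) -addrA.
rewrite (le_trans (ler_normD _ _))// mulr2n mulrDl mul1r lerD//.
by rewrite distrC.
Qed.

(** The selection [theta_hat] may fail to be measurable, but by continuity in the parameter the
    minimal value is below [x] exactly when [G] is below [x] at some point of a countable dense
    subset. *)
Lemma measurable_minimum (d : measure_display) (Omega : measurableType d) (q : nat)
    (Theta : set 'cV[R]_q) (theta0 : 'cV[R]_q) (G : Omega -> 'cV[R]_q -> R)
    (theta_hat : Omega -> 'cV[R]_q) :
  Theta theta0 -> (forall theta, Theta theta -> measurable_fun setT (G^~ theta)) ->
  (forall omega theta, Theta theta -> {for theta, continuous (G omega)}) ->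
  (forall omega, is_minimizer Theta (G omega) (theta_hat omega)) ->
  measurable_fun setT (fun omega => G omega (theta_hat omega)).
Proof.
move=> T0 mG cG min; have [pt Tpt dpt] := countable_dense T0.
move=> mT; apply: (measurability _ (RGenInftyO.measurableE R)) => //.
move=> _ [_ [x ->] <-].
rewrite [X in measurable X](_ : _ =
    \bigcup_i (setT `&` (G^~ (pt i)) @^-1` `]-oo, x[%classic)).
  by apply: bigcupT_measurable => i; apply: (mG _ (Tpt i)) => //; exact: measurable_itv.
apply/seteqP; split=> omega /=; rewrite ?in_itv/=.
  move=> [_ h]; have [Th _] := min omega.
  have d0 : 0 < x - G omega (theta_hat omega) by rewrite subr_gt0.
  have /cvgrPdist_lt /(_ _ d0) /nbhs_ballP[e /= e0 he] := cG omega _ Th.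
  have [i hi] := dpt _ _ Th e0; exists i => //; split=> //=; rewrite in_itv/=.
  have := he (pt i); rewrite -ball_normE /ball_/= => /(_ hi).
  by rewrite ltr_norml => /andP[h1 h2]; lra.
move=> [i _ [_ /=]]; rewrite in_itv/= => h; split=> //.
by have [_ /(_ _ (Tpt i)) h2] := min omega; exact: le_lt_trans h.
Qed.

End measurable_minimum.

Section measurable_contrast.
Context {R : realType} {p k r : nat} (kp : (k <= p)%N).
Variables (Theta : set 'cV[R]_(qdim p k)) (theta0 : 'cV[R]_(qdim p k)).
Hypothesis theta0_in : Theta theta0.
Hypothesis Theta_ff : forall theta, Theta theta ->
  exists S : 'M[R]_(k, r), Sigma_ff theta = S *m S^T.
Hypothesis sigma_gt0 : forall theta, Theta theta -> forall i, 0 < sigma theta i.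

Lemma contrast_sum (Q : 'M[R]_p) theta : contrast kp Q theta =
  \sum_j (\sum_i (Q (vech_pos i).1 (vech_pos i).2 - Sigma kp theta (vech_pos i).1 (vech_pos i).2) *
     invmx (Wmx kp theta) i j) *
   (Q (vech_pos j).1 (vech_pos j).2 - Sigma kp theta (vech_pos j).1 (vech_pos j).2).
Proof.
rewrite /contrast; move: (invmx _) => V; rewrite mxE; apply: eq_bigr => j _.
congr (_ * _); last by rewrite !mxE.
by rewrite mxE; apply: eq_bigr => i _; congr (_ * _); rewrite !mxE.
Qed.

Lemma contrast_continuous (Q : 'M[R]_p) theta : Theta theta ->
  {for theta, continuous (contrast kp Q)}.
Proof.
move=> Tt; rewrite (funext (contrast_sum Q)).
have cs (i : 'I_(pbar p)) : (fun t : 'cV[R]_(qdim p k) => Q (vech_pos i).1 (vech_pos i).2 -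
     Sigma kp t (vech_pos i).1 (vech_pos i).2) @ theta --> 
     Q (vech_pos i).1 (vech_pos i).2 - Sigma kp theta (vech_pos i).1 (vech_pos i).2.
  apply: (@cvgB _ _ _ _ (nbhs_filter theta)); first exact: cvg_cst.
  exact: (@Sigma_continuous R p k kp theta).
apply: (cvg_sum_fun (FF := nbhs_filter theta)) => j.
apply: (@cvgM _ _ _ (nbhs_filter theta)); last exact: cs.
apply: (cvg_sum_fun (FF := nbhs_filter theta)) => i.
apply: (@cvgM _ _ _ (nbhs_filter theta)); first exact: cs.
exact: (@invmx_Wmx_continuous R p k r kp Theta Theta_ff sigma_gt0 theta i j Tt).
Qed.

Lemma measurable_contrast_min (d : measure_display) (Omega : measurableType d)
    (Q : Omega -> 'M[R]_p) (theta_hat : Omega -> 'cV[R]_(qdim p k)) :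
  (forall i j, measurable_fun setT (fun omega => Q omega i j)) ->
  (forall omega, is_minimizer Theta (contrast kp (Q omega)) (theta_hat omega)) ->
  measurable_fun setT (fun omega => contrast kp (Q omega) (theta_hat omega)).
Proof.
move=> mQ min; apply: (measurable_minimum theta0_in) min => [theta Tt|omega theta Tt].
  under eq_fun do rewrite contrast_sum.
  have ms (i : 'I_(pbar p)) : measurable_fun setT (fun omega => Q omega (vech_pos i).1 (vech_pos i).2 -
     Sigma kp theta (vech_pos i).1 (vech_pos i).2).
    by apply: measurable_funB => //; exact: mQ.
  apply: measurable_sum_fun => j; apply: measurable_funM; last exact: ms.
  apply: measurable_sum_fun => i; apply: measurable_funM; first exact: ms.
  exact: measurable_cst.
exact: contrast_continuous.
Qed.

End measurable_contrast.

(** * Covariation of the noise *)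

Section form_sum_moments.
Context {R : realType}.

Lemma sum_diagonal_blocks (I L : finType) (F : (I * L) * (I * L) -> R) :
  (forall u, u.1.1 != u.2.1 -> F u = 0) ->
  \sum_u F u = \sum_i \sum_(ab : L * L) F ((i, ab.1), (i, ab.2)).
Proof.
move=> F0; rewrite (eq_bigr (fun u => F (u.1, u.2))); last by case.
rewrite -(pair_bigA _ (fun u v => F (u, v)))/=.
rewrite (eq_bigr (fun u => \sum_v F ((u.1, u.2), v))); last by case.
rewrite -(pair_bigA _ (fun i a => \sum_v F ((i, a), v)))/=.
apply: eq_bigr => i _; rewrite -(pair_bigA _ (fun a b => F ((i, a), (i, b))))/=.
apply: eq_bigr => a _; rewrite (eq_bigr (fun v => F ((i, a), (v.1, v.2)))); last by case.
rewrite -(pair_bigA _ (fun j b => F ((i, a), (j, b))))/= (bigD1 i)//= [X in _ + X]big1 ?addr0//.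
by move=> j ji; apply: big1 => b _; apply: F0; rewrite eq_sym.
Qed.

Context {d : measure_display} {Omega : measurableType d} {P : probability Omega R} {T : R}.
Hypothesis T0 : 0 < T.
Context {L : finType} {Y : L -> R -> Omega -> R}.
Hypothesis wY : forall l, wiener P T (Y l).
Hypothesis iY : independent_families P (fun l => history (Y l) T).

(** A block-diagonal matrix over the whole grid: the sum over time steps becomes a single centred
    form, to which the moment formulas apply directly. *)
Let block_form n (H : L -> L -> R) (u v : 'I_n * L) :=
  (u.1 == v.1)%:R * ((Num.sqrt n%:R)^-1 * H u.2 v.2).

Lemma form_sum_centered_form n (H : L -> L -> R) w :
  form_sum T Y n H w = centered_form (@grid_increment R d Omega T L Y n)
    (Num.sqrt (T / n%:R)) id (@block_form n H) w.
Proof.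
rewrite /centered_form sum_diagonal_blocks => [|u uu]; last first.
  by rewrite /block_form (negbTE uu) !mul0r.
apply: eq_bigr => i _; rewrite /centered_form mulr_sumr; apply: eq_bigr => ab _.
by rewrite /block_form/= eqxx mul1r xpair_eqE eqxx mulrA.
Qed.

Lemma form_sum_has_moments n (H : L -> L -> R) : (0 < n)%N ->
  has_moments P (form_sum T Y n H).
Proof.
move=> n0; rewrite (funext (form_sum_centered_form n H)).
apply: centered_form_has_moments; last exact: gaussian_grid_increment.
by rewrite gt_eqF// sqrtr_gt0 divr_gt0// ltr0n.
Qed.

Lemma expectation_form_sum_sqr n (H : L -> L -> R) : (0 < n)%N ->
  (forall a b, H a b = H b a) ->
  \int[P]_w form_sum T Y n H w ^+ 2 = 2 * \sum_ab H ab.1 ab.2 ^+ 2.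
Proof.
move=> n0 sH; rewrite (funext (form_sum_centered_form n H)).
have nR : 0 < n%:R :> R by rewrite ltr0n.
rewrite (expectation_centered_form_sqr (P := P)) => //.
- rewrite sum_diagonal_blocks => [|u uu]; last by rewrite /block_form (negbTE uu) mul0r expr0n.
  congr (_ * _); rewrite (eq_bigr (fun=> n%:R^-1 * \sum_ab H ab.1 ab.2 ^+ 2)) => [|i _].
    by rewrite sumr_const card_ord -[LHS]mulr_natr mulrAC mulVf ?mul1r// lt0r_neq0.
  rewrite mulr_sumr; apply: eq_bigr => ab _.
  by rewrite /block_form/= eqxx mul1r exprMn exprVn sqr_sqrtr// ltW.
- by rewrite gt_eqF// sqrtr_gt0 divr_gt0.
- exact: gaussian_grid_increment.
- exact: grid_increment_independent.
- by move=> u v; rewrite /block_form eq_sym sH.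
Qed.

End form_sum_moments.

Section noise_covariation.
Context {R : realType} {d : measure_display} {Omega : measurableType d} {T : R}.
Context {m1 m2 : nat} {Y : 'I_m1 + 'I_m2 -> R -> Omega -> R}.
Hypothesis T0 : 0 < T.

Definition noise_increment (n i : nat) (w : Omega) : 'cV[R]_(m1 + m2) :=
  \col_c path_increment T n (fun t => Y (fintype.split c) t w) i.

Definition noise_covariation (n : nat) (w : Omega) : 'M[R]_(m1 + m2) :=
  T^-1 *: \sum_(i < n) noise_increment n i w *m (noise_increment n i w)^T.

Lemma noise_covariation_congr (p n : nat) (N : 'M[R]_(p, m1 + m2)) w :
  N *m noise_covariation n w *m N^T =
  T^-1 *: \sum_(i < n) (N *m noise_increment n i w) *m (N *m noise_increment n i w)^T.
Proof.
rewrite /noise_covariation -scalemxAr -scalemxAl mulmx_sumr mulmx_suml; congr (_ *: _).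
by apply: eq_bigr => i _; rewrite trmx_mul !mulmxA.
Qed.

(** Standardizing divides a product of two increments by $T/n$, so the sum over steps is [n] times
    the covariation and the prefactor $n^{-1/2}$ becomes $\sqrt n$. *)
Lemma form_sum_covariation n (A : 'M[R]_(m1 + m2)) w : (0 < n)%N ->
  form_sum T Y n (fun a b => A (unsplit a) (unsplit b)) w =
  Num.sqrt n%:R * \sum_c \sum_c' A c c' * (noise_covariation n w - 1%:M) c c'.
Proof.
move=> n0; have nR : 0 < n%:R :> R by rewrite ltr0n.
have s0 : 0 < Num.sqrt n%:R :> R by rewrite sqrtr_gt0.
have bs : {on predT, bijective (@fintype.split m1 m2)}.
  by apply: onW_bij; exists unsplit; [exact: splitK|exact: unsplitK].
have nE : n%:R = Num.sqrt n%:R ^+ 2 :> R by rewrite sqr_sqrtr// ltW.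
pose y i c := noise_increment n i w c ord0.
rewrite /form_sum (eq_bigr (fun i : 'I_n => \sum_c \sum_c' A c c' *
    ((Num.sqrt n%:R)^-1 * (y i c * y i c' * (n%:R / T) - (c == c')%:R)))); last first.
  move=> i _; rewrite /centered_form -(pair_bigA _ (fun a b => A (unsplit a) (unsplit b) *
    (standardized _ _ (i, a) w * standardized _ _ (i, b) w - (a == b)%:R)))/=.
  rewrite (reindex (@fintype.split m1 m2))//= mulr_sumr; apply: eq_bigr => c _.
  rewrite (reindex (@fintype.split m1 m2))//= mulr_sumr; apply: eq_bigr => c' _.
  rewrite !splitK (can_eq splitK) mulrCA; congr (_ * (_ * (_ - _))).
  rewrite /standardized /grid_increment/= /y !mxE mulrACA -invfM -expr2 sqr_sqrtr ?invf_div//.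
  by rewrite divr_ge0 ?(ltW T0)// ler0n.
rewrite exchange_big mulr_sumr; apply: eq_bigr => c _.
rewrite exchange_big mulr_sumr; apply: eq_bigr => c' _.
rewrite -mulr_sumr mulrCA; congr (_ * _); rewrite -mulr_sumr !mxE summxE.
rewrite sumrB sumr_const card_ord -mulr_suml.
rewrite [X in _ = _ * (_ * X - _)](eq_bigr (fun i : 'I_n => y i c * y i c')) => [|i _]; last first.
  by rewrite mxE big_ord1 /y; congr (_ * _); rewrite [LHS]mxE.
move: (\sum_(i < n) _) => S; rewrite -[(c == c')%:R *+ n]mulr_natr.
move: (Num.sqrt n%:R) s0 nE => s s0 ->.
by move: ((c == c')%:R) => dl; field; rewrite !gt_eqF.
Qed.

(** Cyclicity of the trace, $\operatorname{tr}(C\,NZN^\top)=\operatorname{tr}(N^\top CN\,Z)$: linear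
    functionals of the half-vectorization are quadratic forms in the increments. *)
Lemma vech_covariation_form_sum (p n : nat) (N : 'M[R]_(p, m1 + m2)) (c : 'cV[R]_(pbar p)) w :
  (0 < n)%N ->
  (c^T *m (Num.sqrt n%:R *: (vech (N *m noise_covariation n w *m N^T) - vech (N *m N^T)))) ord0 ord0 =
  form_sum T Y n (fun a b => (N^T *m vech_dual c *m N) (unsplit a) (unsplit b)) w.
Proof.
move=> n0; rewrite form_sum_covariation//.
set Z := noise_covariation n w.
have sZ : Z^T = Z.
  rewrite /Z /noise_covariation linearZ/=; congr (_ *: _); rewrite linear_sum/=.
  by apply: eq_bigr => i _; rewrite trmx_mul trmxK.
have frob (m : nat) (A B : 'M[R]_m) : \sum_i \sum_j A i j * B i j = \tr (A^T *m B).
  rewrite exchange_big/=; apply: eq_bigr => j _; rewrite mxE.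
  by apply: eq_bigr => i _; rewrite mxE.
have mB (A B : 'M[R]_1) : (A - B) ord0 ord0 = A ord0 ord0 - B ord0 ord0 by rewrite !mxE.
rewrite -scalemxAr [LHS]mxE; congr (_ * _); rewrite mulmxBr mB.
rewrite !vech_dualP; last 2 first.
  by rewrite trmx_mul trmxK.
  by rewrite !trmx_mul trmxK sZ mulmxA.
rewrite !frob !trmx_mul trmxK vech_dual_sym.
rewrite mulmxBr mulmx1 raddfB/=; congr (_ - _).
  by rewrite !mulmxA [LHS]mxtrace_mulC !mulmxA.
by rewrite !mulmxA [LHS]mxtrace_mulC !mulmxA.
Qed.

End noise_covariation.

Lemma scaled_vech_subE (R : realType) (p : nat) (c : R) (A B : 'M[R]_p) l :
  (c *: (vech A - vech B)) l ord0 =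
  c * (A (vech_pos l).1 (vech_pos l).2 - B (vech_pos l).1 (vech_pos l).2).
Proof. by rewrite !mxE. Qed.

(** * Effect of the drift on the realized covariation *)

Section covariation_perturbation.
Context {R : realType} (T : R) (p m : nat) (N : 'M[R]_(p, m)).
Variables (Y : 'I_m -> R -> R) (phi : 'I_p -> R -> R) (X : R -> 'cV[R]_p) (x0 : 'cV[R]_p).
Hypothesis T0 : 0 < T.
Hypothesis cY : forall c, {within `[0, T], continuous (Y c)}.
Hypothesis cphi : forall a, {within `[0, T], continuous (phi a)}.
Hypothesis XE : forall t a, 0 <= t <= T ->
  X t a ord0 = x0 a ord0 + \sum_c N a c * Y c t + primitive (phi a) t.

Let g a t := \sum_c N a c * Y c t.
Let y n i : 'cV[R]_m := \col_c path_increment T n (Y c) i.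
Let Qt n := T^-1 *: \sum_(i < n) (N *m y n i) *m (N *m y n i)^T.
Let Q n := T^-1 *: \sum_(i < n)
  (X (i.+1%:R * (T / n%:R)) - X (i%:R * (T / n%:R))) *m
  (X (i.+1%:R * (T / n%:R)) - X (i%:R * (T / n%:R)))^T.

(** Increments split into noise and drift, which leaves two cross sums and one drift sum. The cross
    sums are bounded through the quadratic variation of the noise, itself at most a constant plus a
    multiple of the deviation from [S]: this is the source of the factor $1+|a_n|$. *)
Lemma covariation_perturbation (S : 'M[R]_p) (e : R) : 0 < e -> \forall n \near \oo,
  `|Num.sqrt n%:R *: (vech (Q n) - vech (Qt n))| <=
  e * (1 + `|Num.sqrt n%:R *: (vech (Qt n) - vech S)|).
Proof.
move=> e0.
have cg a : {within `[0, T], continuous (g a)}.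
  move=> t; apply: cvg_sum_fun => c; apply: cvgM; first exact: cvg_cst.
  exact: cY.
have prim0 a : primitive (phi a) 0 = 0 by rewrite /primitive set_itv1 Rintegral_set1.
have DE a t : 0 <= t <= T -> primitive (phi a) t = primitive (phi a) 0 + primitive (phi a) t.
  by rewrite prim0 add0r.
have gE n a (i : nat) : (N *m y n i) a ord0 = path_increment T n (g a) i.
  rewrite mxE /path_increment /g -sumrB; apply: eq_bigr => c _.
  by rewrite mxE -mulrBr /path_increment.
pose K := `|S|; pose C := 1 + T * K + T.
have C1 : 1 <= C by rewrite /C -addrA lerDl addr_ge0 ?mulr_ge0 ?(ltW T0)// normr_ge0.
have C0 : 0 < C by rewrite (lt_le_trans _ C1).
(* The $3$ accounts for the three sums, [C] for the bound on the quadratic variation and [T] for the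
   normalization of the covariation. *)
pose e' := e * T / (3 * C).
have e'0 : 0 < e' by rewrite divr_gt0 ?mulr_gt0.
have h1 (ab : 'I_p * 'I_p) : \forall n \near \oo, Num.sqrt n%:R *
    `|\sum_(i < n) path_increment T n (g ab.1) i * path_increment T n (primitive (phi ab.2)) i| <=
    e' * (1 + \sum_(i < n) path_increment T n (g ab.1) i ^+ 2).
  by apply: (@cross_variation _ _ _ (phi ab.2)) => //; exact: DE.
have {}h1 := filter_forall _ h1.
have h2 (ab : 'I_p * 'I_p) : \forall n \near \oo, Num.sqrt n%:R *
    `|\sum_(i < n) path_increment T n (primitive (phi ab.1)) i * path_increment T n (primitive (phi ab.2)) i| <= e'.
  by apply: (@drift_variation _ _ (phi ab.1) (phi ab.2)) => //; exact: DE.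
have {}h2 := filter_forall _ h2.
near=> n.
have n0 : (0 < n)%N by near: n; exact: nbhs_infty_gt.
have g1 : forall ab : 'I_p * 'I_p, Num.sqrt n%:R *
    `|\sum_(i < n) path_increment T n (g ab.1) i * path_increment T n (primitive (phi ab.2)) i| <=
    e' * (1 + \sum_(i < n) path_increment T n (g ab.1) i ^+ 2) by near: n; exact: h1.
have g2 : forall ab : 'I_p * 'I_p, Num.sqrt n%:R *
    `|\sum_(i < n) path_increment T n (primitive (phi ab.1)) i * path_increment T n (primitive (phi ab.2)) i| <= e'.
  by near: n; exact: h2.
have nR : 0 < n%:R :> R by rewrite ltr0n.
have s1 : 1 <= Num.sqrt n%:R :> R by rewrite -[leLHS]sqrtr1 ler_wsqrtr// ler1n.
have s0 : 0 < Num.sqrt n%:R :> R by rewrite (lt_le_trans _ s1).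
set A := `|Num.sqrt n%:R *: (vech (Qt n) - vech S)|.
have A0 : 0 <= A by exact: normr_ge0.
have QtE a b : Qt n a b = T^-1 * \sum_(i < n) path_increment T n (g a) i * path_increment T n (g b) i.
  rewrite mxE summxE; congr (_ * _); apply: eq_bigr => i _.
  by rewrite mxE big_ord1 [(_^T) _ _]mxE !gE.
have tin i : (i <= n)%N -> 0 <= i%:R * (T / n%:R) <= T.
  move=> le_in; rewrite mulr_ge0 ?ler0n ?divr_ge0 ?ler0n ?(ltW T0)//= mulrA ler_pdivrMr//.
  by rewrite mulrC ler_wpM2l ?(ltW T0)// ler_nat.
have XI a (i : 'I_n) : (X (i.+1%:R * (T / n%:R)) - X (i%:R * (T / n%:R))) a ord0 =
    path_increment T n (g a) i + path_increment T n (primitive (phi a)) i.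
  rewrite !mxE (XE _ (tin _ (ltn_ord i))) (XE _ (tin _ (ltnW (ltn_ord i)))).
  by rewrite /path_increment /g; ring.
have QE a b : Q n a b - Qt n a b = T^-1 * (
    \sum_(i < n) path_increment T n (g a) i * path_increment T n (primitive (phi b)) i +
    \sum_(i < n) path_increment T n (g b) i * path_increment T n (primitive (phi a)) i +
    \sum_(i < n) path_increment T n (primitive (phi a)) i * path_increment T n (primitive (phi b)) i).
  rewrite QtE mxE summxE -mulrBr; congr (_ * _); rewrite -sumrB -!big_split/=.
  apply: eq_bigr => i _; rewrite mxE big_ord1 [(_^T) _ _]mxE !XI; ring.
(* The quadratic variation of [g a] is $T$ times a diagonal entry of [Qt n], which is within
   $A/\sqrt n\le A$ of the entry of [S]. *)
have gA a : 1 + \sum_(i < n) path_increment T n (g a) i ^+ 2 <= C * (1 + A).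
  have -> : \sum_(i < n) path_increment T n (g a) i ^+ 2 = T * Qt n a a.
    by rewrite QtE mulrA mulfV ?lt0r_neq0// mul1r; apply: eq_bigr => i _; rewrite expr2.
  have [l lE] := vech_pos_surj (leqnn a).
  have : `|Qt n a a - S a a| <= A.
    have := mx_entry_le (Num.sqrt n%:R *: (vech (Qt n) - vech S)) l ord0.
    rewrite -/A scaled_vech_subE lE/= normrM gtr0_norm//.
    by apply: le_trans; rewrite ler_peMl.
  have := mx_entry_le S a a; rewrite -/K !ler_norml => /andP[_ k1] /andP[_ k2].
  have : T * Qt n a a <= T * (K + A) by rewrite ler_wpM2l ?(ltW T0)//; lra.
  have K0 : 0 <= K by exact: normr_ge0.
  have : 0 <= T * K * A by rewrite !mulr_ge0 ?(ltW T0).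
  move=> TKA TQ; rewrite (le_trans (lerD (lexx 1) TQ))//.
  have -> : C * (1 + A) = 1 + T * (K + A) + (T + A + T * K * A) by rewrite /C; ring.
  by rewrite lerDl !addr_ge0// ltW.
apply: mx_norm_le => [|l j]; first by rewrite mulr_ge0 ?(ltW e0)// addr_ge0.
rewrite ord1 scaled_vech_subE QE.
move: (vech_pos l) => [a b] /=.
set S1 := \sum_i _; set S2 := \sum_i _; set S3 := \sum_i _.
have b1 : Num.sqrt n%:R * `|S1| <= e' * (C * (1 + A)).
  by rewrite (le_trans (g1 (a, b)))// ler_wpM2l ?(ltW e'0).
have b2 : Num.sqrt n%:R * `|S2| <= e' * (C * (1 + A)).
  by rewrite (le_trans (g1 (b, a)))// ler_wpM2l ?(ltW e'0).
have b3 : Num.sqrt n%:R * `|S3| <= e' * (C * (1 + A)).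
  rewrite (le_trans (g2 (a, b)))// ler_peMr ?(ltW e'0)//.
  by rewrite (le_trans C1)// ler_peMr ?(ltW C0)// lerDl.
have -> : e * (1 + A) = T^-1 * (3 * (e' * (C * (1 + A)))).
  by rewrite /e'; field; rewrite !gt_eqF.
rewrite mulrCA normrM gtr0_norm ?invr_gt0// ler_wpM2l ?invr_ge0 ?(ltW T0)//.
rewrite normrM gtr0_norm//.
have := ler_normD (S1 + S2) S3; have := ler_normD S1 S2 => n1 n2.
have : Num.sqrt n%:R * `|S1 + S2 + S3| <= Num.sqrt n%:R * (`|S1| + `|S2| + `|S3|).
  by rewrite ler_wpM2l ?(ltW s0)//; lra.
rewrite !mulrDr; lra.
Unshelve. all: by end_near. Qed.

End covariation_perturbation.

(** * The scaled minimal contrast along one path *)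

Section min_contrast_rate.
Context {R : realType} {N m : nat} (M : 'M[R]_(m, N)).
Variables (x a : nat -> 'cV[R]_N) (t : nat -> R).

Let q (y : 'cV[R]_N) := ((M *m y)^T *m (M *m y)) ord0 ord0.

Hypothesis t_expansion : forall e, 0 < e -> exists2 dl, 0 < dl &
  forall n, (0 < n)%N -> `|x n| < dl -> `|t n - q (x n)| <= e * `|x n| ^+ 2.
Hypothesis x_near : forall e, 0 < e -> \forall n \near \oo,
  `|Num.sqrt n%:R *: x n - a n| <= e * (1 + `|a n|).

(** The expansion is available for $|x_n|<dl$. Otherwise $n\,dl^2\le|\sqrt n\,x_n|^2\le8(1+a_n^\top
    a_n)$, so the denominator is large and the cap at $1$ suffices. *)
Lemma min_contrast_rate :
  (fun n => Num.min 1 `|n%:R * t n - q (a n)| / (1 + ((a n)^T *m a n) ord0 ord0)) @ \oo -->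
  (0 : R).
Proof.
pose A := M^T *m M; pose KA := mx_sum A.
have KA0 : 0 <= KA by exact: mx_sum_ge0.
have qE y : q y = (y^T *m A *m y) ord0 ord0 by rewrite /q trmx_mul !mulmxA.
apply/cvgrPdist_le => e e0.
(* Two halves of $e$: $e/16$ times the $8$ in $|y|^2\le8(1+B)$, and, through [e2], $e/12$ times the
   $6$ in $(1+b)(1+3b)\le6(1+B)$. *)
pose e1 := e / 16; have e10 : 0 < e1 by rewrite divr_gt0.
pose e2 := Num.min 1 (e / (12 * (KA + 1))).
have e20 : 0 < e2 by rewrite lt_min ltr01 divr_gt0// mulr_gt0// ltr_wpDl.
have e21 : e2 <= 1 by rewrite ge_min lexx.
have e2e : KA * e2 <= e / 12.
  have : e2 <= e / (12 * (KA + 1)) by rewrite ge_min lexx orbT.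
  rewrite ler_pdivlMr ?mulr_gt0 ?ltr_wpDl// => h.
  have : 0 <= e2 by exact: ltW.
  by nra.
have [dl dl0 hdl] := t_expansion e10.
near=> n.
have n0 : (0 < n)%N by near: n; exact: nbhs_infty_gt.
have nR : 0 < n%:R :> R by rewrite ltr0n.
have hx : `|Num.sqrt n%:R *: x n - a n| <= e2 * (1 + `|a n|) by near: n; exact: x_near.
have hn : 8 / dl ^+ 2 / e <= n%:R by near: n; exact: nbhs_infty_ger.
have s0 : 0 < Num.sqrt n%:R :> R by rewrite sqrtr_gt0.
pose b := `|a n|; pose B := ((a n)^T *m a n) ord0 ord0.
have b0 : 0 <= b by exact: normr_ge0.
have bB : b ^+ 2 <= B by exact: norm_sqr_le.
have B0 : 0 < 1 + B by rewrite ltr_pwDl// (le_trans _ bB)// sqr_ge0.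
pose y := Num.sqrt n%:R *: x n; pose dlt := y - a n.
have hd : `|dlt| <= e2 * (1 + b) by [].
have hd1 : `|dlt| <= 1 + b by rewrite (le_trans hd)// ler_piMl// addr_ge0.
have yb : `|y| <= 1 + 2 * b.
  have -> : y = dlt + a n by rewrite /dlt subrK.
  by rewrite (le_trans (ler_normD _ _))//; rewrite -/b; lra.
have bb := sqr_ge0 (b - 1).
have y2 : `|y| ^+ 2 <= 8 * (1 + B).
  have : `|y| ^+ 2 <= (1 + 2 * b) ^+ 2 by rewrite lerXn2r ?nnegrE// addr_ge0// mulr_ge0.
  by nra.
have yE : `|y| = Num.sqrt n%:R * `|x n| by rewrite normrZ gtr0_norm.
rewrite sub0r normrN ger0_norm; last by rewrite divr_ge0 ?(ltW B0)// le_min ler01 normr_ge0.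
rewrite ler_pdivrMr// -/B.
have [xd|xd] := ltP `|x n| dl; last first.
  apply: (@le_trans _ _ 1); first by rewrite ge_min lexx.
  have : n%:R * dl ^+ 2 <= `|y| ^+ 2.
    rewrite yE exprMn sqr_sqrtr ?(ltW nR)// ler_wpM2l ?(ltW nR)//.
    by rewrite lerXn2r ?nnegrE// ltW.
  move: hn; rewrite ler_pdivrMr// ler_pdivrMr ?exprn_gt0// => hn h.
  have : 8 <= 8 * (1 + B) * e.
    rewrite (le_trans hn)// mulrAC ler_wpM2r ?(ltW e0)//; exact: le_trans h y2.
  lra.
apply: (@le_trans _ _ `|n%:R * t n - q (a n)|); first by rewrite ge_min lexx orbT.
have nq : n%:R * q (x n) = q y.
  rewrite /q !mulmx_sqrE /y -scalemxAr mulr_sumr; apply: eq_bigr => i _.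
  by rewrite [in RHS]mxE exprMn sqr_sqrtr// ltW.
have h1 : `|n%:R * t n - q y| <= e1 * `|y| ^+ 2.
  rewrite -nq -mulrBr normrM gtr0_norm// yE exprMn sqr_sqrtr ?(ltW nR)// mulrCA.
  by rewrite ler_wpM2l ?(ltW nR)// hdl.
have h2 : `|q y - q (a n)| <= KA * (`|dlt| * (2 * b + `|dlt|)).
  have ya : y = a n - (- dlt) by rewrite opprK /dlt addrC subrK.
  rewrite !qE {1 2}ya form_sub_expand.
  have f1 := norm_form_le A (- dlt) (- dlt); have f2 := norm_form_le A (a n) (- dlt).
  have f3 := norm_form_le A (- dlt) (a n); rewrite !normrN in f1 f2 f3.
  rewrite (le_trans (ler_normB _ _))// (le_trans (lerD (ler_normB _ _) (lexx _)))//.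
  rewrite (le_trans (lerD (lerD f1 f2) f3))// -/KA -/b.
  by rewrite le_eqVlt; apply/orP; left; apply/eqP; ring.
have h3 : KA * (`|dlt| * (2 * b + `|dlt|)) <= KA * ((e2 * (1 + b)) * (1 + 3 * b)).
  by rewrite ler_wpM2l// ler_pM ?addr_ge0 ?mulr_ge0//; lra.
have h4 : KA * e2 * ((1 + b) * (1 + 3 * b)) <= e / 12 * ((1 + b) * (1 + 3 * b)).
  by rewrite ler_wpM2r// mulr_ge0// addr_ge0// mulr_ge0.
have h5 : (1 + b) * (1 + 3 * b) <= 6 * (1 + B) by nra.
have h6 : e / 12 * ((1 + b) * (1 + 3 * b)) <= e / 12 * (6 * (1 + B)).
  by rewrite ler_wpM2l// divr_ge0// ltW.
have h7 : e1 * `|y| ^+ 2 <= e / 2 * (1 + B).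
  have -> : e / 2 * (1 + B) = e1 * (8 * (1 + B)) by rewrite /e1; field.
  by rewrite ler_wpM2l// ltW.
have h8 : `|n%:R * t n - q (a n)| <= `|n%:R * t n - q y| + `|q y - q (a n)|.
  by rewrite (le_trans _ (ler_normD _ _))// addrA subrK.
lra.
Unshelve. all: by end_near. Qed.

End min_contrast_rate.

(** * From almost sure relative smallness to Laplace transforms *)

Section laplace_perturbation.
Context {R : realType} {d : measure_display} {Omega : measurableType d} (P : probability Omega R).
Variables (S q B : nat -> Omega -> R) (C : R).
Hypothesis mS : forall n, measurable_fun setT (S n).
Hypothesis mq : forall n, measurable_fun setT (q n).
Hypothesis mB : forall n, measurable_fun setT (B n).
Hypothesis S_ge0 : forall n w, 0 <= S n w.
Hypothesis q_ge0 : forall n w, 0 <= q n w.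
Hypothesis B_ge0 : forall n w, 0 <= B n w.
Hypothesis B_integrable : forall n, (0 < n)%N -> P.-integrable setT (fun w => (B n w)%:E).
Hypothesis B_bounded : forall n, (0 < n)%N -> \int[P]_w B n w <= C.
Hypothesis near_zero : {ae P, forall w,
  (fun n => Num.min 1 `|S n w - q n w| / (1 + B n w)) @ \oo --> (0 : R)}.

Let rho n w := Num.min 1 `|S n w - q n w|.

Let mrho n : measurable_fun setT (rho n).
Proof.
apply: measurable_minr; first exact: measurable_cst.
by apply: measurableT_comp => //; exact: measurable_funB.
Qed.

Let rho_ge0 n w : 0 <= rho n w.
Proof. by rewrite le_min ler01 normr_ge0. Qed.

Let rho_le1 n w : rho n w <= 1.
Proof. by rewrite ge_min lexx. Qed.

Let B1 n w : 0 < 1 + B n w.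
Proof. by rewrite ltr_pwDl. Qed.

Let irho n : P.-integrable setT (fun w => (rho n w)%:E).
Proof. by apply: (@bounded_integrable _ _ _ P _ 1) => // w; rewrite ger0_norm. Qed.

(** Where $1+B\le K$ the gap is at most $K$ times the ratio [Z], and elsewhere at most
    $1\le(1+B)/K$. Bounded convergence handles the first term, the bound [C] on $\mathbb E B$ the
    second. *)
Lemma expectation_truncated_gap : \int[P]_w rho n w @[n --> \oo] --> (0 : R).
Proof.
pose Z n w := rho n w / (1 + B n w).
have mZ n : measurable_fun setT (Z n).
  apply: measurable_funM; first exact: mrho.
  apply: (measurable_comp (F := [set x : R | x != 0])).
  - by apply: open_measurable; exact: open_neq.
  - by move=> _ [w _ <-] /=; rewrite gt_eqF.
  - apply: open_continuous_measurable_fun; first exact: open_neq.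
    by move=> x x0; apply: inv_continuous; rewrite inE in x0.
  - by apply: measurable_funD => //; exact: measurable_cst.
have Z_ge0 n w : 0 <= Z n w by rewrite divr_ge0// ltW.
have Z_le1 n w : Z n w <= 1.
  by rewrite ler_pdivrMr// mul1r (le_trans (rho_le1 n w))// lerDl.
have Zn1 n w : `|Z n w| <= 1 by rewrite ger0_norm.
have EZ : \int[P]_w Z n w @[n --> \oo] --> (0 : R).
  have := @bounded_convergence_ae _ _ _ P Z (cst 0) 1 mZ (measurable_cst _) near_zero Zn1.
  by rewrite /Rintegral/= integral0.
apply/cvgrPdist_le => e e0.
have C1 : 0 < 1 + `|C| by rewrite ltr_pwDl.
pose K := 2 * (1 + `|C|) / e; have K0 : 0 < K by rewrite divr_gt0// mulr_gt0.
have eK : 0 < e / 2 / K by rewrite !divr_gt0.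
near=> n.
have n0 : (0 < n)%N by near: n; exact: nbhs_infty_gt.
have hZ : `|0 - \int[P]_w Z n w| <= e / 2 / K.
  by near: n; have /cvgrPdist_le /(_ _ eK) := EZ.
have iZ : P.-integrable setT (fun w => (Z n w)%:E) by exact: (@bounded_integrable _ _ _ P _ 1).
have iB := B_integrable n0.
have i1 : P.-integrable setT (fun w => (1 : R)%:E).
  by apply: (@bounded_integrable _ _ _ P (cst 1) 1) => // w; rewrite normr1.
have iKZ : P.-integrable setT (fun w => (K * Z n w)%:E).
  by under eq_fun do rewrite EFinM; exact: integrableZl.
have i1B : P.-integrable setT (fun w => (1 + B n w)%:E).
  by under eq_fun do rewrite EFinD; exact: integrableD.
have iKB : P.-integrable setT (fun w => (K^-1 * (1 + B n w))%:E).
  by under eq_fun do rewrite EFinM; exact: integrableZl.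
have iS : P.-integrable setT (fun w => (K * Z n w + K^-1 * (1 + B n w))%:E).
  by under eq_fun do rewrite EFinD; exact: integrableD.
have le1 : \int[P]_w rho n w <= \int[P]_w (K * Z n w + K^-1 * (1 + B n w)).
  apply: le_Rintegral => [//| | |w _ /=]; [exact: irho|exact: iS|].
  have [bK|Kb] := leP (1 + B n w) K.
    rewrite (@le_trans _ _ (K * Z n w))//; last first.
      by rewrite lerDl mulr_ge0 ?invr_ge0 ?(ltW K0)// ltW.
    have -> : rho n w = (1 + B n w) * Z n w by rewrite /Z mulrC divfK// gt_eqF.
    by rewrite ler_wpM2r.
  rewrite (le_trans (rho_le1 n w))// (@le_trans _ _ (K^-1 * (1 + B n w)))//.
    by rewrite mulrC ler_pdivlMr// mul1r ltW.
  by rewrite lerDr mulr_ge0// ltW.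
have E1 : \int[P]_w (K * Z n w + K^-1 * (1 + B n w)) =
    K * \int[P]_w Z n w + K^-1 * (1 + \int[P]_w B n w).
  rewrite RintegralD// RintegralZl// RintegralZl// RintegralD//.
  by rewrite (@expectation_cst _ _ _ P 1).
have r0 : 0 <= \int[P]_w rho n w by apply: Rintegral_ge0 => w _; exact: rho_ge0.
rewrite sub0r normrN ger0_norm// (le_trans le1)// E1.
have z1 : K * \int[P]_w Z n w <= e / 2.
  move: hZ; rewrite sub0r normrN => hZ.
  by rewrite mulrC -ler_pdivlMr// (le_trans (ler_norm _)).
have b1 : K^-1 * (1 + \int[P]_w B n w) <= e / 2.
  apply: (@le_trans _ _ (K^-1 * (1 + `|C|))).
    by rewrite ler_wpM2l ?invr_ge0 ?(ltW K0)// lerD2l (le_trans (B_bounded n0))// ler_norm.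
  have -> // : K^-1 * (1 + `|C|) = e / 2.
  by rewrite /K; move: (1 + `|C|) C1 => z z0; field; rewrite !gt_eqF.
by rewrite [leRHS]splitr lerD.
Unshelve. all: by end_near. Qed.

(** For nonnegative arguments $|e^{-lS}-e^{-lq}|\le\min(1,l|S-q|)\le(1+l)\min(1,|S-q|)$. *)
Lemma laplace_perturbation (l c : R) : 0 <= l ->
  \int[P]_w expR (- (l * q n w)) @[n --> \oo] --> c ->
  \int[P]_w expR (- (l * S n w)) @[n --> \oo] --> c.
Proof.
move=> l0 hq.
have bnd (F : nat -> Omega -> R) n : (forall w, 0 <= F n w) -> measurable_fun setT (F n) ->
    P.-integrable setT (fun w => (expR (- (l * F n w)))%:E).
  move=> F0 mF; apply: (@bounded_integrable _ _ _ P _ 1) => [|w].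
    apply: measurableT_comp => //; apply: measurableT_comp => //.
    by apply: measurable_funM => //; exact: measurable_cst.
  by rewrite ger0_norm ?expR_ge0// -[leRHS]expR0 ler_expR oppr_le0 mulr_ge0.
have [iS iq] : (forall n, P.-integrable setT (fun w => (expR (- (l * S n w)))%:E)) /\
    (forall n, P.-integrable setT (fun w => (expR (- (l * q n w)))%:E)).
  by split=> n; apply: bnd.
have gap n : `|\int[P]_w expR (- (l * S n w)) - \int[P]_w expR (- (l * q n w))| <=
    (1 + l) * \int[P]_w rho n w.
  rewrite -RintegralB; [|by []|exact: iS|exact: iq].
  have id : P.-integrable setT (fun w => (expR (- (l * S n w)) - expR (- (l * q n w)))%:E).
    by under eq_fun do rewrite EFinB; exact: integrableB.
  rewrite (le_trans (le_normr_Rintegral _ id))// -RintegralZl; [|by []|exact: irho].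
  apply: le_Rintegral => [//| | |].
  - by apply: eq_integrable (integrable_norm id).
  - by apply: eq_integrable (integrableZl measurableT (1 + l) (irho n)).
  move=> w _; rewrite /rho.
  have d1 : `|expR (- (l * S n w)) - expR (- (l * q n w))| <= l * `|S n w - q n w|.
    by rewrite (le_trans (expRN_lipschitz _ _)) ?mulr_ge0// -mulrBr normrM ger0_norm.
  have d2 : `|expR (- (l * S n w)) - expR (- (l * q n w))| <= 1.
    have ex (z : R) : 0 <= z -> 0 <= expR (- (l * z)) <= 1.
      by move=> z0; rewrite expR_ge0/= -[leRHS]expR0 ler_expR oppr_le0 mulr_ge0.
    have /andP[? ?] := ex _ (S_ge0 n w); have /andP[? ?] := ex _ (q_ge0 n w).
    by rewrite ler_norml; apply/andP; split; lra.
  have g0 : 0 <= `|S n w - q n w| by [].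
  by have [h|h] := leP 1 `|S n w - q n w|; rewrite mulrDl mul1r; [lra|lra].
pose u n := \int[P]_w expR (- (l * S n w)); pose v n := \int[P]_w expR (- (l * q n w)).
have g0 i : cst 0 i <= `|u i - v i| <= (1 + l) * \int[P]_w rho i w by rewrite normr_ge0/=; exact: gap.
have uv0 : (fun n => u n - v n) @ \oo --> (0 : R).
  apply/norm_cvg0P; apply: (@squeeze_cvgr _ _ _ _ (cst 0) (fun n => (1 + l) * \int[P]_w rho n w)).
  - exact: nearW g0.
  - exact: cvg_cst.
  - by rewrite -[X in _ --> X](mulr0 (1 + l)); apply: cvgM; [exact: cvg_cst|exact: expectation_truncated_gap].
have uE : u = (fun n => v n + (u n - v n)) by apply/funext => n; rewrite addrC subrK.
have vu : (fun n => v n + (u n - v n)) @ \oo --> c by rewrite -[c]addr0; exact: cvgD.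
by rewrite -uE in vu.
Qed.

End laplace_perturbation.

(** * The factor model *)

Section factor_path.
Context {R : realType} {p k r : nat} (kp : (k <= p)%N) (T : R).
Variables (theta : 'cV[R]_(qdim p k)) (S : 'M[R]_(k, r)).
Variables (b : 'cV[R]_k -> 'cV[R]_k) (B : 'I_p -> R -> R) (c1 : 'cV[R]_k) (c2 : 'cV[R]_p).
Variables (f : R -> 'cV[R]_k) (e X : R -> 'cV[R]_p).
Variables (Y : 'I_r + 'I_p -> R -> R).
Hypothesis cb : forall j, continuous (fun x => b x j ord0 : R).
Hypothesis cB : forall i, continuous (B i).
Hypothesis cf : forall j, {within `[0, T], continuous (fun t => f t j ord0)}.
Hypothesis ce : forall i, {within `[0, T], continuous (fun t => e t i ord0)}.
Hypothesis fE : forall t j, 0 <= t <= T ->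
  f t j ord0 = c1 j ord0 + primitive (fun s => b (f s) j ord0) t +
    (S *m \col_l Y (inl l) t) j ord0.
Hypothesis eE : forall t i, 0 <= t <= T ->
  e t i ord0 = c2 i ord0 + primitive (fun s => B i (e s i ord0)) t + sigma theta i * Y (inr i) t.
Hypothesis XE : forall t, 0 <= t <= T -> X t = Lambda kp theta *m f t + e t.

Definition factor_drift (a : 'I_p) (s : R) : R :=
  \sum_j Lambda kp theta a j * b (f s) j ord0 + B a (e s a ord0).

Lemma continuous_loading_drift j : {within `[0, T], continuous (fun s => b (f s) j ord0)}.
Proof.
move=> s.
have cfs : f @ (nbhs (s : subspace `[0, T])) --> f s.
  by apply: (cvg_mx_entries (nbhs_filter _)) => i l; rewrite ord1; exact: cf.
exact: (cvg_comp _ _ cfs (@cb j (f s))).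
Qed.

Lemma continuous_noise_drift i : {within `[0, T], continuous (fun s => B i (e s i ord0))}.
Proof. move=> s; exact: (cvg_comp _ _ (@ce i s) (@cB i (e s i ord0))). Qed.

Lemma continuous_combination (J : Type) (s : seq J) (c : J -> R) (phi : J -> R -> R) (psi : R -> R) :
  (forall j, {within `[0, T], continuous (phi j)}) -> {within `[0, T], continuous psi} ->
  {within `[0, T], continuous (fun u => \sum_(j <- s) c j * phi j u + psi u)}.
Proof.
move=> cphi cpsi u; apply: cvgD; last exact: cpsi.
apply: cvg_sum_fun => j; apply: cvgM; [exact: cvg_cst|exact: cphi].
Qed.

Lemma continuous_factor_drift a : {within `[0, T], continuous (factor_drift a)}.
Proof.
apply: continuous_combination; first exact: continuous_loading_drift.
exact: continuous_noise_drift.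
Qed.

Lemma primitive_combination (J : Type) (s : seq J) (c : J -> R) (phi : J -> R -> R)
    (psi : R -> R) (t : R) :
  (forall j, {within `[0, T], continuous (phi j)}) -> {within `[0, T], continuous psi} ->
  0 <= t <= T ->
  primitive (fun u => \sum_(j <- s) c j * phi j u + psi u) t =
  \sum_(j <- s) c j * primitive (phi j) t + primitive psi t.
Proof.
move=> cphi cpsi /andP[t0 tT].
have int (g : R -> R) : {within `[0, T], continuous g} ->
    lebesgue_measure.-integrable `[0, t]%classic (EFin \o g).
  move=> cg; apply: continuous_compact_integrable; first exact: segment_compact.
  by apply: continuous_subspaceW cg; apply: subset_itvScc; rewrite bnd_simp.
have mI : measurable (`[0, t]%classic : set (measurableTypeR R)) by exact: measurable_itv.
elim: s => [|j s IH].
  by rewrite big_nil add0r /primitive; apply: eq_Rintegral => u _; rewrite big_nil add0r.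
rewrite big_cons -addrA -IH /primitive -RintegralZl//; last exact: int.
rewrite -RintegralD//.
- by apply: eq_Rintegral => u _; rewrite big_cons addrA.
- by apply: eq_integrable (integrableZl mI (c j) (int _ (cphi j))).
- by apply: int; exact: continuous_combination.
Qed.

(** Linearity of the integral gathers all drifts into one primitive, and [split] matches the columns
    of [noise_mx] with the two families of Wiener processes. *)
Lemma factor_path t a : 0 <= t <= T ->
  X t a ord0 = (Lambda kp theta *m c1 + c2) a ord0 +
    \sum_c noise_mx kp theta S a c * Y (fintype.split c) t + primitive (factor_drift a) t.
Proof.
move=> tT; rewrite XE// mxE eE// mxE.
rewrite (eq_bigr (fun j => Lambda kp theta a j * c1 j ord0 +
  Lambda kp theta a j * primitive (fun s => b (f s) j ord0) t +
  Lambda kp theta a j * (S *m \col_l Y (inl l) t) j ord0)); last first.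
  by move=> j _; rewrite fE// !mulrDr.
rewrite !big_split/= primitive_combination//; last 2 first.
- exact: continuous_loading_drift.
- exact: continuous_noise_drift.
rewrite big_split_ord/= [(_ + c2) a ord0]mxE [(Lambda kp theta *m c1) a ord0]mxE.
have -> : \sum_(l < r) noise_mx kp theta S a (lshift p l) * Y (fintype.split (lshift p l)) t =
    \sum_j Lambda kp theta a j * (S *m \col_l Y (inl l) t) j ord0.
  transitivity ((Lambda kp theta *m S *m \col_l Y (inl l) t) a ord0).
    rewrite mxE; apply: eq_bigr => l _.
    by rewrite (unsplitK (inl l)) /noise_mx row_mxEl [(\col_l _) l ord0]mxE.
  by rewrite -mulmxA mxE.
have -> : \sum_(i < p) noise_mx kp theta S a (rshift r i) * Y (fintype.split (rshift r i)) t =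
    sigma theta a * Y (inr a) t.
  rewrite (bigD1 a)//= big1 ?addr0 => [|i ia].
    by rewrite (unsplitK (inr a)) /noise_mx row_mxEr !mxE eqxx mulr1n.
  by rewrite /noise_mx row_mxEr !mxE eq_sym (negbTE ia) mulr0n mul0r.
ring.
Qed.

End factor_path.

Lemma row_form_entry (R : pzRingType) (m n : nat) (A : 'M[R]_(m, n)) (Z : 'M[R]_n) i j :
  (row i A *m Z *m (row j A)^T) ord0 ord0 = (A *m Z *m A^T) i j.
Proof. by rewrite -row_mul mxE [RHS]mxE; apply: eq_bigr => l _; rewrite !mxE. Qed.

Unset Implicit Arguments.

Theorem theorem7 (R : realType) (p k r : nat)
  (k_gt0 : (0 < k)%N) (k_lt_p : (k < p)%N) (r_gt0 : (0 < r)%N)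
  (* parameter space and true parameter *)
  (Theta : set 'cV[R]_(qdim p k))
  (Theta_convex : convex_set (Theta : set (convex_lmodType 'cV[R]_(qdim p k))))
  (Theta_compact : compact Theta)
  (Theta_ff : forall theta, Theta theta ->
     exists S : 'M[R]_(k, r), Sigma_ff theta = S *m S^T)
  (theta0 : 'cV[R]_(qdim p k)) (theta0_int : Theta° theta0)
  (S0 : 'M[R]_(k, r)) (S0_ff : Sigma_ff theta0 = S0 *m S0^T)
  (* driving Wiener processes *)
  (d : measure_display) (Omega : measurableType d) (P : probability Omega R)
  (T : R) (T_gt0 : 0 < T)
  (W : R -> Omega -> 'cV[R]_r) (Bw : 'I_p -> R -> Omega -> R)
  (W_wiener : forall j, wiener P T (fun t omega => W t omega j ord0))
  (Bw_wiener : forall i, wiener P T (Bw i))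
  (WB_indep : independent_families P (fun l : 'I_r + 'I_p =>
     match l with
     | inl j => history (fun t omega => W t omega j ord0) T
     | inr i => history (Bw i) T
     end))
  (* the k-factor model, i.e. the null hypothesis *)
  (b0 : 'cV[R]_k -> 'cV[R]_k) (B0 : 'I_p -> R -> R)
  (c1 : 'cV[R]_k) (c2 : 'cV[R]_p)
  (f : R -> Omega -> 'cV[R]_k) (e : R -> Omega -> 'cV[R]_p)
  (X : R -> Omega -> 'cV[R]_p)
  (f_sde : forall j, solves_sde P T (c1 j ord0)
     (fun t omega => b0 (f t omega) j ord0)
     (fun t omega => (S0 *m W t omega) j ord0)
     (fun t omega => f t omega j ord0))
  (e_sde : forall i, solves_sde P T (c2 i ord0)
     (fun t omega => B0 i (e t omega i ord0))
     (fun t omega => sigma theta0 i * Bw i t omega)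
     (fun t omega => e t omega i ord0))
  (X_model : forall t omega, 0 <= t <= T ->
     X t omega = Lambda (ltnW k_lt_p) theta0 *m f t omega + e t omega)
  (* (i) *)
  (b0_lip : exists2 C : R, 0 < C &
     forall x y, enorm (b0 x - b0 y) <= C * enorm (x - y))
  (f_moments : bounded_moments P T f)
  (b0_smooth : forall j, C_up 4 (fun x => b0 x j ord0))
  (* (ii) *)
  (B0_lip : exists2 C : R, 0 < C &
     forall x y i, `|B0 i x - B0 i y| <= C * `|x - y|)
  (e_moments : bounded_moments P T e)
  (B0_smooth : forall i, C_up 4 (fun x : 'cV[R]_1 => B0 i (x ord0 ord0)))
  (* (iii) *)
  (sigma_gt0 : forall theta, Theta theta -> forall i, 0 < sigma theta i)
  (* (iv) *)
  (ident : forall theta, Theta theta ->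
     Sigma (ltnW k_lt_p) theta = Sigma (ltnW k_lt_p) theta0 -> theta = theta0)
  (* (v) *)
  (rank_Delta : \rank (Delta (ltnW k_lt_p) theta0) = qdim p k)
  (* minimum contrast estimator *)
  (theta_hat : nat -> Omega -> 'cV[R]_(qdim p k))
  (theta_hat_min : forall n omega, (0 < n)%N ->
     is_minimizer Theta (contrast (ltnW k_lt_p) (QXX T X n omega))
       (theta_hat n omega)) :
  cvg_in_distribution P
    (fun n omega => n%:R *
       contrast (ltnW k_lt_p) (QXX T X n omega) (theta_hat n omega))
    (chi2 R (pbar p - qdim p k)).
Proof.
have Tin : Theta theta0 by exact: interior_subset theta0_int.
set kp := ltnW k_lt_p in X_model ident rank_Delta theta_hat_min *.
pose Y (l : 'I_r + 'I_p) : R -> Omega -> R :=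
  match l with inl j => fun t w => W t w j ord0 | inr i => Bw i end.
have wY l : wiener P T (Y l) by case: l => [j|i]; [exact: W_wiener|exact: Bw_wiener].
have iY : independent_families P (fun l => history (Y l) T).
  by move=> E hE; apply: WB_indep => l; move: (hE l); case: l.
pose N := noise_mx kp theta0 S0.
have SN : Sigma kp theta0 = N *m N^T by exact: noise_mx_factor S0_ff (sigma_gt0 theta0 Tin).
have [M MWM expand] := contrast_expansion Theta_compact Theta_ff sigma_gt0 theta0_int ident rank_Delta.
pose G (c : 'cV[R]_(pbar p)) (u v : 'I_r + 'I_p) := (N^T *m vech_dual c *m N) (unsplit u) (unsplit v).
have symG c u v : G c u v = G c v u.
  have sA : (N^T *m vech_dual c *m N)^T = N^T *m vech_dual c *m N.
    by rewrite !trmx_mul trmxK vech_dual_sym mulmxA.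
  by rewrite /G -[in LHS]sA mxE.
(* For positive [n] the form sums of [H j] and [D l] are the [j]-th coordinate of $Ma_n$ and the
   [l]-th coordinate of $a_n$; [q] and [B] are the squared lengths of these two vectors. *)
pose H j := G (row j M)^T; pose D l := G (delta_mx l ord0).
pose q n w := \sum_j form_sum T Y n (H j) w ^+ 2.
pose B n w := \sum_l form_sum T Y n (D l) w ^+ 2.
(* The value of $\mathbb E|a_n|^2$ for every positive [n], by the variance formula for form sums. *)
pose C := \sum_l 2 * \sum_ab D l ab.1 ab.2 ^+ 2.
pose a n w := Num.sqrt n%:R *: (vech (N *m @noise_covariation R d Omega T r p Y n w *m N^T) - vech (N *m N^T)).
have aE c n w : (0 < n)%N -> (c^T *m a n w) ord0 ord0 = form_sum T Y n (G c) w.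
  exact: vech_covariation_form_sum.
have qE n w : (0 < n)%N -> ((M *m a n w)^T *m (M *m a n w)) ord0 ord0 = q n w.
  move=> n0; rewrite mulmx_sqrE; apply: eq_bigr => j _.
  by rewrite -(aE _ _ _ n0) trmxK -row_mul [in RHS]mxE.
have BE n w : (0 < n)%N -> ((a n w)^T *m a n w) ord0 ord0 = B n w.
  move=> n0; rewrite mulmx_sqrE; apply: eq_bigr => l _.
  by rewrite -(aE _ _ _ n0) trmx_delta -rowE [in RHS]mxE.
(* As $W$ is twice the Frobenius pairing, $MWM^\top=1$ says that the matrices [H j] are orthogonal
   with squared norm $1/2$. *)
have orthH i j : \sum_(ab : ('I_r + 'I_p) * ('I_r + 'I_p)) H i ab.1 ab.2 * H j ab.1 ab.2 = (i == j)%:R / 2.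
  have -> : \sum_(ab : ('I_r + 'I_p) * ('I_r + 'I_p)) H i ab.1 ab.2 * H j ab.1 ab.2 =
      \sum_(ab : 'I_(r + p) * 'I_(r + p)) (N^T *m vech_dual (row i M)^T *m N) ab.1 ab.2 *
        (N^T *m vech_dual (row j M)^T *m N) ab.1 ab.2.
    rewrite (reindex (fun ab : 'I_(r + p) * 'I_(r + p) => (fintype.split ab.1, fintype.split ab.2)))/=.
      by apply: eq_bigr => ab _; rewrite /H /G !splitK.
    exists (fun uv => (unsplit uv.1, unsplit uv.2)) => -[u v] _ /=; by rewrite ?splitK ?unsplitK.
  rewrite -vech_dual_form -SN; apply: (@mulfI _ 2); first by rewrite pnatr_eq0.
  rewrite mulrCA divff ?pnatr_eq0// mulr1.
  have := congr1 (fun A : 'M[R]_(_, _) => A i j) MWM; rewrite /= [RHS]mxE => <-.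
  by rewrite -row_form_entry /Wmx trmxK -scalemxAr -scalemxAl [RHS]mxE.
have mX t i : 0 <= t <= T -> measurable_fun setT (fun w => X t w i ord0).
  move=> tT; rewrite (_ : (fun w => _) = fun w => \sum_j Lambda kp theta0 i j * f t w j ord0 + e t w i ord0); last first.
    by apply/funext => w; rewrite X_model// mxE [X in X + _]mxE.
  apply: measurable_funD; last by have [m _ _] := e_sde i; exact: m.
  apply: measurable_sum_fun => j; apply: measurable_funM; first exact: measurable_cst.
  by have [m _ _] := f_sde j; exact: m.
have mQ n i j : (0 < n)%N -> measurable_fun setT (fun w => QXX T X n w i j).
  move=> n0.
  rewrite (_ : (fun w => _) = fun w => T^-1 * \sum_(l < n)
     ((X (l.+1%:R * (T / n%:R)) w i ord0 - X (l%:R * (T / n%:R)) w i ord0) *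
      (X (l.+1%:R * (T / n%:R)) w j ord0 - X (l%:R * (T / n%:R)) w j ord0))); last first.
    apply/funext => w; rewrite mxE summxE; congr (_ * _); apply: eq_bigr => l _.
    by rewrite mxE big_ord1 !mxE.
  apply: measurable_funM; first exact: measurable_cst.
  apply: measurable_sum_fun => l.
  by apply: measurable_funM; apply: measurable_funB; apply: mX; apply: grid_time_in => //; exact: ltnW.
pose V n w := n%:R * contrast kp (QXX T X n w) (theta_hat n w).
have mV n : measurable_fun setT (V n).
  (* At $n=0$ no minimizer is given, but the factor [n%:R] makes the statistic zero. *)
  case: n => [|n].
    by rewrite (_ : V 0%N = cst 0) //; apply/funext => w; rewrite /V mul0r.
  apply: measurable_funM; first exact: measurable_cst.
  apply: (measurable_contrast_min Tin Theta_ff sigma_gt0) => [i j|w]; first exact: mQ.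
  exact: theta_hat_min.
have V_ge0 n w : 0 <= V n w.
  case: n => [|n]; first by rewrite /V mul0r.
  have [Tn _] := theta_hat_min n.+1 w isT.
  rewrite /V mulr_ge0// /contrast; set u := _ - _.
  have [_ pV] := posdef_inv (posdef_Wmx_in kp Theta_ff sigma_gt0 Tn).
  by have [->|u0] := eqVneq u 0; [rewrite mulmx0 mxE|exact/ltW/pV].
have mfs n (K : 'I_r + 'I_p -> 'I_r + 'I_p -> R) : measurable_fun setT (form_sum T Y n K).
  exact: (measurable_form_sum T_gt0 wY).
have near_zero : {ae P, forall w,
    (fun n => Num.min 1 `|V n w - q n w| / (1 + B n w)) @ \oo --> (0 : R)}.
  have aef (j : 'I_k) : {ae P, forall w, {within `[0, T], continuous (fun t => f t w j ord0)} /\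
      forall t : R, 0 <= t <= T -> f t w j ord0 =
        c1 j ord0 + primitive (fun s => b0 (f s w) j ord0) t + (S0 *m W t w) j ord0}.
    by have [_ h1 h2] := f_sde j; apply: filterS2 h1 h2.
  have aee (i : 'I_p) : {ae P, forall w, {within `[0, T], continuous (fun t => e t w i ord0)} /\
      forall t : R, 0 <= t <= T -> e t w i ord0 =
        c2 i ord0 + primitive (fun s => B0 i (e s w i ord0)) t + sigma theta0 i * Bw i t w}.
    by have [_ h1 h2] := e_sde i; apply: filterS2 h1 h2.
  have aeY l : {ae P, forall w, {within `[0, T], continuous (fun t => Y l t w)}}.
    by have [] := wY l.
  (* Finitely many almost sure properties hold together; from here on the path [w] is fixed and the
     argument is deterministic. *)
  apply: filterS3 (filter_forall _ aef) (filter_forall _ aee) (filter_forall _ aeY) => w hf he hY.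
  have cb j : continuous (fun x => b0 x j ord0 : R) by case: (b0_smooth j).
  have cB i : continuous (B0 i).
    have [c _ _] := B0_smooth i => z.
    have cz : (fun z : R => const_mx z : 'cV[R]_1) @ z --> (const_mx z : 'cV[R]_1).
      by apply: (cvg_mx_entries (nbhs_filter z)) => i1 j1; under eq_fun do rewrite mxE; rewrite mxE; exact: cvg_id.
    have -> : B0 i = (fun x : 'cV[R]_1 => B0 i (x ord0 ord0)) \o (fun z => const_mx z).
      by apply/funext => y /=; rewrite mxE.
    exact: (continuous_comp cz (@c (const_mx z))).
  pose x n := vech (QXX T X n w) - vech (Sigma kp theta0).
  have t_exp e1 : 0 < e1 -> exists2 dl, 0 < dl & forall n, (0 < n)%N -> `|x n| < dl ->
      `|contrast kp (QXX T X n w) (theta_hat n w) - ((M *m x n)^T *m (M *m x n)) ord0 ord0| <=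
      e1 * `|x n| ^+ 2.
    move=> e10; have [dl dl0 h] := expand e1 e10; exists dl => // n n0 xd.
    by apply: h => //; exact: theta_hat_min.
  have x_near e1 : 0 < e1 -> \forall n \near \oo,
      `|Num.sqrt n%:R *: x n - a n w| <= e1 * (1 + `|a n w|).
    move=> e10.
    have fE t j : 0 <= t <= T -> f t w j ord0 = c1 j ord0 +
        primitive (fun s => b0 (f s w) j ord0) t + (S0 *m \col_l Y (inl l) t w) j ord0.
      move=> tT; have [_ ->//] := hf j; congr (_ + (_ *m _) j ord0).
      by apply/colP => l; rewrite mxE.
    have cYw c : {within `[0, T], continuous (fun t => Y (fintype.split c) t w)} by exact: hY.
    have cphi i := @continuous_factor_drift R p k kp T theta0 b0 B0 (f^~ w) (e^~ w) cb cB
      (fun j => (hf j).1) (fun i => (he i).1) i.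
    have XE t i (tT : 0 <= t <= T) := @factor_path R p k r kp T theta0 S0 b0 B0 c1 c2
      (f^~ w) (e^~ w) (X^~ w) (fun l t => Y l t w) cb cB (fun j => (hf j).1) (fun i => (he i).1)
      fE (fun t i => (he i).2 t) (fun t => X_model t w) t i tT.
    have := covariation_perturbation T_gt0 cYw cphi XE (N *m N^T) e10.
    apply: filterS => n hn; rewrite /a noise_covariation_congr; apply: le_trans hn.
    rewrite /x SN -scalerBr opprB addrA subrK; exact: lexx.
  have := min_contrast_rate t_exp x_near; apply: cvg_trans; apply: near_eq_cvg.
  near=> n; have n0 : (0 < n)%N by near: n; exact: nbhs_infty_gt.
  by rewrite (qE _ _ n0) (BE _ _ n0).
apply: laplace_cvg_in_distribution => //; first exact: chi2_ge0.
move=> l l0.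
have -> : \int[chi2 R (pbar p - qdim p k)]_x expR (- (l * x)) =
    (Num.sqrt (1 + 2 * l))^-1 ^+ (pbar p - qdim p k) by rewrite /Rintegral laplace_chi2.
apply: (laplace_perturbation (S := V) (q := q) (B := B) (C := C)) => //.
- by move=> n; apply: measurable_sum_fun => j; apply: measurable_funX.
- by move=> n; apply: measurable_sum_fun => j; apply: measurable_funX.
- by move=> n w; apply: sumr_ge0 => j _; exact: sqr_ge0.
- by move=> n w; apply: sumr_ge0 => j _; exact: sqr_ge0.
- move=> n n0; apply: has_moments_integrable; apply: has_moments_sum => j.
  by apply: has_momentsX; exact: (form_sum_has_moments T_gt0 wY).
- move=> n n0; rewrite expectation_sum_fun => [|j]; last first.
    by apply: has_moments_integrable; apply: has_momentsX; exact: (form_sum_has_moments T_gt0 wY).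
  by apply: ler_sum => j _; rewrite (expectation_form_sum_sqr T_gt0 wY iY n0 (symG _)).
(* Since $r>0$, the first coordinate of [W] can carry the auxiliary Gaussian direction. *)
- exact: (laplace_clt T_gt0 (inl (Ordinal r_gt0)) wY iY (fun j => symG _) orthH l0).
Unshelve. all: by end_near. Qed.
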